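(* Let $\phi$ be an $\mathbb H^{n\times n}$-valued rational slice hyperholomorphic function, slice hyperholomorphic at infinity, with minimal realization $$\phi(p)=D+C\star(pI_N-A)^{-\star}B,$$ where $(C,A,B)\in\mathbb H^{n\times N}\times\mathbb H^{N\times N}\times\mathbb H^{N\times n}$ and $D\in\mathbb H^{n\times n}$. Then the kernel $$(\phi(p)+\phi(q)^* )\star(p+\overline q)^{-\star},\qquad p,q\in\mathbb H_+,$$ is positive definite on $\mathbb H_+$ if and only if there exists a negative definite matrix $H\in\mathbb H^{N\times N}$ such that $$\begin{pmatrix}H&0\\0&I_n\end{pmatrix}\begin{pmatrix}A&B\\C&D\end{pmatrix}+\begin{pmatrix}A&B\\C&D\end{pmatrix}^*\begin{pmatrix}H&0\\0&I_n\end{pmatrix}\ge 0.$$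
   Context: $\mathbb H$ is the skew field of quaternions, $\mathbb H_+=\{p\in\mathbb H:\operatorname{Re}p>0\}$, and $\mathbb S$ is the sphere of purely imaginary quaternions of norm $1$. A set $\Omega\subseteq\mathbb H$ is axially symmetric if $x+Iy\in\Omega$ ($x,y\in\mathbb R$, $I\in\mathbb S$) implies $x+Jy\in\Omega$ for all $J\in\mathbb S$. A matrix-valued function $f$ on an axially symmetric open set is (left) slice hyperholomorphic if $f(x+Iy)=\alpha(x,y)+I\beta(x,y)$ with $\alpha,\beta$ depending only on $x,y$, real differentiable, $\partial_x\alpha=\partial_y\beta$, $\partial_y\alpha=-\partial_x\beta$, $\alpha(x,-y)=\alpha(x,y)$, $\beta(x,-y)=-\beta(x,y)$. ''Slice hyperholomorphic at infinity'' means slice hyperholomorphic in a set of the form $|p|>r$. The $\star$-product of $f=\alpha+I\beta$ and $g=\gamma+I\delta$ is $f\star g=(\alpha\gamma-\beta\delta)+I(\alpha\delta+\beta\gamma)$. The function $C\star(pI_N-A)^{-\star}B$ is the slice hyperholomorphic extension of $x\mapsto C(xI_N-A)^{-1}B$, $x$ real; for $|p|$ large it equals $\sum_{t\ge0}p^{-t-1}CA^tB$. In the kernel, the $\star$-product is taken in the variable $p$, and $(p+\overline q)^{-\star}=(|q|^2+2\operatorname{Re}(q)p+p^2)^{-1}(p+q)$. The realization is minimal if $\bigcap_{t\ge0}\ker CA^t=\{0\}$ and $\bigcap_{t\ge0}\ker B^*A^{*t}=\{0\}$. An $\mathbb H^{n\times n}$-valued function $K(u,v)$ with $K(u,v)=K(v,u)^*$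 on $\Omega\times\Omega$ is positive definite on $\Omega$ if for all $M\in\mathbb N$, $u_1,\dots,u_M\in\Omega$ and $\xi_1,\dots,\xi_M\in\mathbb H^n$, the Hermitian matrix with $(k,j)$ entry $\xi_k^*K(u_k,u_j)\xi_j$ has no strictly negative eigenvalues. For a Hermitian quaternionic matrix $X$, $X\ge0$ means positive semidefinite; a negative definite matrix is Hermitian with all eigenvalues strictly negative. *)

(* Defs.v *)
From HB Require Import structures.
From mathcomp Require Import all_boot all_order all_algebra ring lra.
From mathcomp Require Import all_classical all_reals all_analysis.

Set Implicit Arguments.
Unset Strict Implicit.
Unset Printing Implicit Defensive.

Import Order.TTheory GRing.Theory Num.Theory.
Import numFieldNormedType.Exports.

Local Open Scope classical_set_scope.
Local Open Scope ring_scope.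

Record quat (R : realType) := Quat {qre : R; qi : R; qj : R; qk : R}.

Section QuaternionRing.
Variable R : realType.
Notation H := (quat R).

Definition quat_to_prod (p : H) := (qre p, qi p, qj p, qk p).
Definition quat_of_prod (t : R * R * R * R) : H :=
  let: (a, b, c, d) := t in Quat a b c d.
Lemma quat_to_prodK : cancel quat_to_prod quat_of_prod.
Proof. by case. Qed.
HB.instance Definition _ := Choice.copy H (can_type quat_to_prodK).

Definition qzero : H := Quat 0 0 0 0.
Definition qopp (p : H) : H := Quat (- qre p) (- qi p) (- qj p) (- qk p).
Definition qadd (p q : H) : H :=
  Quat (qre p + qre q) (qi p + qi q) (qj p + qj q) (qk p + qk q).

Lemma qaddA : associative qadd.
Proof. by move=> [? ? ? ?] [? ? ? ?] [? ? ? ?]; congr Quat; rewrite /= addrA. Qed.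
Lemma qaddC : commutative qadd.
Proof. by move=> [? ? ? ?] [? ? ? ?]; congr Quat; rewrite /= addrC. Qed.
Lemma qadd0 : left_id qzero qadd.
Proof. by move=> [? ? ? ?]; congr Quat; rewrite /= add0r. Qed.
Lemma qaddN : left_inverse qzero qopp qadd.
Proof. by move=> [? ? ? ?]; congr Quat; rewrite /= addNr. Qed.
HB.instance Definition _ := GRing.isZmodule.Build H qaddA qaddC qadd0 qaddN.

Definition qreal (x : R) : H := Quat x 0 0 0.
Definition qmul (p q : H) : H :=
  let: Quat a b c d := p in let: Quat a' b' c' d' := q in
  Quat (a * a' - b * b' - c * c' - d * d')
       (a * b' + b * a' + c * d' - d * c')
       (a * c' - b * d' + c * a' + d * b')
       (a * d' + b * c' - c * b' + d * a').

Lemma qmulA : associative qmul.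
Proof. by move=> [? ? ? ?] [? ? ? ?] [? ? ? ?]; congr Quat; rewrite /=; ring. Qed.
Lemma qmul1 : left_id (qreal 1) qmul.
Proof. by move=> [? ? ? ?]; congr Quat; rewrite /=; ring. Qed.
Lemma qmulr1 : right_id (qreal 1) qmul.
Proof. by move=> [? ? ? ?]; congr Quat; rewrite /=; ring. Qed.
Lemma qmulDl : left_distributive qmul qadd.
Proof. by move=> [? ? ? ?] [? ? ? ?] [? ? ? ?]; congr Quat; rewrite /=; ring. Qed.
Lemma qmulDr : right_distributive qmul qadd.
Proof. by move=> [? ? ? ?] [? ? ? ?] [? ? ? ?]; congr Quat; rewrite /=; ring. Qed.
Lemma qone_neq0 : qreal 1 != 0 :> H.
Proof. by apply/eqP => -[/eqP]; rewrite oner_eq0. Qed.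
HB.instance Definition _ := GRing.Zmodule_isNzRing.Build H
  qmulA qmul1 qmulr1 qmulDl qmulDr qone_neq0.

Definition qconj (p : H) : H := Quat (qre p) (- qi p) (- qj p) (- qk p).
Definition qnormsq (p : H) : R :=
  qre p ^+ 2 + qi p ^+ 2 + qj p ^+ 2 + qk p ^+ 2.
Definition qnorm (p : H) : R := Num.sqrt (qnormsq p).
Definition qinv (p : H) : H := qmul (qreal (qnormsq p)^-1) (qconj p).

Lemma qnormsq_eq0 p : (qnormsq p == 0) = (p == 0).
Proof.
case: p => a b c d; rewrite /qnormsq /=.
apply/idP/eqP => [|[-> -> -> ->]]; last by rewrite expr0n /= !addr0.
rewrite !paddr_eq0 ?addr_ge0 ?sqr_ge0// !sqrf_eq0.
by move=> /andP[/andP[/andP[/eqP-> /eqP->] /eqP->] /eqP->].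
Qed.

Lemma qmulVq : {in [pred p : H | p != 0], left_inverse 1 qinv *%R}.
Proof.
move=> p; rewrite inE -qnormsq_eq0; case: p => a b c d; rewrite /qnormsq /= => n0.
by congr Quat; rewrite /= /qnormsq /=; field.
Qed.
Lemma qmulqV : {in [pred p : H | p != 0], right_inverse 1 qinv *%R}.
Proof.
move=> p; rewrite inE -qnormsq_eq0; case: p => a b c d; rewrite /qnormsq /= => n0.
by congr Quat; rewrite /= /qnormsq /=; field.
Qed.
Lemma qunitP (x y : H) : y * x = 1 /\ x * y = 1 -> [pred p : H | p != 0] x.
Proof.
move=> [yx _] /=; apply/eqP => x0; move: yx; rewrite x0 mulr0 => /esym/eqP.
by rewrite oner_eq0.
Qed.
Lemma qinv_out : {in [predC [pred p : H | p != 0]], qinv =1 id}.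
Proof.
move=> p; rewrite !inE negbK => /eqP->.
by congr Quat; rewrite /= ?oppr0; ring.
Qed.
HB.instance Definition _ := GRing.NzRing_hasMulInverse.Build H
  qmulVq qmulqV qunitP qinv_out.

End QuaternionRing.

Section SliceFunctions.
Variable R : realType.
Notation H := (quat R).

Definition qvec (p : H) : 'rV[R]_4 :=
  \row_(k < 4) [:: qre p; qi p; qj p; qk p]`_k.

Definition qopen (Omega : set H) : Prop := open (@qvec @` Omega).

Definition imag_sphere : set H := [set I | qre I = 0 /\ qnorm I = 1].

Definition half_space : set H := [set p | 0 < qre p].

Definition slice_point (x y : R) (I : H) : H := qreal x + I * qreal y.

Definition axially_symmetric (Omega : set H) : Prop :=
  forall (x y : R) (I J : H), imag_sphere I -> imag_sphere J ->
    Omega (slice_point x y I) -> Omega (slice_point x y J).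

(* Functions are total; their values outside the set [Omega] under
   consideration are irrelevant. *)
Definition slice_components m n (Omega : set H) (f : H -> 'M[H]_(m, n))
    (alpha beta : R -> R -> 'M[H]_(m, n)) : Prop :=
  forall (x y : R) (I : H), imag_sphere I -> Omega (slice_point x y I) ->
    [/\ f (slice_point x y I) = alpha x y + I *: beta x y,
        alpha x (- y) = alpha x y & beta x (- y) = - beta x y].

(* Real differentiability is that of each entry, as a map R^2 -> R^4. *)
Definition mx_differentiable m n (alpha : R -> R -> 'M[H]_(m, n)) (x y : R) :=
  forall i j,
    differentiable (fun z : R * R => qvec (alpha z.1 z.2 i j)) (x, y).

Definition partial_x m n (alpha : R -> R -> 'M[H]_(m, n)) x y i j : 'rV[R]_4 :=
  derive1 (fun t : R => qvec (alpha t y i j)) x.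
Definition partial_y m n (alpha : R -> R -> 'M[H]_(m, n)) x y i j : 'rV[R]_4 :=
  derive1 (fun t : R => qvec (alpha x t i j)) y.

Definition slice_hyperholomorphic m n (Omega : set H)
    (f : H -> 'M[H]_(m, n)) : Prop :=
  [/\ qopen Omega, axially_symmetric Omega &
   exists alpha beta : R -> R -> 'M[H]_(m, n),
     slice_components Omega f alpha beta /\
     forall (x y : R) (I : H), imag_sphere I -> Omega (slice_point x y I) ->
       [/\ mx_differentiable alpha x y, mx_differentiable beta x y,
           forall i j, partial_x alpha x y i j = partial_y beta x y i j &
           forall i j, partial_y alpha x y i j = - partial_x beta x y i j]].

Definition slice_hyperholomorphic_at_infinity m n (Omega : set H)
    (f : H -> 'M[H]_(m, n)) : Prop :=
  exists r : R, [set p | r < qnorm p] `<=` Omega /\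
    slice_hyperholomorphic [set p | r < qnorm p] f.

(* A rational function is [d(p)^-1 * \sum_k p^k P_k] with a real scalar
   denominator [d]: real polynomials are central for the star product, and
   every quaternionic denominator can be made real.  [Omega] is the natural
   domain of [f]: it omits at most zeros of [d], and no point to which [f]
   extends slice hyperholomorphically, so its complement consists exactly of
   the poles of [f]. *)
Definition rational_slice_hyperholomorphic m n (Omega : set H)
    (f : H -> 'M[H]_(m, n)) : Prop :=
  [/\ slice_hyperholomorphic Omega f,
      exists (d : {poly R}) (l : nat) (P : nat -> 'M[H]_(m, n)),
        [/\ d != 0,
            forall p, (map_poly (@qreal R) d).[p] != 0 -> Omega p &
            forall p, Omega p ->
              (map_poly (@qreal R) d).[p] *: f p
              = \sum_(k < l) p ^+ k *: P k] &
      forall (Omega' : set H) (g : H -> 'M[H]_(m, n)),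
        slice_hyperholomorphic Omega' g -> Omega `<=` Omega' ->
        (forall p, Omega p -> g p = f p) -> Omega' `<=` Omega].

(* For p = x + I y with y >= 0, [slice_unit p] is I (an arbitrary element of
   the sphere when p is real), and alpha(x, y), beta(x, y) are recovered from
   f(x + I y) and f(x - I y); see [starE]. *)
Definition slice_unit (p : H) : H :=
  let v := p - qreal (qre p) in
  if v == 0 then Quat 0 1 0 0 else v * qreal (qnorm v)^-1.
Definition alpha_part m n (f : H -> 'M[H]_(m, n)) (p : H) : 'M[H]_(m, n) :=
  qreal 2^-1 *: (f p + f (qconj p)).
Definition beta_part m n (f : H -> 'M[H]_(m, n)) (p : H) : 'M[H]_(m, n) :=
  qreal 2^-1 *: (slice_unit p *: (f (qconj p) - f p)).

Definition star m n l (f : H -> 'M[H]_(m, n)) (g : H -> 'M[H]_(n, l))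
    (p : H) : 'M[H]_(m, l) :=
  (alpha_part f p *m alpha_part g p - beta_part f p *m beta_part g p)
  + slice_unit p *:
    (alpha_part f p *m beta_part g p + beta_part f p *m alpha_part g p).

Lemma qrealD x y : qreal (x + y) = qreal x + qreal y :> H.
Proof. by congr Quat; rewrite /= addr0. Qed.
Lemma qrealM x y : qreal (x * y) = qreal x * qreal y :> H.
Proof. by congr Quat; rewrite /=; ring. Qed.
Lemma qrealC x (p : H) : qreal x * p = p * qreal x.
Proof. by case: p => a b c d; congr Quat; rewrite /=; ring. Qed.

Lemma qnormZ x (p : H) : qnorm (p * qreal x) = `|x| * qnorm p.
Proof.
rewrite /qnorm -sqrtr_sqr -sqrtrM ?sqr_ge0//; congr Num.sqrt.
by case: p => a b c d; rewrite /qnormsq /=; ring.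
Qed.

Lemma imag_sphereN (I : H) : imag_sphere I -> imag_sphere (- I).
Proof.
move=> [re0 n1]; split; first by rewrite /= re0 oppr0.
by rewrite -n1; congr Num.sqrt; rewrite /qnormsq /= !sqrrN.
Qed.

Lemma imag_sphere_sqr (I : H) : imag_sphere I -> I * I = - 1.
Proof.
move=> [/=]; case: I => a b c d /= -> n1.
have : qnormsq (Quat 0 b c d) = 1.
  rewrite -[LHS]sqr_sqrtr ?[Num.sqrt _]n1 ?expr1n//.
  by rewrite /qnormsq !addr_ge0 ?sqr_ge0.
by rewrite /qnormsq /= => n2; congr Quat; rewrite /=; lra.
Qed.

Lemma qconj_slice_point x y (I : H) : imag_sphere I ->
  qconj (slice_point x y I) = slice_point x (- y) I.
Proof. by case: I => a b c d [/= -> _]; congr Quat; rewrite /=; ring. Qed.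

Lemma slice_pointNN x y (I : H) : slice_point x (- y) (- I) = slice_point x y I.
Proof. by case: I => a b c d; congr Quat; rewrite /=; ring. Qed.

Lemma slice_unit_gt0 x y (I : H) : imag_sphere I -> 0 < y ->
  slice_unit (slice_point x y I) = I.
Proof.
move=> SI y0; rewrite /slice_unit.
have -> : slice_point x y I - qreal (qre (slice_point x y I)) = I * qreal y.
  by case: SI; case: I => a b c d /= -> _; congr Quat; rewrite /=; ring.
have n0 : qnorm (I * qreal y) = y by rewrite qnormZ SI.2 mulr1 gtr0_norm.
have v0 : I * qreal y != 0.
  apply/eqP => v0; move: n0 y0; rewrite v0 /qnorm /qnormsq /= expr0n /= !addr0.
  by rewrite sqrtr0 => <-; rewrite ltxx.
rewrite (negbTE v0) n0 -mulrA -qrealM divff ?gt_eqF//.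
by rewrite [qreal 1]/(1 : H) mulr1.
Qed.

Lemma slice_unit_sphere x (I : H) : imag_sphere (slice_unit (slice_point x 0 I)).
Proof.
rewrite /slice_unit; have -> : slice_point x 0 I = qreal x.
  by case: I => a b c d; congr Quat; rewrite /=; ring.
rewrite subrr eqxx; split => //=.
by rewrite /qnorm /qnormsq /= expr0n expr1n /= !addr0 add0r sqrtr1.
Qed.

Lemma alpha_partE m n Omega (f : H -> 'M[H]_(m, n)) alpha beta x y I :
  slice_components Omega f alpha beta -> imag_sphere I ->
  Omega (slice_point x y I) -> Omega (slice_point x (- y) I) ->
  alpha_part f (slice_point x y I) = alpha x y.
Proof.
move=> fab SI O1 O2; rewrite /alpha_part qconj_slice_point//.
have [-> _ _] := fab _ _ _ SI O1; have [-> _ _] := fab _ _ _ SI O2.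
have [_ -> ->] := fab _ _ _ SI O1.
rewrite scalerN addrACA subrr addr0 scalerDr -scalerDl -qrealD.
have -> : 2^-1 + 2^-1 = 1 :> R by lra.
by rewrite [qreal 1]/(1 : H) scale1r.
Qed.

Lemma beta_partE m n Omega (f : H -> 'M[H]_(m, n)) alpha beta x y I :
  slice_components Omega f alpha beta -> imag_sphere I ->
  Omega (slice_point x y I) -> Omega (slice_point x (- y) I) ->
  slice_unit (slice_point x y I) = I ->
  beta_part f (slice_point x y I) = beta x y.
Proof.
move=> fab SI O1 O2 uI; rewrite /beta_part qconj_slice_point// uI.
have [-> _ _] := fab _ _ _ SI O1; have [-> _ _] := fab _ _ _ SI O2.
have [_ -> ->] := fab _ _ _ SI O1.
rewrite opprD addrACA subrr add0r scalerN -opprD scalerN scalerDr scalerA.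
rewrite imag_sphere_sqr// scaleN1r -opprD opprK scalerDr -scalerDl -qrealD.
have -> : 2^-1 + 2^-1 = 1 :> R by lra.
by rewrite [qreal 1]/(1 : H) scale1r.
Qed.

Lemma starE m n l Omega (f : H -> 'M[H]_(m, n)) (g : H -> 'M[H]_(n, l))
    alpha beta gamma delta x y I :
  axially_symmetric Omega ->
  slice_components Omega f alpha beta -> slice_components Omega g gamma delta ->
  imag_sphere I -> Omega (slice_point x y I) ->
  star f g (slice_point x y I) =
    (alpha x y *m gamma x y - beta x y *m delta x y)
    + I *: (alpha x y *m delta x y + beta x y *m gamma x y).
Proof.
move=> axO fab gcd.
have key z J : slice_unit (slice_point x z J) = J -> imag_sphere J ->
    Omega (slice_point x z J) ->
    star f g (slice_point x z J) =
    (alpha x z *m gamma x z - beta x z *m delta x z)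
    + J *: (alpha x z *m delta x z + beta x z *m gamma x z).
  move=> uJ SJ O1.
  have O2 : Omega (slice_point x (- z) J).
    rewrite -slice_pointNN opprK.
    exact: axO SJ (imag_sphereN SJ) O1.
  rewrite /star uJ (alpha_partE fab)// (alpha_partE gcd)//.
  by rewrite (beta_partE fab)// (beta_partE gcd).
move=> SI Oxy; have [y0|y0|y0] := ltrgtP 0 y.
- by apply: key => //; exact: slice_unit_gt0.
- have SNI := imag_sphereN SI.
  have ONN : Omega (slice_point x (- y) (- I)) by rewrite slice_pointNN.
  rewrite -slice_pointNN key//; last by apply: slice_unit_gt0; rewrite ?oppr_gt0.
  have [_ -> ->] := fab _ _ _ SI Oxy; have [_ -> ->] := gcd _ _ _ SI Oxy.
  by rewrite mulmxN mulNmx opprK mulNmx mulmxN -opprD scaleNr scalerN opprK.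
- rewrite -{y}y0 in Oxy *.
  have d0 k h (u : H -> 'M[H]_(k, h)) a b :
      slice_components Omega u a b -> b x 0 = 0.
    move=> uab; have [_ _] := uab _ _ _ SI Oxy; rewrite oppr0 => b0.
    have : (qreal 2^-1 *: (b x 0 + b x 0)) = 0 by rewrite {1}b0 addNr scaler0.
    rewrite scalerDr -scalerDl -qrealD.
    have -> : 2^-1 + 2^-1 = 1 :> R by lra.
    by rewrite [qreal 1]/(1 : H) scale1r.
  have SJ := slice_unit_sphere x I.
  set J := slice_unit _ in SJ.
  have eIJ : slice_point x 0 I = slice_point x 0 J.
    by rewrite /slice_point [qreal 0]/(0 : H) !mulr0.
  rewrite {1}eIJ key//; last by rewrite -eIJ.
    rewrite (d0 _ _ _ _ _ fab) (d0 _ _ _ _ _ gcd).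
    by rewrite !(mulmx0, mul0mx) addr0 !scaler0.
  by rewrite -eIJ.
Qed.

Definition qadj m n (X : 'M[H]_(m, n)) : 'M[H]_(n, m) := map_mx (@qconj R) X^T.

(* Quaternionic eigenvalues are right eigenvalues; those of a Hermitian matrix
   are real. *)
Definition right_eigenvalue n (X : 'M[H]_n) (lambda : H) : Prop :=
  exists2 v : 'cV[H]_n, v != 0 & X *m v = v *m lambda%:M.

Definition hermitian n (X : 'M[H]_n) : Prop := qadj X = X.

Definition positive_semidefinite n (X : 'M[H]_n) : Prop :=
  hermitian X /\ forall v : 'cV[H]_n, 0 <= qre ((qadj v *m X *m v) ord0 ord0).

Definition negative_definite n (X : 'M[H]_n) : Prop :=
  hermitian X /\
  forall lambda, right_eigenvalue X lambda ->
    exists2 x : R, lambda = qreal x & x < 0.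

Definition positive_definite_kernel n (Omega : set H)
    (K : H -> H -> 'M[H]_n) : Prop :=
  (forall u v, Omega u -> Omega v -> K u v = qadj (K v u)) /\
  forall (M : nat) (u : 'I_M -> H) (xi : 'I_M -> 'cV[H]_n),
    (forall k, Omega (u k)) ->
    forall x : R, x < 0 ->
      ~ right_eigenvalue
          (\matrix_(k < M, j < M)
             (qadj (xi k) *m K (u k) (u j) *m xi j) ord0 ord0) (qreal x).

(* [G] is C * (p I - A)^{-*} B: the slice hyperholomorphic extension to
   [Omega] of x |-> C (x I - A)^-1 B, x real.  The library has no inverse for
   matrices over a noncommutative ring, whence the two-sided inverse [X]. *)
Definition star_resolvent n N (Omega : set H)
    (C : 'M[H]_(n, N)) (A : 'M[H]_N) (B : 'M[H]_(N, n))
    (G : H -> 'M[H]_n) : Prop :=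
  slice_hyperholomorphic Omega G /\
  forall (x : R) (X : 'M[H]_N), Omega (qreal x) ->
    X *m ((qreal x)%:M - A) = 1%:M -> ((qreal x)%:M - A) *m X = 1%:M ->
    G (qreal x) = C *m X *m B.

Definition realization n N (Omega : set H) (phi : H -> 'M[H]_n)
    (A : 'M[H]_N) (B : 'M[H]_(N, n)) (C : 'M[H]_(n, N)) (D : 'M[H]_n) : Prop :=
  exists2 G, star_resolvent Omega C A B G &
    forall p, Omega p -> phi p = D + G p.

Definition minimal_realization n N
    (A : 'M[H]_N) (B : 'M[H]_(N, n)) (C : 'M[H]_(n, N)) : Prop :=
  (forall v : 'cV[H]_N, (forall t : nat, C *m A ^+ t *m v = 0) -> v = 0) /\
  (forall v : 'cV[H]_N,
     (forall t : nat, qadj B *m qadj A ^+ t *m v = 0) -> v = 0).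

(* (p + \bar q)^{-*}, the star inverse being taken in p. *)
Definition star_inv_add_conj (p q : H) : H :=
  (qreal (qnormsq q) + qreal (2 * qre q) * p + p ^+ 2)^-1 * (p + q).

Definition caratheodory_kernel n (phi : H -> 'M[H]_n) (p q : H) : 'M[H]_n :=
  star (fun p' => phi p' + qadj (phi q))
       (fun p' => (star_inv_add_conj p' q)%:M) p.

End SliceFunctions.

Arguments half_space {R}.

(* Main.v *)
(* A kernel [K] on the half-space satisfies [p K + K \bar q = phi(p) + phi(q)^*],
   and since [Re p + Re q > 0] this Sylvester equation determines [K]; the star
   product is not needed beyond this point.  Likewise the star resolvent
   [Gamma(p) = C * (p - A)^{-*}] is handled through [p Gamma - Gamma A = C].

   Necessity only uses the real points [x > 0] outside the spectrum.  For the
   dual system [A^*, C^*, B^*, D^*] the form [sum xi_x^* K(x,y) xi_y] is the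
   energy supplied on [(-oo, 0]] by the exponential input [sum e^{xt} xi_x].  Its
   infimum over the inputs that reach a given state is a quadratic form; an
   implicit Euler step along a trajectory gives the dissipation inequality, and
   minimality makes the form finite and definite.  [H] is minus its inverse.

   For sufficiency, with [H = -P], [P A + A^* P <= 0] keeps the roots of the
   minimal real polynomial of [A] out of the half-space, so [D + Gamma B] is
   slice hyperholomorphic there, agrees with [phi] on the domain of [phi], and
   maximality of that domain puts the half-space inside.  Finally
   [K = Gamma P^{-1} Gamma^* + T], where [p T + T \bar q] is a positive kernel, so
   [T] is positive by Lyapunov's argument on an eigenvector. *)
From HB Require Import structures.
Require Import Defs.
From mathcomp Require Import all_boot all_order all_algebra ring lra.
From mathcomp Require Import all_classical all_reals all_analysis.
Import Order.TTheory GRing.Theory Num.Theory.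
Import numFieldNormedType.Exports.
Local Open Scope classical_set_scope.
Local Open Scope ring_scope.
Set Implicit Arguments.
Unset Strict Implicit.
Unset Printing Implicit Defensive.
Local Notation hermitian := Defs.hermitian.

(** * Quaternions and the real inner product *)

Section Quaternions.
Variable R : realType.
Notation H := (quat R).

(** Since scalars do not commute, spectral facts are drawn from two commutative sources: real
    polynomials, which are central, and the real inner product [ip], the real part of v^* w. The
    dual system is forced by the order of the factors. With transfer function phi(x)^*, the mixed
    supply of two inputs is ip xi_x (phi(y)^* xi_y) + ip (phi(x)^* xi_x) xi_y, which is the form of
    phi(x) + phi(y)^*, the numerator of the kernel at real points; the original system would produce
    phi(x)^* + phi(y). Duality also exchanges the two halves of minimality: observability makes
    every dual state reachable, so the infimum is finite, and controllability makes the form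
    definite. Inverting the form leads back to the original system. Only exponentials with positive
    real rates occur, so differentiation is multiplication by the rate and integration is division
    by x + y; no differential equation is solved. At a real point the star product also reduces to
    division by x + y. *)

Lemma qreal_is_zmod_morphism : zmod_morphism (@qreal R).
Proof. by move=> x y; congr Quat; rewrite /= oppr0 addr0. Qed.
Lemma qreal_is_monoid_morphism : monoid_morphism (@qreal R).
Proof. by split => // x y; rewrite qrealM. Qed.
HB.instance Definition _ :=
  GRing.isZmodMorphism.Build R H (@qreal R) qreal_is_zmod_morphism.
HB.instance Definition _ :=
  GRing.isMonoidMorphism.Build R H (@qreal R) qreal_is_monoid_morphism.

Lemma qre_is_zmod_morphism : zmod_morphism (@qre R).
Proof. by move=> [? ? ? ?] [? ? ? ?]. Qed.
HB.instance Definition _ :=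
  GRing.isZmodMorphism.Build H R (@qre R) qre_is_zmod_morphism.

Lemma qconj_is_zmod_morphism : zmod_morphism (@qconj R).
Proof. by move=> [? ? ? ?] [? ? ? ?]; congr Quat; rewrite /= opprD. Qed.
HB.instance Definition _ :=
  GRing.isZmodMorphism.Build H H (@qconj R) qconj_is_zmod_morphism.

Lemma qvec_is_zmod_morphism : zmod_morphism (@qvec R).
Proof.
move=> [? ? ? ?] [? ? ? ?]; apply/rowP => i; rewrite !mxE.
by case: i => -[|[|[|[|]]]].
Qed.
HB.instance Definition _ :=
  GRing.isZmodMorphism.Build H 'rV[R]_4 (@qvec R) qvec_is_zmod_morphism.

Lemma qvecZ t (p : H) : qvec (qreal t * p) = t *: qvec p.
Proof.
case: p => a b c d; apply/rowP => -[[|[|[|[|i]]]] // ?].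
all: rewrite !mxE /=; ring.
Qed.

Lemma qvec_inj : injective (@qvec R).
Proof.
move=> [a b c d] [a' b' c' d'] /rowP e.
have := e (inord 0); have := e (inord 1); have := e (inord 2).
by have := e (inord 3); rewrite !mxE !inordK//= => -> -> -> ->.
Qed.

Lemma qconjM (p q : H) : qconj (p * q) = qconj q * qconj p.
Proof. by case: p => ? ? ? ?; case: q => ? ? ? ?; congr Quat; rewrite /=; ring. Qed.

Lemma qconjK : involutive (@qconj R).
Proof. by move=> [? ? ? ?]; congr Quat; rewrite /= opprK. Qed.

Lemma qconj_real t : qconj (qreal t) = qreal t :> H.
Proof. by congr Quat; rewrite /= oppr0. Qed.

Lemma qreM_C (p q : H) : qre (p * q) = qre (q * p).
Proof. by case: p => ? ? ? ?; case: q => ? ? ? ?; rewrite /=; ring. Qed.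

Lemma qre_conj (p : H) : qre (qconj p) = qre p.
Proof. by []. Qed.

Lemma qreMl t (p : H) : qre (qreal t * p) = t * qre p.
Proof. by case: p => ? ? ? ?; rewrite /=; ring. Qed.

Lemma qnormsq_ge0 (p : H) : 0 <= qnormsq p.
Proof. by rewrite !addr_ge0 ?sqr_ge0. Qed.

Lemma qconj_mul (p : H) : qconj p * p = qreal (qnormsq p).
Proof. by case: p => ? ? ? ?; congr Quat; rewrite /qnormsq /=; ring. Qed.

Lemma mul_qconj (p : H) : p * qconj p = qreal (qnormsq p).
Proof. by case: p => ? ? ? ?; congr Quat; rewrite /qnormsq /=; ring. Qed.

Lemma qreal_neq0 t : (qreal t != 0 :> H) = (t != 0).
Proof. by congr (~~ _); apply/eqP/eqP => [[]|->]. Qed.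

Lemma qadjE m n (X : 'M[H]_(m, n)) i j : qadj X i j = qconj (X j i).
Proof. by rewrite !mxE. Qed.

Lemma qadjM m n l (X : 'M[H]_(m, n)) (Y : 'M[H]_(n, l)) :
  qadj (X *m Y) = qadj Y *m qadj X.
Proof.
apply/matrixP => i j; rewrite qadjE !mxE raddf_sum; apply: eq_bigr => k _ /=.
by rewrite !qadjE qconjM.
Qed.

Lemma qadjK m n (X : 'M[H]_(m, n)) : qadj (qadj X) = X.
Proof. by apply/matrixP => i j; rewrite !qadjE qconjK. Qed.

Lemma qadj_is_zmod_morphism m n : zmod_morphism (@qadj R m n).
Proof. by move=> X Y; apply/matrixP => i j; rewrite !mxE raddfB. Qed.
HB.instance Definition _ m n := GRing.isZmodMorphism.Build
  'M[H]_(m, n) 'M[H]_(n, m) (@qadj R m n) (@qadj_is_zmod_morphism m n).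

Lemma qadj_scalar n p : qadj (p%:M : 'M[H]_n) = (qconj p)%:M.
Proof.
apply/matrixP => i j; rewrite !mxE eq_sym.
by case: eqP => _; rewrite ?mulr1n ?mulr0n// raddf0.
Qed.

Lemma qadj1 n : qadj (1%:M : 'M[H]_n) = 1%:M.
Proof. by rewrite qadj_scalar qconj_real. Qed.

Lemma qadjZ m n t (X : 'M[H]_(m, n)) : qadj (qreal t *: X) = qreal t *: qadj X.
Proof. by apply/matrixP => i j; rewrite !mxE qconjM qconj_real qrealC. Qed.

Lemma qadjX n (X : 'M[H]_n) k : qadj (X ^+ k) = qadj X ^+ k.
Proof.
elim: k => [|k IH]; first by rewrite !expr0 qadj1.
by rewrite exprS exprSr qadjM IH.
Qed.

Lemma mulmxZr m n l t (X : 'M[H]_(m, n)) (Y : 'M[H]_(n, l)) :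
  X *m (qreal t *: Y) = qreal t *: (X *m Y).
Proof.
apply/matrixP => i j; rewrite !mxE mulr_sumr; apply: eq_bigr => k _.
by rewrite !mxE !mulrA qrealC.
Qed.

(** The real part turns the Hermitian product into a symmetric real bilinear form; right
    multiplication by [q%:M] and adjoints keep track of the quaternionic structure. *)
Definition ip m (v w : 'cV[H]_m) : R := qre ((qadj v *m w) 0 0).

Lemma ipE m (v w : 'cV[H]_m) : ip v w = \sum_i qre (qconj (v i 0) * w i 0).
Proof. by rewrite /ip !mxE raddf_sum; apply: eq_bigr => i _; rewrite qadjE. Qed.

Lemma ipC m (v w : 'cV[H]_m) : ip v w = ip w v.
Proof.
by rewrite !ipE; apply: eq_bigr => i _; rewrite -[LHS]qre_conj qconjM qconjK.
Qed.

Lemma ip_is_zmod_morphism m (v : 'cV[H]_m) : zmod_morphism (ip v).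
Proof.
by move=> x y; rewrite /ip mulmxBr [X in qre X]mxE [X in _ + X]mxE raddfB.
Qed.
HB.instance Definition _ m (v : 'cV[H]_m) :=
  GRing.isZmodMorphism.Build 'cV[H]_m R (ip v) (ip_is_zmod_morphism v).

Lemma ipDr m (v x y : 'cV[H]_m) : ip v (x + y) = ip v x + ip v y.
Proof. exact: raddfD. Qed.
Lemma ipDl m (v x y : 'cV[H]_m) : ip (x + y) v = ip x v + ip y v.
Proof. by rewrite ipC ipDr !(ipC v). Qed.
Lemma ipBr m (v x y : 'cV[H]_m) : ip v (x - y) = ip v x - ip v y.
Proof. exact: raddfB. Qed.
Lemma ipNr m (v x : 'cV[H]_m) : ip v (- x) = - ip v x.
Proof. exact: raddfN. Qed.
Lemma ipNl m (v x : 'cV[H]_m) : ip (- x) v = - ip x v.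
Proof. by rewrite ipC ipNr ipC. Qed.
Lemma ip0r m (v : 'cV[H]_m) : ip v 0 = 0.
Proof. exact: raddf0. Qed.
Lemma ip0l m (v : 'cV[H]_m) : ip 0 v = 0.
Proof. by rewrite ipC ip0r. Qed.
Lemma ipZr m t (v w : 'cV[H]_m) : ip v (qreal t *: w) = t * ip v w.
Proof. by rewrite /ip mulmxZr mxE qreMl. Qed.
Lemma ipZl m t (v w : 'cV[H]_m) : ip (qreal t *: v) w = t * ip v w.
Proof. by rewrite ipC ipZr ipC. Qed.
Lemma ip_sumr m I (r : seq I) (F : I -> 'cV[H]_m) v :
  ip v (\sum_(i <- r) F i) = \sum_(i <- r) ip v (F i).
Proof. exact: raddf_sum. Qed.
Lemma ip_suml m I (r : seq I) (F : I -> 'cV[H]_m) v :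
  ip (\sum_(i <- r) F i) v = \sum_(i <- r) ip (F i) v.
Proof. by rewrite ipC ip_sumr; apply: eq_bigr => i _; rewrite ipC. Qed.

Lemma ipxx m (v : 'cV[H]_m) : ip v v = \sum_i qnormsq (v i 0).
Proof. by rewrite ipE; apply: eq_bigr => i _; rewrite qconj_mul. Qed.

Lemma ip_ge0 m (v : 'cV[H]_m) : 0 <= ip v v.
Proof. by rewrite ipxx sumr_ge0// => i _; exact: qnormsq_ge0. Qed.

Lemma ip_eq0 m (v : 'cV[H]_m) : ip v v = 0 -> v = 0.
Proof.
rewrite ipxx => /eqP; rewrite psumr_eq0 => [/allP v0|i _]; last exact: qnormsq_ge0.
apply/colP => i; rewrite [RHS]mxE; apply/eqP; rewrite -qnormsq_eq0.
by apply: v0; rewrite mem_index_enum.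
Qed.

Lemma ip_gt0 m (v : 'cV[H]_m) : v != 0 -> 0 < ip v v.
Proof.
by move=> v0; rewrite lt_neqAle ip_ge0 andbT eq_sym; apply: contra_neq v0 => /ip_eq0.
Qed.

Lemma ip_nondeg m (v : 'cV[H]_m) : (forall w, ip w v = 0) -> v = 0.
Proof. by move=> v0; apply: ip_eq0. Qed.

Lemma ip_adj m n (X : 'M[H]_(m, n)) v w : ip (X *m v) w = ip v (qadj X *m w).
Proof. by rewrite /ip qadjM mulmxA. Qed.

Lemma ip_adjr m n (X : 'M[H]_(m, n)) v w : ip v (X *m w) = ip (qadj X *m v) w.
Proof. by rewrite ip_adj qadjK. Qed.

Lemma mulcol_scalarE m n (v : 'M[H]_(m, n)) (q : H) i j :
  (v *m q%:M) i j = v i j * q.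
Proof.
rewrite !mxE (bigD1 j)//= mxE eqxx big1 ?addr0// => k kj.
by rewrite mxE (negbTE kj) mulr0n mulr0.
Qed.

Lemma ip_mulr m (v w : 'cV[H]_m) (q : H) :
  ip (v *m q%:M) (w *m q%:M) = qnormsq q * ip v w.
Proof.
rewrite !ipE mulr_sumr; apply: eq_bigr => i _; rewrite !mulcol_scalarE qconjM.
by rewrite mulrA qreM_C !mulrA mul_qconj -mulrA qreMl.
Qed.

(** Discriminant argument for t -> B(u + t v, u + t v); the scaling [sc] is constrained only through
    [B]. *)
Lemma cauchy_schwarz_form (V : zmodType) (B : V -> V -> R)
    (sc : R -> V -> V) :
  (forall u v, B u v = B v u) ->
  (forall t u v w, B (u + sc t v) w = B u w + t * B v w) ->
  (forall v, 0 <= B v v) -> forall u v, B u v ^+ 2 <= B u u * B v v.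
Proof.
move=> BC BD B0 u v.
have q t : 0 <= B u u + t * (2 * B u v) + t ^+ 2 * B v v.
  have := B0 (u + sc t v); rewrite BD BC BD (BC v (u + _)) BD (BC v u); lra.
have [v0|v0] := eqVneq (B v v) 0.
  rewrite v0 mulr0.
  have [->|uv0] := eqVneq (B u v) 0; first by rewrite expr0n.
  (* The polynomial is affine here, and this [t] gives it the value -1. *)
  have := q (- (B u u + 1) / (2 * B u v)).
  rewrite v0 mulr0 addr0 divfK ?mulf_neq0// ?pnatr_eq0//; lra.
have := q (- (B u v) / B v v); have vp : 0 < B v v by rewrite lt_neqAle eq_sym v0 B0.
have -> : B u u + - B u v / B v v * (2 * B u v) + (- B u v / B v v) ^+ 2 * B v v =
   (B u u * B v v - B u v ^+ 2) / B v v by field.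
by rewrite pmulr_lge0 ?invr_gt0// subr_ge0.
Qed.

End Quaternions.

(** * Annihilating polynomials and inverses *)

Section Annihilator.
Variable R : realType.
Notation H := (quat R).

Lemma mulmx_scalar_real m n t (v : 'M[H]_(m, n)) :
  v *m (qreal t)%:M = qreal t *: v.
Proof. by apply/matrixP => i j; rewrite mulcol_scalarE mxE qrealC. Qed.

Definition mx_eval N (A : 'M[H]_N) (f : {poly R}) : 'M[H]_N :=
  \sum_(i < size f) qreal f`_i *: A ^+ i.

Section Eval.
Variables (N : nat) (A : 'M[H]_N).
Implicit Types f g : {poly R}.

Lemma mx_eval_wide K f : (size f <= K)%N ->
  mx_eval A f = \sum_(i < K) qreal f`_i *: A ^+ i.
Proof.
move=> fK; rewrite /mx_eval (big_ord_widen K (fun i => qreal f`_i *: A ^+ i))//.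
rewrite big_mkcond; apply: eq_bigr => i _.
by case: ltnP => // fi; rewrite nth_default// rmorph0 scale0r.
Qed.

Lemma mx_evalD f g : mx_eval A (f + g) = mx_eval A f + mx_eval A g.
Proof.
have [K [fgK fK gK]] : exists K : nat,
  [/\ size (f + g)%R <= K, size f <= K & size g <= K]%N.
  exists (maxn (size f) (size g)); split; first exact: size_polyD.
  - exact: leq_maxl.
  - exact: leq_maxr.
rewrite !(@mx_eval_wide K)// -big_split; apply: eq_bigr => i _.
by rewrite coefD rmorphD scalerDl.
Qed.

Lemma mx_evalZ t f : mx_eval A (t *: f) = qreal t *: mx_eval A f.
Proof.
rewrite !(@mx_eval_wide (size f)) ?size_scale_leq// scaler_sumr.
by apply: eq_bigr => i _; rewrite coefZ rmorphM scalerA.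
Qed.

Lemma mx_evalMX f : mx_eval A (f * 'X) = A *m mx_eval A f.
Proof.
rewrite (@mx_eval_wide (size f).+1); last first.
  by have [->|f0] := eqVneq f 0; rewrite ?mul0r ?size_poly0// size_mulX.
rewrite big_ord_recl coefMX /= rmorph0 scale0r add0r mulmx_sumr.
by apply: eq_bigr => i _; rewrite coefMX /= mulmxZr exprS.
Qed.

Lemma mx_evalC c : mx_eval A c%:P = (qreal c)%:M.
Proof.
rewrite (@mx_eval_wide 1) ?size_polyC_leq1// big_ord1 coefC /= expr0.
by rewrite -[X in _ *: X]/(1%:M) scale_scalar_mx mulr1.
Qed.

Lemma mx_eval_comm f : A *m mx_eval A f = mx_eval A f *m A.
Proof.
rewrite mulmx_sumr mulmx_suml; apply: eq_bigr => i _.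
rewrite mulmxZr -scalemxAl; congr (_ *: _).
by transitivity (A ^+ i.+1); [rewrite exprS | rewrite exprSr].
Qed.

(** Horner's scheme. Evaluated at [A], the truncations [drop_poly k f] yield both the inverse of [A]
    and the coefficients of its resolvent. *)
Lemma poly_drop_recl k (f : {poly R}) :
  drop_poly k f = drop_poly k.+1 f * 'X + (f`_k)%:P.
Proof.
apply/polyP => i; rewrite coefD coefMX coefC !coef_drop_poly.
by case: i => [|i] /=; rewrite ?add0r ?addr0 // addSnnS.
Qed.

Lemma mx_eval_drop k f :
  mx_eval A (drop_poly k f) =
  A *m mx_eval A (drop_poly k.+1 f) + (qreal f`_k)%:M.
Proof. by rewrite poly_drop_recl mx_evalD mx_evalMX mx_evalC. Qed.

Definition mx_coord (X : 'M[H]_N) : 'rV[R]_#|{: 'I_N * 'I_N * 'I_4}| :=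
  \row_a qvec (X (enum_val a).1.1 (enum_val a).1.2) 0 (enum_val a).2.

Lemma mx_coord_eq0 X : mx_coord X = 0 -> X = 0.
Proof.
move=> /rowP X0; apply/matrixP => i j; apply: qvec_inj; apply/rowP => k.
have := X0 (enum_rank (i, j, k)); rewrite [LHS]mxE enum_rankK /= => ->.
by rewrite [(0 : 'M[H]_N) i j]mxE raddf0 !mxE.
Qed.

(** The D + 1 first powers of [A] are linearly dependent over the reals, because quaternionic
    matrices of size [N] form a real space of dimension D = 4 N^2. Real coefficients make the
    polynomial central. *)
Lemma annihilator_exists : exists2 f : {poly R}, f != 0 & mx_eval A f = 0.
Proof.
set D := #|{: 'I_N * 'I_N * 'I_4}|.
pose M := \matrix_(i < D.+1) mx_coord (A ^+ i).
have : kermx M != 0.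
  rewrite -mxrank_eq0 mxrank_ker -lt0n subn_gt0.
  by rewrite (leq_ltn_trans (rank_leq_col M)).
move=> /rowV0Pn[u /sub_kermxP uM u0].
pose f : {poly R} := \poly_(i < D.+1) u 0 (inord i).
have fE (i : 'I_D.+1) : f`_i = u 0 i by rewrite coef_poly ltn_ord inord_val.
exists f.
  apply: contra_neq u0 => f0; apply/rowP => i.
  by rewrite -fE f0 coef0 mxE.
rewrite (@mx_eval_wide D.+1) ?size_poly//; apply: mx_coord_eq0.
rewrite -uM; apply/rowP => a.
rewrite [LHS]mxE summxE raddf_sum summxE [RHS]mxE; apply: eq_bigr => i _ /=.
rewrite [X in qvec X]mxE qvecZ fE [LHS]mxE [M _ _]mxE.
by rewrite [X in _ = _ * X]mxE.
Qed.

Definition min_annihilator (f : {poly R}) :=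
  [/\ f != 0, mx_eval A f = 0 &
      forall g, g != 0 -> mx_eval A g = 0 -> (size f <= size g)%N].

Lemma min_annihilator_exists : exists f, min_annihilator f.
Proof.
have ex : exists n, `[< exists f : {poly R}, [/\ f != 0, mx_eval A f = 0 & size f = n] >].
  have [f f0 fA] := annihilator_exists; exists (size f).
  by apply/asboolP; exists f.
case: (ex_minnP ex) => n /asboolP[f [f0 fA sf]] min.
exists f; split => // g g0 gA; rewrite sf; apply: min; apply/asboolP.
by exists g.
Qed.

(* The constant term of a minimal annihilating polynomial is nonzero. *)
Lemma mulmx_injective_invertible :
  (forall v : 'cV[H]_N, A *m v = 0 -> v = 0) ->
  exists2 B, A *m B = 1%:M & B *m A = 1%:M.
Proof.
move=> Ainj; have [f [f0 fA fmin]] := min_annihilator_exists.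
pose B := mx_eval A (drop_poly 1 f).
have E : A *m B + (qreal f`_0)%:M = 0.
  rewrite -(mx_eval_drop 0 f) -{}fA; congr mx_eval.
  by apply/polyP => i; rewrite coef_drop_poly addn0.
(* If the constant term vanishes, injectivity turns [A *m B = 0] into [B = 0], so [drop_poly 1 f],
   one degree lower, also annihilates [A]. *)
have [f00|f00] := eqVneq (f`_0) 0.
  have B0 : B = 0.
    move: E; rewrite f00 !rmorph0 addr0 => AB0.
    apply/matrixP => i j; rewrite mxE.
    have /Ainj/colP/(_ i) : A *m col j B = 0 by rewrite colE mulmxA AB0 mul0mx.
    by rewrite !mxE.
  have d0 : drop_poly 1 f != 0.
    apply: contra_neq f0 => d0; apply/polyP => -[|i]; rewrite coef0//.
    by have := congr1 (fun p : {poly R} => p`_i) d0; rewrite coef_drop_poly addn1 coef0.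
  have := fmin _ d0 B0; rewrite size_drop_poly.
  have : (0 < size f)%N by rewrite size_poly_gt0.
  by case: (size f) => // n _; rewrite subn1 /= ltnn.
have E' : A *m (qreal (- (f`_0)^-1) *: B) = 1%:M.
  rewrite mulmxZr; move/eqP: E; rewrite addr_eq0 => /eqP->.
  rewrite scalerN scale_scalar_mx -qrealM mulNr mulVf//.
  by apply/matrixP => i j; rewrite !mxE rmorphN rmorph1 mulNrn opprK.
exists (qreal (- (f`_0)^-1) *: B) => //.
by rewrite -scalemxAl -mx_eval_comm -mulmxZr.
Qed.

End Eval.
End Annihilator.

(** * Hermitian quaternionic matrices *)

Section Spectral.
Variable R : realType.
Notation H := (quat R).

(** A crude constant: apply Re(conj p * q) <= |p|^2 + |q|^2 to p = v_i and q = X_ij v_j, and sum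
    over the entries. *)
Lemma form_bound m (X : 'M[H]_m) :
  exists2 c : R, 0 < c & forall v, ip v (X *m v) <= c * ip v v.
Proof.
exists (1 + \sum_i \sum_j (1 + qnormsq (X i j))).
  apply: ltr_pwDl => //; apply: sumr_ge0 => i _; apply: sumr_ge0 => j _.
  by rewrite addr_ge0// qnormsq_ge0.
move=> v; rewrite mulrDl mul1r ler_wpDl ?ip_ge0//.
rewrite {1}ipE mulr_suml; apply: ler_sum => i _.
rewrite mxE mulr_sumr raddf_sum mulr_suml; apply: ler_sum => j _ /=.
have vb k : qnormsq (v k 0) <= ip v v.
  by rewrite ipxx (bigD1 k)//= ler_wpDr// sumr_ge0// => l _; exact: qnormsq_ge0.
have amgm (p q : H) : qre (qconj p * q) <= qnormsq p + qnormsq q.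
  have := qnormsq_ge0 (p - q); have := qnormsq_ge0 (p + q).
  case: p q => a b c d [a' b' c' d']; rewrite /qnormsq /=; nra.
have qM (p q : H) : qnormsq (p * q) = qnormsq p * qnormsq q.
  by case: p q => a b c d [a' b' c' d']; rewrite /qnormsq /=; ring.
apply: (le_trans (amgm _ _)); rewrite qM [leRHS]mulrDl mul1r lerD//.
by rewrite ler_wpM2l// qnormsq_ge0.
Qed.

Lemma hermitian_ip m (X : 'M[H]_m) u v :
  hermitian X -> ip u (X *m v) = ip v (X *m u).
Proof. by move=> hX; rewrite ip_adjr hX ipC. Qed.

Lemma psd_cauchy_schwarz m (X : 'M[H]_m) : hermitian X ->
  (forall v, 0 <= ip v (X *m v)) ->
  forall u v, ip u (X *m v) ^+ 2 <= ip u (X *m u) * ip v (X *m v).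
Proof.
move=> hX X0; apply: (@cauchy_schwarz_form _ _ (fun u v => ip u (X *m v))
  (fun t v => qreal t *: v)) => //.
- by move=> u v; exact: hermitian_ip.
- by move=> t u v w; rewrite ipDl ipZl.
Qed.

Lemma psd_ker m (X : 'M[H]_m) v : hermitian X ->
  (forall v, 0 <= ip v (X *m v)) -> ip v (X *m v) = 0 -> X *m v = 0.
Proof.
move=> hX X0 v0; apply: ip_nondeg => w.
have := psd_cauchy_schwarz hX X0 w v; rewrite v0 mulr0 => h.
by apply/eqP; rewrite -sqrf_eq0 eq_le h sqr_ge0.
Qed.

(** With [Z] the inverse of [Y], Cauchy-Schwarz for [Y] at [Z *m v] and [v] reads |v|^4 <= ip v (Z
    v) * ip v (Y v), and the first factor is at most c |v|^2. *)
Lemma pd_coercive m (Y : 'M[H]_m) : hermitian Y ->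
  (forall v, 0 <= ip v (Y *m v)) -> (forall v : 'cV[H]_m, Y *m v = 0 -> v = 0) ->
  exists2 c : R, 0 < c & forall v, ip v v <= c * ip v (Y *m v).
Proof.
move=> hY Y0 Yinj; have [Z YZ ZY] := mulmx_injective_invertible Yinj.
have [c c0 cb] := form_bound Z; exists c => // v.
have [->|v0] := eqVneq v 0; first by rewrite ip0l mulmx0 ip0r mulr0.
have vp := ip_gt0 v0.
have := psd_cauchy_schwarz hY Y0 (Z *m v) v.
rewrite (hermitian_ip _ _ hY) mulmxA YZ mul1mx (ipC (Z *m v)) => h.
have h2 : ip v (Z *m v) * ip v (Y *m v) <= c * ip v v * ip v (Y *m v).
  by rewrite ler_wpM2r.
move: (le_trans h h2); rewrite expr2 -mulrA mulrCA ler_pM2l//.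
Qed.

(* If the form takes a negative value, let [t0 > 0] be the supremum of the [t]
   such that [X + t] is not positive: [X + t0] is positive and, [- t0] not being
   an eigenvalue, invertible, hence coercive, which contradicts the choice of
   [t0]. *)
Lemma psd_of_no_negative_eigenvalue m (X : 'M[H]_m) : hermitian X ->
  (forall x : R, x < 0 -> ~ right_eigenvalue X (qreal x)) ->
  forall v, 0 <= ip v (X *m v).
Proof.
move=> hX noneg v0; rewrite leNgt; apply/negP => neg0.
pose T := [set t : R | exists v, ip v (X *m v) + t * ip v v < 0].
have [c c0 cb] := form_bound (- X).
have v0n : v0 != 0 by apply: contra_ltN neg0 => /eqP->; rewrite mulmx0 ip0r.
have T0 : T 0 by exists v0; rewrite mul0r addr0.
have Tub t : T t -> t <= c.
  move=> [v tv]; rewrite leNgt; apply/negP => ct.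
  have := cb v; rewrite mulNmx ipNr => h; have := ip_ge0 v; nra.
have hsT : has_sup T by split; [exists 0 | exists c => t /Tub].
pose t0 := sup T.
have Xt t : t0 < t -> forall v, 0 <= ip v (X *m v) + t * ip v v.
  move=> t0t v; rewrite leNgt; apply/negP => h.
  have : t <= t0 by apply: ub_le_sup; [exact: hsT.2|exists v].
  by rewrite leNgt t0t.
have t0_gt0 : 0 < t0.
  have vp := ip_gt0 v0n.
  pose e := - ip v0 (X *m v0) / ip v0 v0 / 2.
  have e0 : 0 < e by rewrite !divr_gt0// oppr_gt0.
  apply: (lt_le_trans e0); apply: ub_le_sup; first exact: hsT.2.
  exists v0; rewrite /e -!mulrA (mulrCA _ 2^-1) mulVf ?gt_eqF//; lra.
pose Y := X + (qreal t0)%:M.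
have YE v : ip v (Y *m v) = ip v (X *m v) + t0 * ip v v.
  by rewrite mulmxDl mul_scalar_mx ipDr ipZr.
have hY : hermitian Y by rewrite /Defs.hermitian raddfD /= hX qadj_scalar qconj_real.
have Y0 v : 0 <= ip v (Y *m v).
  rewrite YE leNgt; apply/negP => h.
  (* Half of the defect, damped by [1 + ip v v], so that X + (t0 + e) is still negative at [v]. *)
  pose e := - (ip v (X *m v) + t0 * ip v v) / (1 + ip v v) / 2.
  have vp := ip_ge0 v.
  have e0 : 0 < e by rewrite !divr_gt0 ?oppr_gt0//; lra.
  have := Xt (t0 + e); rewrite ltrDl => /(_ e0 v).
  have : e * (1 + ip v v) * 2 = - (ip v (X *m v) + t0 * ip v v).
    by rewrite /e; field; lra.
  nra.
have Yinj (v : 'cV[H]_m) : Y *m v = 0 -> v = 0.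
  move=> Yv; apply/eqP; apply: contraT => vn0; exfalso.
  apply: (noneg (- t0)); first by rewrite oppr_lt0.
  exists v => //; rewrite mulmx_scalar_real; move/eqP: Yv.
  by rewrite mulmxDl mul_scalar_mx addr_eq0 rmorphN scaleNr => /eqP.
have [k k0 kb] := pd_coercive hY Y0 Yinj.
have : t0 <= t0 - k^-1.
  apply: ge_sup; first by exists 0.
  move=> t [v tv]; rewrite leNgt; apply/negP => h.
  have := kb v; rewrite YE => kv.
  have : k^-1 * ip v v <= ip v (X *m v) + t0 * ip v v by rewrite ler_pdivrMl.
  have := ip_ge0 v; nra.
by rewrite lerBrDr gerDl leNgt invr_gt0 k0.
Qed.

(** The form of [- X] is nonnegative by the eigenvalue criterion; a null vector would lie in the
    kernel and make 0 an eigenvalue. *)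
Lemma negative_definite_ip m (X : 'M[H]_m) : negative_definite X ->
  hermitian X /\ forall v, v != 0 -> ip v (X *m v) < 0.
Proof.
move=> [hX eig]; split => // v v0.
have hN : hermitian (- X) by rewrite /Defs.hermitian raddfN /= hX.
have X0 u : 0 <= ip u (- X *m u).
  apply: psd_of_no_negative_eigenvalue => // x x0 [w w0 xw].
  have [|y] := eig (qreal (- x)).
    exists w => //; rewrite mulmx_scalar_real in xw.
    by rewrite mulmx_scalar_real rmorphN scaleNr -xw mulNmx opprK.
  by move=> [<-]; rewrite oppr_lt0 ltNge ltW.
rewrite -oppr_gt0 -ipNr -mulNmx lt_neqAle X0 andbT eq_sym.
apply/eqP => /(psd_ker hN X0)/eqP; rewrite mulNmx oppr_eq0 => /eqP Xv.
have [|y] := eig (qreal 0).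
  by exists v; rewrite // Xv mulmx_scalar_real rmorph0 scale0r.
by move=> [<-]; rewrite ltxx.
Qed.

(** An eigenvalue equals v^* X v divided by |v|^2. The numerator is its own conjugate, hence real,
    and negative by hypothesis. *)
Lemma ip_negative_definite m (X : 'M[H]_m) : hermitian X ->
  (forall v, v != 0 -> ip v (X *m v) < 0) -> negative_definite X.
Proof.
move=> hX X0; split=> // lam [v v0 Xv].
have E : qadj v *m (X *m v) = qadj v *m v *m lam%:M by rewrite Xv mulmxA.
pose s := (qadj v *m (X *m v)) 0 0.
have vv : (qadj v *m v) 0 0 = qreal (ip v v).
  rewrite mxE ipxx rmorph_sum; apply: eq_bigr => i _.
  by rewrite qadjE qconj_mul.
have sv : s = qreal (ip v v) * lam.
  by rewrite /s E mulcol_scalarE vv.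
have vp := ip_gt0 v0.
have sr : s = qreal (qre s).
  have : qconj s = s.
    by rewrite /s -qadjE !qadjM hX qadjK mulmxA.
  by case: (s) => a b c d [h1 h2 h3]; congr Quat => /=; lra.
exists (qre s / ip v v).
  by rewrite rmorphM /= -sr sv qrealC -mulrA -rmorphM /= divff ?gt_eqF// rmorph1 mulr1.
by rewrite pmulr_llt0 ?invr_gt0//; exact: X0.
Qed.

End Spectral.

(** * Resolvents *)

Section Resolvent.
Variable R : realType.
Notation H := (quat R).

Lemma qpoly_evalE (f : {poly R}) K (p : H) : (size f <= K)%N ->
  (map_poly (@qreal R) f).[p] = \sum_(i < K) p ^+ i * qreal f`_i.
Proof.
move=> fK; rewrite (@horner_coef_wide _ K) ?size_map_poly//.
by apply: eq_bigr => i _; rewrite coef_map qrealC.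
Qed.

Lemma qpoly_eval_real (f : {poly R}) x :
  (map_poly (@qreal R) f).[qreal x] = qreal f.[x].
Proof. by rewrite horner_map. Qed.

Lemma qpoly_comm (f : {poly R}) (p q : H) : p * q = q * p ->
  (map_poly (@qreal R) f).[p] * q = q * (map_poly (@qreal R) f).[p].
Proof.
move=> pq; rewrite !(qpoly_evalE p (leqnn (size f))) mulr_suml mulr_sumr.
apply: eq_bigr => i _; rewrite -mulrA qrealC !mulrA.
congr (_ * _); apply/esym; exact: (commrX i (esym pq)).
Qed.

(** A real polynomial such as X^2 + 1 vanishes on a whole sphere of quaternions; the degree bounds
    the number of roots only among pairwise commuting points, for instance those of one slice. *)
Lemma qpoly_eval_neq0 (f : {poly R}) (l : seq H) : f != 0 ->
  uniq l -> (forall p q, p \in l -> q \in l -> p * q = q * p) ->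
  (size f <= size l)%N ->
  exists2 p, p \in l & (map_poly (@qreal R) f).[p] != 0.
Proof.
move=> f0 ul lc fl.
have [/hasP//|/hasPn al] :=
  boolP (has (fun p => (map_poly (@qreal R) f).[p] != 0) l).
exfalso; move: fl; rewrite leqNgt => /negP; apply.
rewrite -(size_map_poly (@qreal R)); apply: max_ring_poly_roots.
- by rewrite map_poly_eq0.
- by apply/allP => p /al; rewrite negbK.
- elim: l ul lc {al} => // p l IH /= /andP[pl ul] lc.
  rewrite {}IH// ?andbT; last first.
    by move=> q r ql rl; apply: lc; rewrite inE ?ql ?rl orbT.
  apply/allP => q ql; rewrite /diff_roots lc ?inE ?eqxx ?ql ?orbT//=.
  by rewrite subr_eq0; apply: contraNneq pl => <-.
Qed.

(** Real points are central, so the usual root count applies to a polynomial with quaternionic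
    coefficients. *)
Lemma real_power_sum_eq0 K (c : nat -> H) (l : seq R) : uniq l ->
  (K <= size l)%N ->
  (forall x, x \in l -> \sum_(k < K) qreal x ^+ k * c k = 0) ->
  forall k, (k < K)%N -> c k = 0.
Proof.
move=> ul Kl h.
pose f : {poly H} := \poly_(k < K) c k.
suff f0 : f = 0.
  move=> k kK; have : f`_k = 0 by rewrite f0 coef0.
  by rewrite coef_poly kK.
apply/eqP; apply: contraT => f0.
have : (size (map (@qreal R) l) < size f)%N.
  apply: max_ring_poly_roots => //; last by rewrite map_uniq_roots.
  apply/allP => _ /mapP[x xl ->]; rewrite /root horner_poly.
  by apply/eqP; rewrite -[RHS](h x xl); apply: eq_bigr => i _; rewrite -rmorphXn qrealC.
rewrite size_map ltnNge; case/negP.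
exact: leq_trans (size_poly _ _) Kl.
Qed.

Lemma real_power_mxsum_eq0 m n K (c : nat -> 'M[H]_(m, n)) (l : seq R) :
  uniq l -> (K <= size l)%N ->
  (forall x, x \in l -> \sum_(k < K) qreal x ^+ k *: c k = 0) ->
  forall k, (k < K)%N -> c k = 0.
Proof.
move=> ul Kl h k kK; apply/matrixP => i j; rewrite mxE.
apply: (real_power_sum_eq0 (c := fun k => c k i j) ul Kl) kK => x xl.
have /matrixP/(_ i j) := h x xl; rewrite summxE mxE => {2}<-.
by apply: eq_bigr => a _; rewrite mxE.
Qed.

Section Coef.
Variables (N : nat) (A : 'M[H]_N) (f : {poly R}).
Hypothesis fA : mx_eval A f = 0.

(* [(f(x) - f(A)) / (x - A) = sum_k x^k rcoef k]. *)
Definition rcoef k : 'M[H]_N := mx_eval A (drop_poly k.+1 f).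

(** The star resolvent multiplied by f(p): without the denominator it is a polynomial in [p],
    defined everywhere. *)
Definition gam m (C : 'M[H]_(m, N)) (p : H) : 'M[H]_(m, N) :=
  \sum_(k < size f) p ^+ k *: (C *m rcoef k).

Lemma mx_eval0 : mx_eval A 0 = 0.
Proof. by rewrite /mx_eval size_poly0 big_ord0. Qed.

(** With F k = p^k C Q_k, where Q_k is [drop_poly k f] at [A], the k-th term of the left side is
    F(k+1) - F(k) + p^k f_k C. The sum telescopes between f(A) = 0 and the empty truncation. As [p]
    acts on the left and [A] on the right, they never have to commute. *)
Lemma gam_sylvester m (C : 'M[H]_(m, N)) p :
  p *: gam C p - gam C p *m A = (map_poly (@qreal R) f).[p] *: C.
Proof.
rewrite (qpoly_evalE p (leqnn _)) /gam scaler_sumr mulmx_suml scaler_suml.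
pose Q k : 'M[H]_N := mx_eval A (drop_poly k f).
have QA k : Q k.+1 *m A = Q k - (qreal f`_k)%:M.
  by rewrite -mx_eval_comm /Q [in RHS]mx_eval_drop addrK.
pose F k := p ^+ k *: (C *m Q k).
have -> : \sum_(i < size f) p ^+ i * qreal f`_i *: C =
    \sum_(i < size f) p ^+ i *: (C *m (qreal f`_i)%:M).
  by apply: eq_bigr => i _; rewrite mulmx_scalar_real scalerA.
have F0 : \sum_(0 <= k < size f) (F k.+1 - F k) = 0.
  rewrite telescope_sumr// /F /Q drop_poly_eq0// mx_eval0 mulmx0 scaler0.
  suff -> : drop_poly 0 f = f by rewrite fA mulmx0 scaler0 subrr.
  by apply/polyP => i; rewrite coef_drop_poly addn0.
rewrite -[RHS]add0r -[X in _ = X + _]F0 big_mkord -sumrB -big_split; apply: eq_bigr => k _.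
rewrite /F scalerA -exprS -[(_ *: _) *m A]scalemxAl -mulmxA.
by rewrite [rcoef k *m A]QA mulmxBr scalerBr opprB addrA addrAC.
Qed.

Lemma rcoef_comm k : rcoef k *m A = A *m rcoef k.
Proof. by rewrite mx_eval_comm. Qed.

Lemma gam_mulmx m l (B : 'M[H]_(l, m)) (C : 'M[H]_(m, N)) x :
  gam (B *m C) (qreal x) = B *m gam C (qreal x).
Proof.
rewrite /gam mulmx_sumr; apply: eq_bigr => k _.
by rewrite -rmorphXn mulmxZr mulmxA.
Qed.

Definition resolvent x : 'M[H]_N := qreal (f.[x])^-1 *: gam 1%:M (qreal x).

Lemma mulmx_resolventl x : f.[x] != 0 ->
  resolvent x *m ((qreal x)%:M - A) = 1%:M.
Proof.
move=> fx; rewrite /resolvent -scalemxAl mulmxBr mulmx_scalar_real.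
by rewrite gam_sylvester qpoly_eval_real scalerA -rmorphM /= mulVf// rmorph1 scale1r.
Qed.

Lemma mulmx_resolventr x : f.[x] != 0 ->
  ((qreal x)%:M - A) *m resolvent x = 1%:M.
Proof.
move=> fx; rewrite -(mulmx_resolventl fx) mulmxBl mulmxBr mulmx_scalar_real.
rewrite mul_scalar_mx; congr (_ - _).
rewrite /resolvent mulmxZr -scalemxAl; congr (_ *: _).
rewrite /gam mulmx_sumr mulmx_suml; apply: eq_bigr => k _.
by rewrite -rmorphXn mulmxZr -scalemxAl !mul1mx rcoef_comm.
Qed.

Lemma resolvent_uniq x (X : 'M[H]_N) : f.[x] != 0 ->
  X *m ((qreal x)%:M - A) = 1%:M -> X = resolvent x.
Proof.
move=> fx XA; rewrite -[X]mulmx1 -(mulmx_resolventr fx) mulmxA XA mul1mx.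
by [].
Qed.

Lemma gam_realE m (C : 'M[H]_(m, N)) x : f.[x] != 0 ->
  qreal (f.[x])^-1 *: gam C (qreal x) = C *m resolvent x.
Proof. by move=> fx; rewrite /resolvent mulmxZr -gam_mulmx mulmx1. Qed.

Lemma rcoef0 : A *m rcoef 0 = - (qreal f`_0)%:M.
Proof.
apply/eqP; rewrite -addr_eq0 /rcoef -mx_eval_drop.
suff -> : drop_poly 0 f = f by rewrite fA.
by apply/polyP => i; rewrite coef_drop_poly addn0.
Qed.

Lemma rcoefS k : A *m rcoef k.+1 = rcoef k - (qreal f`_k.+1)%:M.
Proof. by rewrite /rcoef [in RHS]mx_eval_drop addrK. Qed.

Lemma rcoef_default k : (size f <= k.+1)%N -> rcoef k = 0.
Proof. by move=> fk; rewrite /rcoef drop_poly_eq0// mx_eval0. Qed.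

(** The last nonzero coefficient is the leading coefficient of [f] times the identity, which gives
    [C *m B = 0]. The recursion [rcoefS] then passes the hypothesis on to [C *m A], and induction on
    [t] concludes. *)
Lemma rcoef_observable m n (C : 'M[H]_(m, N)) (B : 'M[H]_(N, n)) : f != 0 ->
  (forall k, C *m rcoef k *m B = 0) -> forall t, C *m A ^+ t *m B = 0.
Proof.
move=> f0.
have base (C' : 'M[H]_(m, N)) : (forall k, C' *m rcoef k *m B = 0) -> C' *m B = 0.
  move=> h; suff : qreal (lead_coef f) *: (C' *m B) = 0.
    move=> e; rewrite -[LHS]scale1r -(rmorph1 (@qreal R)).
    by rewrite -(mulVf (_ : lead_coef f != 0)) ?lead_coef_eq0// rmorphM /= -scalerA e scaler0.
  have := size_poly_gt0 f; rewrite f0 lead_coefE.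
  case E: (size f) => [//|[|d]] _ /=.
    have : C' *m (A *m rcoef 0) *m B = 0.
      by rewrite rcoef_default ?E// !mulmx0 mul0mx.
    by rewrite rcoef0 mulmxN mulNmx mulmx_scalar_real -scalemxAl => /eqP; rewrite oppr_eq0 => /eqP.
  have : C' *m (A *m rcoef d.+1) *m B = 0.
    by rewrite rcoef_default ?E// !mulmx0 mul0mx.
  rewrite rcoefS mulmxBr mulmxBl h sub0r mulmx_scalar_real -scalemxAl => /eqP.
  by rewrite oppr_eq0 => /eqP.
move=> + t; elim: t C => [|t IH] C h.
  by rewrite expr0 -[X in C *m X]/(1%:M) mulmx1; exact: base.
rewrite exprS -[A * _]/(A *m _) mulmxA; apply: IH => -[|k]; rewrite -mulmxA.
  rewrite mulmxA -[C *m A *m _]mulmxA rcoef0 mulmxN mulNmx mulmx_scalar_real.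
  by rewrite -scalemxAl base// scaler0 oppr0.
rewrite mulmxA -[C *m A *m _]mulmxA rcoefS mulmxBr mulmxBl h sub0r.
by rewrite mulmx_scalar_real -scalemxAl base// scaler0 oppr0.
Qed.

(** Cleared of its denominator f(x), the function x -> C (x - A)^-1 B is a polynomial with fewer
    coefficients than there are sample points, so each [rcoef] term vanishes. *)
Lemma resolvent_observable m n (C : 'M[H]_(m, N)) (B : 'M[H]_(N, n)) (l : seq R) :
  f != 0 -> uniq l -> (size f <= size l)%N -> (forall x, x \in l -> f.[x] != 0) ->
  (forall x, x \in l -> C *m resolvent x *m B = 0) ->
  forall t, C *m A ^+ t *m B = 0.
Proof.
move=> f0 ul fl lf h; apply: rcoef_observable => // k.
have [kf|kf] := ltnP k (size f); last first.
  by rewrite rcoef_default ?mulmx0 ?mul0mx// (leq_trans kf).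
apply: (real_power_mxsum_eq0 (c := fun k => C *m rcoef k *m B) ul fl) kf => x xl.
suff : gam C (qreal x) *m B = 0.
  move=> e; rewrite -[RHS]e /gam mulmx_suml.
  by apply: eq_bigr => i _; rewrite scalemxAl.
have := h _ xl; rewrite -gam_realE ?lf// -scalemxAl => e.
by rewrite -[LHS]scale1r -(rmorph1 (@qreal R)) -(mulfV (lf _ xl)) rmorphM /= -scalerA e scaler0.
Qed.

End Coef.
End Resolvent.

(** * Quadratic forms on quaternionic columns *)

Section QuadraticForms.
Variable R : realType.
Notation H := (quat R).

(** Source of the real sample points below: [g] is the sequence they are to be taken from, and only
    finitely many of its terms are roots. *)
Lemma poly_nonroots (F : {poly R}) (g : nat -> R) K : F != 0 -> injective g ->
  exists l : seq R, [/\ uniq l, (K <= size l)%N &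
    forall x, x \in l -> F.[x] != 0 /\ exists k, x = g k].
Proof.
move=> F0 ginj; pose l := [seq g k | k <- iota 0 (K + size F)].
have ul : uniq l by rewrite map_inj_uniq ?iota_uniq.
exists [seq x <- l | ~~ root F x]; split.
- exact: filter_uniq.
- have cl : (size [seq x <- l | root F x] <= size F)%N.
    rewrite ltnW//; apply: max_poly_roots => //; last exact: filter_uniq.
    by apply/allP => x; rewrite mem_filter => /andP[].
  rewrite !size_filter in cl *.
  have := count_predC (root F) l; rewrite size_map size_iota.
  move=> e; rewrite -(leq_add2r (size F)) -{}e addnC.
  by rewrite leq_add.
- move=> x; rewrite mem_filter => /andP[Fx /mapP[k _ xk]].
  by split; [exact: Fx | exists k].
Qed.

(* Additivity and a quadratic bound: comparing [n t] with its integer part,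
   [n (g t - t g 1)] stays bounded. *)
Lemma additive_bounded_linear (g : R -> R) (c : R) :
  (forall s t, g (s - t) = g s - g t) ->
  (forall t, `|g t| <= c * (1 + t ^+ 2)) -> forall t, g t = t * g 1.
Proof.
move=> gB gb t.
pose gA : {additive R -> R} := HB.pack g (GRing.isZmodMorphism.Build R R g gB).
have gMz (x : R) (m : int) : g (x *~ m) = g x *~ m by exact: (raddfMz gA).
have gMn (x : R) (k : nat) : g (x *+ k) = g x *+ k by exact: (raddfMn gA).
have c0 : 0 <= c by have := gb 0; rewrite expr0n addr0 mulr1; apply: le_trans.
have bound (k : nat) : k%:R * `|g t - t * g 1| <= 2 * c + `|g 1|.
  pose m := Num.floor (t *+ k).
  pose r := t *+ k - m%:~R.
  have /andP[m1 m2] := Num.Theory.floor_itv (t *+ k); rewrite rmorphD rmorph1 -/m in m1 m2.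
  have r0 : 0 <= r by rewrite subr_ge0.
  have r1 : r <= 1 by rewrite /r; lra.
  have gr : g r = (g t) *+ k - g 1 * m%:~R by rewrite gB gMn gMz mulrzr.
  have -> : k%:R * `|g t - t * g 1| = `|g r - r * g 1|.
    rewrite -[k%:R]normr_nat -normrM; congr `|_|.
    by rewrite gr /r -[t *+ k]mulr_natl -[g t *+ k]mulr_natl; ring.
  apply: (le_trans (ler_normB _ _)); rewrite lerD//.
    rewrite (le_trans (gb r))// mulrC ler_wpM2r//.
    by rewrite -[2]/(1 + 1) lerD2l expr_le1.
  rewrite normrM ger0_norm// ler_piMl//.
apply/eqP; rewrite -subr_eq0 -normr_le0 leNgt; apply/negP => d0.
have := bound (Num.bound ((2 * c + `|g 1|) / `|g t - t * g 1|)).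
apply/negP; rewrite -ltNge -ltr_pdivrMr//.
by apply: le_lt_trans (archi_boundP _); rewrite ?divr_ge0 ?addr_ge0 ?mulr_ge0.
Qed.

Lemma qscalar0 n : (0 : H)%:M = 0 :> 'M[H]_n.
Proof. by apply/matrixP => i j; rewrite !mxE mul0rn. Qed.

(** * From the parallelogram law to a Hermitian matrix *)

Section JordanVonNeumann.
Variables (N : nat) (V : 'cV[H]_N -> R).
Hypothesis V_ge0 : forall v, 0 <= V v.
Hypothesis V_par : forall u v, V (u + v) + V (u - v) = 2 * V u + 2 * V v.
Hypothesis VZ : forall t v, V (qreal t *: v) = t ^+ 2 * V v.
Hypothesis VMr : forall q v, V (v *m q%:M) = qnormsq q * V v.

Definition polar u v := (V (u + v) - V (u - v)) / 4.

Lemma V0 : V 0 = 0.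
Proof. by have := VZ 0 0; rewrite rmorph0 scale0r expr0n /= mul0r. Qed.

Lemma VN v : V (- v) = V v.
Proof.
by have := VZ (- 1) v; rewrite rmorphN rmorph1 scaleN1r sqrrN expr1n mul1r.
Qed.

Lemma polarC u v : polar u v = polar v u.
Proof. by rewrite /polar (addrC u v) -(opprB v u) VN. Qed.

Lemma polar_diag v : polar v v = V v.
Proof.
have := VZ 2 v; rewrite /polar subrr V0 subr0.
have -> : qreal 2 *: v = v + v by rewrite rmorphD rmorph1 scalerDl scale1r.
by move=> ->; field.
Qed.

Lemma polar_double u v : polar u (v + v) = 2 * polar u v.
Proof.
have h1 := V_par (u + v) v; have h2 := V_par (u - v) v.
move: h1 h2; rewrite -addrA addrK subrK -addrA -opprD /polar => h1 h2.
by move: h1 h2; lra.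
Qed.

(** Subtract the parallelogram laws for (u + v, w + v) and (u - v, w - v): the terms in u - w cancel
    and [polar_double] halves the increment 2v. *)
Lemma polarDl u w v : polar (u + w) v = polar u v + polar w v.
Proof.
have h1 := V_par (u + v) (w + v); have h2 := V_par (u - v) (w - v).
have e1 : u + v - (w + v) = u - w by rewrite opprD addrACA subrr addr0.
have e2 : u - v - (w - v) = u - w by rewrite opprB addrA subrK.
have e3 : u + v + (w + v) = u + w + (v + v) by rewrite addrACA.
have e4 : u - v + (w - v) = u + w - (v + v) by rewrite addrACA -opprD.
rewrite e1 e3 in h1; rewrite e2 e4 in h2.
have := polar_double (u + w) v; rewrite /polar; move: h1 h2; lra.
Qed.

Lemma polarNl u v : polar (- u) v = - polar u v.
Proof.
apply/eqP; rewrite -addr_eq0 -polarDl addNr /polar !add0r VN subrr mul0r.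
by [].
Qed.

(** Nonnegativity of [V] bounds |polar (a u) v| by (a^2 V u + V v) / 2, the growth condition that
    makes an additive function of [a] linear. *)
Lemma polarZl t u v : polar (qreal t *: u) v = t * polar u v.
Proof.
rewrite -[X in _ = _ * polar X v]scale1r.
apply: (@additive_bounded_linear (fun t => polar (qreal t *: u) v) (V u + V v)).
  by move=> a b; rewrite rmorphB scalerBl polarDl polarNl.
move=> a; have h := V_par (qreal a *: u) v; rewrite VZ in h.
have := V_ge0 (qreal a *: u + v); have := V_ge0 (qreal a *: u - v).
have := V_ge0 u; have := V_ge0 v => p1 p2 p3 p4.
have := sqr_ge0 a; rewrite ler_norml /polar => p5.
have q1 : 0 <= a ^+ 2 * V u by rewrite mulr_ge0.
have q2 : 0 <= a ^+ 2 * V v by rewrite mulr_ge0.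
by apply/andP; split; lra.
Qed.

Lemma polarMr q u v : polar (u *m q%:M) (v *m q%:M) = qnormsq q * polar u v.
Proof. by rewrite /polar -mulmxDl -mulmxBl !VMr -mulrBr mulrA. Qed.

(** Multiply by |q|^2 and absorb it on one side through [polarMr], where conj q * q is again the
    real number |q|^2. *)
Lemma polar_adj q u v : polar u (v *m q%:M) = polar (u *m (qconj q)%:M) v.
Proof.
have [->|q0] := eqVneq q 0.
  by rewrite (raddf0 (@qconj R)) qscalar0 !mulmx0 polarC /polar !add0r !VN !subrr.
have nq : qnormsq q != 0 by rewrite qnormsq_eq0.
apply: (mulfI nq); rewrite -[RHS]polarMr -mulmxA -scalar_mxM qconj_mul.
by rewrite mulmx_scalar_real polarZl.
Qed.

Definition unit_col (a : 'I_N) : 'cV[H]_N := delta_mx a 0.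

Lemma col_decomp (v : 'cV[H]_N) : v = \sum_a unit_col a *m (v a 0)%:M.
Proof.
apply/colP => b; rewrite summxE (bigD1 b)//= big1 ?addr0 => [|a ab].
  by rewrite mulcol_scalarE mxE !eqxx mul1r.
by rewrite mulcol_scalarE mxE eq_sym (negbTE ab) mul0r.
Qed.

(** Re(conj q * b) is the Euclidean product of R^4, so the components of the representing vector are
    the values of [polar] at the unit columns multiplied by 1, i, j, k. *)
Definition riesz (v : 'cV[H]_N) : 'cV[H]_N :=
  \col_a Quat (polar (unit_col a) v)
    (polar (unit_col a *m (Quat 0 1 0 0)%:M) v)
    (polar (unit_col a *m (Quat 0 0 1 0)%:M) v)
    (polar (unit_col a *m (Quat 0 0 0 1)%:M) v).

Lemma polar_suml I (r : seq I) (F : I -> 'cV[H]_N) v :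
  polar (\sum_(i <- r) F i) v = \sum_(i <- r) polar (F i) v.
Proof.
elim/big_rec2: _ => [|i y x _ <-]; last by rewrite polarDl.
by rewrite /polar !add0r VN subrr mul0r.
Qed.

Lemma ip_riesz u v : ip u (riesz v) = polar u v.
Proof.
rewrite ipE [in RHS](col_decomp u) polar_suml; apply: eq_bigr => a _.
rewrite mxE; case: (u a 0) => x y z w.
have -> b0 b1 b2 b3 : qre (qconj (Quat x y z w) * Quat b0 b1 b2 b3) =
    x * b0 + y * b1 + z * b2 + w * b3 by rewrite /=; ring.
have -> : Quat x y z w = qreal x * 1 + qreal y * Quat 0 1 0 0 +
    qreal z * Quat 0 0 1 0 + qreal w * Quat 0 0 0 1 :> H.
  by congr Quat; rewrite /=; ring.
rewrite !(raddfD (@scalar_mx H 1)) /= !mulmxDr !polarDl.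
have pz t q : polar (unit_col a *m (qreal t * q)%:M) v =
    t * polar (unit_col a *m q%:M) v.
  by rewrite -polarZl qrealC scalar_mxM mulmxA mulmx_scalar_real.
rewrite !pz mulmx1; ring.
Qed.

Lemma rieszD u v : riesz (u + v) = riesz u + riesz v.
Proof.
apply/eqP; rewrite -subr_eq0; apply/eqP/ip_nondeg => w.
by rewrite ipBr ipDr !ip_riesz !(polarC w) polarDl subrr.
Qed.

Lemma ip_mulr_adj m (u v : 'cV[H]_m) q :
  ip u (v *m q%:M) = ip (u *m (qconj q)%:M) v.
Proof.
rewrite !ipE; apply: eq_bigr => i _.
by rewrite !mulcol_scalarE qconjM qconjK mulrA qreM_C mulrA.
Qed.

Lemma rieszM q v : riesz (v *m q%:M) = riesz v *m q%:M.
Proof.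
apply/eqP; rewrite -subr_eq0; apply/eqP/ip_nondeg => w.
by rewrite ipBr ip_mulr_adj !ip_riesz polar_adj subrr.
Qed.

(** [riesz] is additive and commutes with right multiplication by quaternions, hence is left
    multiplication by the matrix of its values on unit columns. *)
Lemma quadratic_form_matrix : exists Q : 'M[H]_N,
  hermitian Q /\ forall u v, ip u (Q *m v) = polar u v.
Proof.
pose Q : 'M[H]_N := \matrix_(a, b) riesz (unit_col b) a 0.
have QE v : Q *m v = riesz v.
  rewrite [in RHS](col_decomp v).
  have -> : riesz (\sum_a unit_col a *m (v a 0)%:M) =
      \sum_a riesz (unit_col a) *m (v a 0)%:M.
    elim/big_rec2: _ => [|i y x _ <-]; last by rewrite rieszD rieszM.
    by rewrite -(mulmx0 1 (0 : 'cV[H]_N)) -(qscalar0 1) rieszM qscalar0 !mulmx0.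
  apply/colP => a; rewrite mxE summxE; apply: eq_bigr => b _.
  by rewrite mulcol_scalarE mxE.
have QP u v : ip u (Q *m v) = polar u v by rewrite QE ip_riesz.
exists Q; split => //.
rewrite /Defs.hermitian; apply/eqP; rewrite -subr_eq0; apply/eqP.
apply/matrixP => a b; rewrite [RHS]mxE.
have /colP/(_ a) : (qadj Q - Q) *m unit_col b = 0.
  apply: ip_nondeg => w.
  by rewrite mulmxBl ipBr -ip_adj QP ipC QP polarC subrr.
by rewrite -colE !mxE.
Qed.

End JordanVonNeumann.
End QuadraticForms.

(** * The positive real lemma *)

Section PositiveRealLemma.
Variable R : realType.
Notation H := (quat R).
Variables (n N : nat) (A : 'M[H]_N) (B : 'M[H]_(N, n)) (C : 'M[H]_(n, N)).
Variables (D : 'M[H]_n) (f : {poly R}).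
Hypotheses (f0 : f != 0) (fA : mx_eval A f = 0).

Let Rs := resolvent A f.
Definition transfer x : 'M[H]_n := D + C *m Rs x *m B.
Let signal := seq (R * 'cV[H]_n).
Implicit Types s t : signal.

(* The list [s] of pairs [(x, xi)] stands for the input [sum e^{xt} xi] on
   [(-oo, 0]]; [state s] is the state it produces at time 0 and [energy s s] the
   energy [int 2 Re (u^* y)] it supplies. *)
Definition state s : 'cV[H]_N := \sum_(a <- s) Rs a.1 *m (B *m a.2).
Definition input s : 'cV[H]_n := \sum_(a <- s) a.2.
(** The denominator x + y stands for the integral of e^{(x+y)t} over (-oo, 0], which equals
    1/(x+y). *)
Definition coenergy (a b : R * 'cV[H]_n) : R :=
  (ip a.2 (transfer b.1 *m b.2) + ip (transfer a.1 *m a.2) b.2) / (a.1 + b.1).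
Definition energy s t : R := \sum_(a <- s) \sum_(b <- t) coenergy a b.
Definition admissible (x : R) := (0 < x) && (f.[x] != 0).
Definition admissible_signal s := all (fun a => admissible a.1) s.
Definition weight (c : R -> R) s : signal :=
  [seq (a.1, qreal (c a.1) *: a.2) | a <- s].

Lemma coenergyC a b : coenergy a b = coenergy b a.
Proof.
rewrite /coenergy [b.1 + _]addrC; congr (_ / _).
by rewrite addrC ipC [ip a.2 _]ipC.
Qed.

Lemma coenergyZl x c v b : coenergy (x, qreal c *: v) b = c * coenergy (x, v) b.
Proof.
rewrite /coenergy mulrA; congr (_ / _); rewrite /= mulrDr.
congr (_ + _); first exact: ipZl.
by rewrite mulmxZr; exact: ipZl.
Qed.

Lemma coenergyZ a b c d : coenergy (a.1, qreal c *: a.2) (b.1, qreal d *: b.2) =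
  c * d * coenergy a b.
Proof.
case: a b => x v [y w] /=.
by rewrite coenergyZl coenergyC coenergyZl coenergyC mulrA.
Qed.

Lemma energyC s t : energy s t = energy t s.
Proof.
rewrite /energy exchange_big; apply: eq_bigr => a _; apply: eq_bigr => b _.
exact: coenergyC.
Qed.

Lemma energy_catl s s' t : energy (s ++ s') t = energy s t + energy s' t.
Proof. by rewrite /energy big_cat. Qed.

Lemma energy_catr s t t' : energy s (t ++ t') = energy s t + energy s t'.
Proof. by rewrite energyC energy_catl !(energyC s). Qed.

Lemma energy_weight c d s t : energy (weight c s) (weight d t) =
  \sum_(a <- s) \sum_(b <- t) c a.1 * d b.1 * coenergy a b.
Proof.
rewrite /energy big_map; apply: eq_bigr => a _; rewrite big_map.
by apply: eq_bigr => b _; rewrite coenergyZ.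
Qed.

Lemma energy_scalel c s t : energy (weight (fun=> c) s) t = c * energy s t.
Proof.
rewrite /energy big_map mulr_sumr; apply: eq_bigr => -[x v] _.
by rewrite mulr_sumr; apply: eq_bigr => b _; rewrite coenergyZl.
Qed.

Lemma energy_scaler c s t : energy s (weight (fun=> c) t) = c * energy s t.
Proof. by rewrite energyC energy_scalel energyC. Qed.

Lemma state_cat s t : state (s ++ t) = state s + state t.
Proof. by rewrite /state big_cat. Qed.

Lemma state_scale c s : state (weight (fun=> c) s) = qreal c *: state s.
Proof.
rewrite /state big_map scaler_sumr; apply: eq_bigr => a _.
by rewrite !mulmxZr.
Qed.

Lemma admissible_cat s t :
  admissible_signal (s ++ t) = admissible_signal s && admissible_signal t.
Proof. exact: all_cat. Qed.

Lemma admissible_weight c s : admissible_signal (weight c s) = admissible_signal s.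
Proof. by rewrite /admissible_signal all_map. Qed.

Lemma resolventE x : f.[x] != 0 -> qreal x *: Rs x = 1%:M + A *m Rs x.
Proof.
move=> fx; rewrite -(mulmx_resolventr fA fx) mulmxBl subrK.
by rewrite mul_scalar_mx.
Qed.

(* [weight id] is the time derivative of the signal. *)
Lemma state_derivative s : admissible_signal s ->
  state (weight id s) = A *m state s + B *m input s.
Proof.
move=> /allP ok; rewrite /state /input big_map !mulmx_sumr -big_split big_seq.
rewrite [RHS]big_seq; apply: eq_bigr => a /ok /andP[_ fa] /=.
by rewrite !mulmxZr scalemxAl resolventE// mulmxDl mul1mx addrC !mulmxA.
Qed.

Lemma output_sum s :
  \sum_(a <- s) transfer a.1 *m a.2 = C *m state s + D *m input s.
Proof.
rewrite /state /input !mulmx_sumr -big_split; apply: eq_bigr => a _ /=.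
by rewrite mulmxDl addrC !mulmxA.
Qed.

(** The factor x + y differentiates the product of two exponentials in time, so the left side is the
    rate of energy supply at time 0, twice the real part of u^* y. *)
Lemma energy_sum_points s : admissible_signal s ->
  \sum_(a <- s) \sum_(b <- s) (a.1 + b.1) * coenergy a b =
  2 * ip (input s) (C *m state s + D *m input s).
Proof.
move=> /allP ok; rewrite -output_sum /input.
rewrite mulr_natl mulr2n {2}ipC !ip_suml -big_split.
rewrite [LHS]big_seq [RHS]big_seq; apply: eq_bigr => a /ok /andP[a0 _].
rewrite !ip_sumr -big_split [LHS]big_seq [RHS]big_seq.
apply: eq_bigr => b /ok /andP[b0 _] /=.
by rewrite /coenergy mulrCA divff ?mulr1// gt_eqF// addr_gt0.
Qed.

Hypothesis energy_ge0 : forall s, admissible_signal s -> 0 <= energy s s.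
Hypothesis reachable : forall v, exists2 s, admissible_signal s & state s = v.

Definition costs v := [set e : R | exists s,
  [/\ admissible_signal s, state s = v & e = energy s s]].
(** The required supply in the sense of Willems: the least energy that brings the system from rest
    at -oo to the state [v]. *)
Definition cost v := inf (costs v).

Lemma costs_inf v : has_inf (costs v).
Proof.
split; first by have [s os sv] := reachable v; exists (energy s s), s.
by exists 0 => _ [s [os _ ->]]; exact: energy_ge0.
Qed.

Lemma cost_le s : admissible_signal s -> cost (state s) <= energy s s.
Proof. by move=> os; apply: ge_inf; [exact: (costs_inf _).2 | exists s]. Qed.

Lemma cost_approx v e : 0 < e -> exists s,
  [/\ admissible_signal s, state s = v & energy s s < cost v + e].
Proof.
move=> e0; have [_ [s [os sv ->]] lt] := inf_adherent e0 (costs_inf v).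
by exists s.
Qed.

Lemma cost_ge0 v : 0 <= cost v.
Proof.
by apply: lb_le_inf; [exact: (costs_inf v).1 | move=> _ [s [os _ ->]]; exact: energy_ge0].
Qed.

Lemma costZ_le c v : cost (qreal c *: v) <= c ^+ 2 * cost v.
Proof.
have [->|c0] := eqVneq c 0.
  rewrite rmorph0 scale0r expr0n mul0r.
  have := @cost_le [::] isT; rewrite /state /energy !big_nil.
  by [].
have c2 : 0 < c ^+ 2 by rewrite exprn_even_gt0.
apply/ler_addgt0Pr => e e0.
have [|s [os sv lt]] := @cost_approx v (e / c ^+ 2); first by rewrite divr_gt0.
have := @cost_le (weight (fun=> c) s); rewrite admissible_weight state_scale sv.
move=> /(_ os) /le_trans; apply.
rewrite energy_scalel energy_scaler mulrA -expr2.
by rewrite -[e](divfK (lt0r_neq0 c2)) [e / _ * _]mulrC -mulrDr ler_pM2l// ltW.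
Qed.

Lemma costZ c v : cost (qreal c *: v) = c ^+ 2 * cost v.
Proof.
apply/eqP; rewrite eq_le costZ_le /=.
have [->|c0] := eqVneq c 0; first by rewrite expr0n mul0r cost_ge0.
have := costZ_le c^-1 (qreal c *: v); rewrite scalerA -rmorphM /= mulVf//.
rewrite rmorph1 scale1r exprVn => h.
by rewrite -ler_pdivlMl// exprn_even_gt0.
Qed.

(** Nearly optimal signals [s] and [t] for [u] and [v] give s + t and s - t for u + v and u - v, and
    [energy] satisfies the parallelogram law exactly. The reverse inequality is this one at (u + v,
    u - v). *)
Lemma cost_par_le u v : cost (u + v) + cost (u - v) <= 2 * cost u + 2 * cost v.
Proof.
apply/ler_addgt0Pr => e e0.
have e4 : 0 < e / 4 by rewrite divr_gt0.
have [s [os su ls]] := cost_approx u e4; have [t [ot tv lt]] := cost_approx v e4.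
have h1 := @cost_le (s ++ t); have h2 := @cost_le (s ++ weight (fun=> -1) t).
move: h1 h2; rewrite !admissible_cat admissible_weight os ot !state_cat state_scale.
rewrite rmorphN rmorph1 scaleN1r su tv => /(_ isT) h1 /(_ isT) h2.
move: h1 h2; rewrite !(energy_catl, energy_catr, energy_scalel, energy_scaler).
rewrite (energyC t s); lra.
Qed.

Lemma cost_par u v : cost (u + v) + cost (u - v) = 2 * cost u + 2 * cost v.
Proof.
apply/eqP; rewrite eq_le cost_par_le /=.
have := cost_par_le (u + v) (u - v).
have -> : u + v + (u - v) = qreal 2 *: u.
  by rewrite addrACA subrr addr0 rmorphD rmorph1 scalerDl scale1r.
have -> : u + v - (u - v) = qreal 2 *: v.
  by rewrite opprD opprK addrACA subrr add0r rmorphD rmorph1 scalerDl scale1r.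
rewrite !costZ; lra.
Qed.

(** The system matrices act on the left, so multiplying every input on the right by [q] multiplies
    the state by [q] and the energy by |q|^2. *)
Lemma costM_le q v : cost (v *m q%:M) <= qnormsq q * cost v.
Proof.
have [->|q0] := eqVneq q 0.
  rewrite qscalar0 mulmx0 /qnormsq /= expr0n /= !addr0 mul0r.
  by have := costZ_le 0 0; rewrite rmorph0 scale0r expr0n mul0r.
have q2 : 0 < qnormsq q by rewrite lt_neqAle eq_sym qnormsq_eq0 q0 qnormsq_ge0.
apply/ler_addgt0Pr => e e0.
have [|s [os sv lt]] := @cost_approx v (e / qnormsq q); first by rewrite divr_gt0.
pose s' := [seq (a.1, a.2 *m q%:M) | a <- s].
have os' : admissible_signal s' by rewrite /admissible_signal all_map.
have sv' : state s' = v *m q%:M.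
  rewrite -sv /state big_map mulmx_suml; apply: eq_bigr => a _.
  by rewrite !mulmxA.
have es' : energy s' s' = qnormsq q * energy s s.
  rewrite /energy big_map mulr_sumr; apply: eq_bigr => a _.
  rewrite big_map mulr_sumr; apply: eq_bigr => b _.
  rewrite /coenergy mulrA; congr (_ / _); rewrite /= mulrDr.
  by congr (_ + _); rewrite mulmxA ip_mulr.
rewrite -sv'; apply: (le_trans (cost_le os')); rewrite es'.
by rewrite -[e](divfK (lt0r_neq0 q2)) [e / _ * _]mulrC -mulrDr ler_pM2l// ltW.
Qed.

Lemma costM q v : cost (v *m q%:M) = qnormsq q * cost v.
Proof.
apply/eqP; rewrite eq_le costM_le /=.
have [->|q0] := eqVneq q 0.
  by rewrite /qnormsq /= expr0n /= !addr0 mul0r cost_ge0.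
have q2 : 0 < qnormsq q by rewrite lt_neqAle eq_sym qnormsq_eq0 q0 qnormsq_ge0.
have := costM_le (qconj q) (v *m q%:M).
rewrite -mulmxA -scalar_mxM mul_qconj mulmx_scalar_real costZ.
have -> : qnormsq (qconj q) = qnormsq q by rewrite /qnormsq /= !sqrrN.
by rewrite expr2 -mulrA ler_pM2l.
Qed.

Local Notation form := (polar cost).

(* An implicit Euler step: [s] is [(1 - h d/dt) s'], and the pole [1/h] of
   [s'], invisible in [s], carries the freedom to prescribe the input of [s']. *)
Lemma implicit_step h v w s : 0 < h -> admissible h^-1 -> admissible_signal s ->
  all (fun a => a.1 != h^-1) s ->
  state s = v - qreal h *: (A *m v + B *m w) ->
  cost v + h ^+ 2 * cost (A *m v + B *m w) <=
  energy s s + 2 * h * ip w (C *m v + D *m w).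
Proof.
move=> h0 adh os /allP offh sE.
pose t := weight (fun x => (1 - h * x)^-1) s.
pose s' : signal := (h^-1, w - input t) :: t.
have os' : admissible_signal s' by rewrite /= adh admissible_weight.
have iw : input s' = w by rewrite /input big_cons subrK.
pose ns := weight (fun x => 1 - h * x) s'.
have nsE : ns = (h^-1, 0) :: s.
  rewrite /ns /= divff ?gt_eqF// subrr rmorph0 scale0r; congr (_ :: _).
  rewrite /t /weight -map_comp -[RHS]map_id; apply/eq_in_map => -[x y] xs /=.
  congr (_, _); rewrite scalerA -rmorphM /= mulfV ?rmorph1 ?scale1r// subr_eq0.
  apply: contra_neq (offh _ xs) => e.
  by rewrite -[h^-1]mulr1 /= e mulKf// gt_eqF.
have en : energy ns ns = energy s s.
  have z b : coenergy (h^-1, 0) b = 0.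
    by rewrite /coenergy /= ip0l add0r mulmx0 ip0l mul0r.
  rewrite nsE /energy big_cons big1 ?add0r => [|b _]; last exact: z.
  by apply: eq_bigr => a _; rewrite big_cons coenergyC z add0r.
(* Expand (1 - hx)(1 - hy) = 1 - h(x + y) + h^2 xy; [energy_sum_points] evaluates the middle
   term. *)
have e' : energy ns ns = energy s' s' - h * (2 * ip w (C *m state s' + D *m w)) +
    h ^+ 2 * energy (weight id s') (weight id s').
  rewrite -[in ip _ _]iw -energy_sum_points// !energy_weight {1}/energy.
  rewrite !mulr_sumr -sumrB -big_split; apply: eq_bigr => a _.
  rewrite !mulr_sumr -sumrB -big_split; apply: eq_bigr => b _ /=.
  by ring.
have ds' : state (weight id s') = A *m state s' + B *m w.
  by rewrite state_derivative// iw.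
have sns : state ns = state s' - qreal h *: state (weight id s').
  rewrite /state !big_map scaler_sumr -sumrB; apply: eq_bigr => a _ /=.
  rewrite !mulmxZr scalerA -rmorphM -[X in _ = X - _]scale1r.
  by rewrite -(rmorph1 (@qreal R)) -scalerBl -rmorphB.
(* The state of [s'] and [v] have the same image under 1 - hA, which is injective since 1/h is not a
   root of [f]. *)
have sv : state s' = v.
  have st : state ns = state s.
    by rewrite nsE /state big_cons /= !mulmx0 add0r.
  have [_ fh] := andP adh.
  have : qreal h^-1 *: state ns = qreal h^-1 *: state s by rewrite st.
  rewrite sE sns ds' !scalerBr !scalerA -!rmorphM /= mulVf ?gt_eqF// rmorph1 !scale1r.
  rewrite !opprD !addrA => /addIr e.
  have /(congr1 (mulmx (Rs h^-1))) : ((qreal h^-1)%:M - A) *m state s' = ((qreal h^-1)%:M - A) *m v.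
    by rewrite !mulmxBl !mul_scalar_mx.
  by rewrite !mulmxA mulmx_resolventl// !mul1mx.
have c1 := cost_le os'.
have c2 := @cost_le (weight id s'); rewrite admissible_weight in c2.
have {}c2 := c2 os'.
rewrite ds' sv in c2; rewrite sv in c1 e'.
have h2 : 0 < h ^+ 2 by rewrite exprn_gt0.
rewrite -(ler_pM2l h2) in c2.
move: c1 c2 e'; rewrite en; lra.
Qed.

Lemma form_expand u v : cost (u - v) = cost u - 2 * form u v + cost v.
Proof. by have := cost_par u v; rewrite /polar; lra. Qed.

(** For a step of length 1 + d, the new rate 1/(1 + d) must avoid the roots of [f] and the rates
    already present: finitely many values. *)
Lemma admissible_near1 (s : signal) e : 0 < e -> exists d,
  [/\ 0 < d, d <= e, admissible (1 + d)^-1 & all (fun a => a.1 != (1 + d)^-1) s].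
Proof.
move=> e0; pose F := f * \prod_(a <- s) ('X - a.1%:P).
have F0 : F != 0.
  by rewrite mulf_neq0// monic_neq0// monic_prod// => a _; exact: monicXsubC.
pose g (k : nat) := (1 + e / k.+1%:R)^-1.
have ginj : injective g.
  move=> k l /invr_inj/addrI/(mulfI (lt0r_neq0 e0))/invr_inj/eqP.
  by rewrite eqr_nat => /eqP[].
have [l [_ + lP]] := poly_nonroots 1 F0 ginj; case: l lP => // x l lP _.
have [] := lP x; first by rewrite mem_head.
rewrite hornerM mulf_eq0 negb_or => /andP[fx px] [k xk].
have d0 : 0 < e / k.+1%:R by rewrite divr_gt0.
exists (e / k.+1%:R); split => //.
- by rewrite ler_pdivrMr// ler_peMr ?ler1n// ltW.
- by rewrite /admissible -/(g k) -xk fx andbT xk /g invr_gt0 addr_gt0.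
- apply/allP => a as_; apply: contra_neq px => ax.
  apply/eqP; rewrite horner_prod prodf_seq_eq0; apply/hasP; exists a => //=.
  by rewrite hornerXsubC ax xk subrr.
Qed.

(** A step of length 1 from a nearly optimal signal for v - z, with z = A v + B w, would give cost v
    + cost z <= cost (v - z) + 2 ip w (C v + D w), which [form_expand] turns into the claim: the
    cost being quadratic, the step length need not tend to 0. As the rate 1 may be forbidden, the
    length is 1 + d, and adding [- d] times a signal for z produces the required initial state. *)
Lemma dissipation v w : form v (A *m v + B *m w) <= ip w (C *m v + D *m w).
Proof.
set z := A *m v + B *m w; set sg := ip w _; rewrite leNgt; apply/negP => gap.
pose g := cost v + cost z - cost (v - z) - 2 * sg.
have g0 : 0 < g by rewrite /g form_expand; lra.
have [|s [os sv ls]] := @cost_approx (v - z) (g / 2); first by rewrite divr_gt0.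
have [t [ot tz _]] := @cost_approx z 1 ltr01.
(* The first and second order coefficients in [d] of the error caused by using 1 + d instead of
   1. *)
pose m1 := 2 * sg - 2 * energy s t - 2 * cost z; pose m2 := energy t t - cost z.
pose M := `|m1| + `|m2|.
have M0 : 0 <= M by rewrite addr_ge0.
pose e := Num.min 1 (g / 4 / (M + 1)).
have e0 : 0 < e.
  rewrite lt_min ltr01 /= !divr_gt0//; lra.
have [d [d0 de adm off]] := admissible_near1 (s ++ t) e0.
have h0 : 0 < 1 + d by lra.
pose r := s ++ weight (fun=> - d) t.
have or : admissible_signal r by rewrite admissible_cat os admissible_weight.
have offr : all (fun a => a.1 != (1 + d)^-1) r.
  by move: off; rewrite !all_cat => /andP[-> ot']; rewrite all_map.
have sr : state r = v - qreal (1 + d) *: z.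
  rewrite state_cat state_scale sv tz rmorphN rmorphD rmorph1 scalerDl scale1r.
  by rewrite scaleNr -[LHS]addrA -opprD.
have := implicit_step h0 adm or offr sr; rewrite -/z -/sg /r.
rewrite !(energy_catl, energy_catr, energy_scalel, energy_scaler) (energyC t s).
move=> step.
have d1 : d <= 1 by rewrite (le_trans de)// ge_min lexx.
have dM : d * (M + 1) <= g / 4.
  rewrite -ler_pdivlMr; last by lra.
  by rewrite (le_trans de)// ge_min lexx orbT.
have b1 : d * m1 <= d * `|m1| by rewrite ler_pM2l// ler_norm.
have b2 : d ^+ 2 * m2 <= d * `|m2|.
  apply: (@le_trans _ _ (d ^+ 2 * `|m2|)).
    by rewrite ler_pM2l ?exprn_gt0// ler_norm.
  by rewrite ler_wpM2r// expr2 ler_piMr// ltW.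
have bM : d * M <= d * (M + 1) by rewrite ler_pM2l//; lra.
have eM : d * M = d * `|m1| + d * `|m2| by rewrite /M mulrDr.
move: step ls; rewrite /g /m1 /m2 in dM g0 b1 b2 eM *; clear -g0 b1 b2 bM dM eM.
lra.
Qed.

Lemma storage_exists : exists Q : 'M[H]_N, [/\ hermitian Q,
  forall v, 0 <= ip v (Q *m v) &
  forall v w, ip v (Q *m (A *m v + B *m w)) <= ip w (C *m v + D *m w)].
Proof.
have [Q [hQ QE]] := quadratic_form_matrix cost_ge0 cost_par costZ costM.
exists Q; split => //.
- by move=> v; rewrite QE (polar_diag costZ); exact: cost_ge0.
- by move=> v w; rewrite QE; exact: dissipation.
Qed.

End PositiveRealLemma.

(** * Definiteness of the storage form *)

Section StoragePositivity.
Variable R : realType.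
Notation H := (quat R).
Variables (n N : nat) (A : 'M[H]_N) (B : 'M[H]_(N, n)) (C : 'M[H]_(n, N)).
Variables (D : 'M[H]_n) (Q : 'M[H]_N).
Hypothesis hQ : hermitian Q.
Hypothesis Q_ge0 : forall v, 0 <= ip v (Q *m v).
Hypothesis diss : forall v w,
  ip v (Q *m (A *m v + B *m w)) <= ip w (C *m v + D *m w).

Lemma le_square_eq0 (a b : R) : (forall t, t * a <= t ^+ 2 * b) -> a = 0.
Proof.
move=> h; pose t := a / (1 + `|b|).
have b1 : 0 < 1 + `|b| by rewrite ltr_pwDl.
have : a ^+ 2 / (1 + `|b|) <= a ^+ 2 / (1 + `|b|) * (b / (1 + `|b|)).
  have -> : a ^+ 2 / (1 + `|b|) = t * a by rewrite /t; ring.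
  have -> : t * a * (b / (1 + `|b|)) = t ^+ 2 * b by rewrite /t; ring.
  exact: h.
have bb : b / (1 + `|b|) < 1 by rewrite ltr_pdivrMr// mul1r ltr_pwDl// ler_norm.
have [->//|a0] := eqVneq a 0.
have ap : 0 < a ^+ 2 / (1 + `|b|) by rewrite divr_gt0// exprn_even_gt0.
by rewrite -{1}[X in X <= _]mulr1 ler_pM2l// leNgt bb.
Qed.

(** Perturb the dissipation inequality at [v] by [t w], first in the input, then in the state. As
    [Q *m v = 0] there is no constant term, and the linear term, bounded by a quadratic one for
    either sign of [t], must vanish. So the kernel of [Q] is [A]-invariant and lies in the kernel of
    [C]. *)
Lemma storage_ker (v : 'cV[H]_N) : Q *m v = 0 -> C *m v = 0 /\ Q *m (A *m v) = 0.
Proof.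
move=> Qv; split; apply: ip_nondeg => w.
  apply/eqP; rewrite -oppr_eq0; apply/eqP.
  apply: (@le_square_eq0 _ (ip w (D *m w))) => t.
  have := diss v (qreal t *: w).
  rewrite ip_adjr hQ Qv ip0l ipZl mulmxZr ipDr ipZr; lra.
apply: (@le_square_eq0 _ (- ip w (Q *m (A *m w)))) => t.
have := diss (v + qreal t *: w) 0.
rewrite mulmx0 addr0 ip0l ip_adjr hQ mulmxDr Qv add0r mulmxZr ipZl mulmxDr mulmxZr.
by rewrite ipDr ipZr !ip_adj hQ; lra.
Qed.

Lemma storage_pd : (forall v : 'cV[H]_N, (forall t, C *m A ^+ t *m v = 0) -> v = 0) ->
  forall v, v != 0 -> 0 < ip v (Q *m v).
Proof.
move=> obs v v0; rewrite lt_neqAle Q_ge0 andbT eq_sym; apply: contra_neq v0.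
move=> /(psd_ker hQ Q_ge0) Qv; apply: obs => t.
suff [] : C *m (A ^+ t *m v) = 0 /\ Q *m (A ^+ t *m v) = 0 by rewrite mulmxA.
elim: t => [|t [_ IH]].
  by rewrite expr0 -[1 *m v]/(1%:M *m v) mul1mx; split => //; exact: (storage_ker Qv).1.
by rewrite exprS -[A * _]/(A *m _) -mulmxA; have [_ q] := storage_ker IH; have [] := storage_ker q.
Qed.

End StoragePositivity.

(** * The kernel as the solution of a Sylvester equation *)

Section Kernel.
Variable R : realType.
Notation H := (quat R).

Lemma slice_unit_decomp (p : H) : exists y : R,
  imag_sphere (slice_unit p) /\ p = slice_point (qre p) y (slice_unit p).
Proof.
pose v := p - qreal (qre p).
have pv : p = qreal (qre p) + v by rewrite addrC subrK.
rewrite /slice_unit -/v; have [v0|v0] := eqVneq v 0.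
  exists 0; split; last by rewrite /slice_point rmorph0 mulr0 addr0 {1}pv v0 addr0.
  by split => //; rewrite /qnorm /qnormsq /= expr0n expr1n /= !addr0 add0r sqrtr1.
have n0 : qnorm v != 0.
  rewrite /qnorm sqrtr_eq0 -ltNge lt_neqAle qnormsq_ge0 andbT eq_sym.
  by rewrite qnormsq_eq0.
exists (qnorm v); split.
  split; first by rewrite -qrealC qreMl /v raddfB /= subrr mulr0.
  by rewrite qnormZ ger0_norm ?invr_ge0 ?sqrtr_ge0// mulVf.
by rewrite /slice_point -mulrA -rmorphM mulVf// rmorph1 mulr1.
Qed.

Lemma slice_mulE x y (I u w : H) : I * I = -1 ->
  (qreal x + I * qreal y) * (u + I * w) =
  (qreal x * u - qreal y * w) + I * (qreal x * w + qreal y * u).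
Proof.
move=> I2.
have e1 : qreal x * (I * w) = I * (qreal x * w) by rewrite mulrA qrealC -mulrA.
have e2 : I * qreal y * (I * w) = - (qreal y * w).
  by rewrite -mulrA (mulrA (qreal y)) (qrealC y I) -mulrA mulrA I2 mulN1r.
rewrite mulrDl !mulrDr e1 e2 -mulrA [I * (_ * u) - _]addrC.
by rewrite addrACA.
Qed.

(** The denominator is a real polynomial in [p], hence commutes with [p], and p(p + q) + (p + q)
    conj q equals it. Its imaginary part is 2(Re p + Re q) Im p, so a zero would be real, where the
    value is positive. *)
Lemma star_inv_add_conjP (p q : H) : half_space p -> half_space q ->
  p * star_inv_add_conj p q + star_inv_add_conj p q * qconj q = 1.
Proof.
move=> p0 q0; rewrite /star_inv_add_conj.
set d := qreal (qnormsq q) + _ + _.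
have d0 : d != 0.
  apply/eqP; move: p0 q0; rewrite /d expr2 /half_space /qnormsq /=.
  case: p {d} => a b c e; case: q => a' b' c' e' /= a0 a0' [] h1 h2 h3 h4.
  have z t : 2 * a' * t + (a * t + t * a) = 0 -> t = 0.
    move=> ht; have : (a + a') * t = 0 by lra.
    by move/eqP; rewrite mulf_eq0 => /orP[/eqP|/eqP//]; lra.
  have b0 : b = 0 by apply: z; lra.
  have c0 : c = 0 by apply: z; subst b; lra.
  have e0 : e = 0 by apply: z; subst b c; lra.
  subst b c e; nra.
have pr t : GRing.comm p (qreal t) by rewrite /GRing.comm qrealC.
have pd : GRing.comm p d.
  apply: commrD; last exact: commrX.
  by apply: commrD => //; apply: commrM.
have pdV : p * d^-1 = d^-1 * p by exact: commrV.
rewrite mulrA pdV -!mulrA -mulrDr.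
suff -> : p * (p + q) + (p + q) * qconj q = d by rewrite mulVr.
have qq : q + qconj q = qreal (2 * qre q).
  by case: q {q0 d d0 pr pd pdV} => *; congr Quat; rewrite /=; ring.
rewrite /d expr2 mulrDr mulrDl mul_qconj -addrA [p * q + _]addrA -mulrDr qq.
by rewrite -qrealC addrC [_ * p + _]addrC.
Qed.

Lemma add_sub_eq1 (u z : H) : u + z = 1 -> u - z = 1 -> u = 1 /\ z = 0.
Proof.
case: u z => a b c d [a' b' c' d'] [h1 h2 h3 h4] [k1 k2 k3 k4].
by split; congr Quat; lra.
Qed.

Lemma slice_sylvester (I a b c d q : H) x y : I * I = -1 ->
  qreal x * c - qreal y * d + c * q = 1 ->
  qreal x * d + qreal y * c + d * q = 0 ->
  let K := (a * c - b * d) + I * (a * d + b * c) in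
  (qreal x + I * qreal y) * K + K * q = a + I * b.
Proof.
move=> I2 h1 h2 /=; rewrite slice_mulE// mulrDl addrACA -[I * _ * q]mulrA -mulrDr.
congr (_ + I * _).
  transitivity (a * (qreal x * c - qreal y * d + c * q) -
                b * (qreal x * d + qreal y * c + d * q)).
    case: a b c d q {h1 h2} => [? ? ? ?] [? ? ? ?] [? ? ? ?] [? ? ? ?] [? ? ? ?].
    by congr Quat; rewrite /=; ring.
  by rewrite h1 h2 mulr1 mulr0 subr0.
transitivity (a * (qreal x * d + qreal y * c + d * q) +
              b * (qreal x * c - qreal y * d + c * q)).
  case: a b c d q {h1 h2} => [? ? ? ?] [? ? ? ?] [? ? ? ?] [? ? ? ?] [? ? ? ?].
  by congr Quat; rewrite /=; ring.
by rewrite h1 h2 mulr1 mulr0 add0r.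
Qed.

(** The star product is not pointwise, so the equation for [star_inv_add_conj] is used at both [p]
    and [qconj p]: together they split into the two slice components that [slice_sylvester] takes as
    hypotheses. *)
Lemma caratheodory_sylvester n (phi : H -> 'M[H]_n) p q :
  half_space p -> half_space q ->
  p *: caratheodory_kernel phi p q + caratheodory_kernel phi p q *m (qconj q)%:M
  = phi p + qadj (phi q).
Proof.
move=> p0 q0; rewrite /caratheodory_kernel /star.
set f := fun p' => phi p' + qadj (phi q).
set g := fun p' => (star_inv_add_conj p' q)%:M.
have [y [SI pE]] := slice_unit_decomp p; set I := slice_unit p in SI pE *.
have I2 := imag_sphere_sqr SI.
set x := qre p in pE.
have pcE : qconj p = qreal x - I * qreal y.
  by rewrite pE qconj_slice_point// /slice_point rmorphN mulrN.
have pc0 : half_space (qconj p) by [].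
pose s := star_inv_add_conj p q; pose s' := star_inv_add_conj (qconj p) q.
pose c := qreal 2^-1 * (s + s'); pose d := qreal 2^-1 * (I * (s' - s)).
have h21 : qreal 2^-1 + qreal 2^-1 = 1 :> H.
  by rewrite -rmorphD -[RHS](rmorph1 (@qreal R)); congr qreal; lra.
have Id : I * d = qreal 2^-1 * (s - s').
  by rewrite /d mulrA -qrealC -mulrA (mulrA I) I2 mulN1r opprB.
have sE : s = c + I * d.
  by rewrite Id /c -mulrDr addrACA subrr addr0 mulrDr -mulrDl h21 mul1r.
have s'E : s' = c - I * d.
  rewrite Id /c -mulrBr opprB [s + s']addrC addrACA subrr addr0.
  by rewrite mulrDr -mulrDl h21 mul1r.
have e1 := star_inv_add_conjP p0 q0; have e2 := star_inv_add_conjP pc0 q0.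
rewrite -/s -/s' pcE in e1 e2.
have X1 : (qreal x * c - qreal y * d + c * qconj q) +
    I * (qreal x * d + qreal y * c + d * qconj q) = 1.
  rewrite -e1 {1}pE /slice_point sE slice_mulE// [in RHS]mulrDl mulrDr mulrA.
  by rewrite [RHS]addrACA -mulrA.
have X2 : (qreal x * c - qreal y * d + c * qconj q) -
    I * (qreal x * d + qreal y * c + d * qconj q) = 1.
  have := slice_mulE x (- y) c (- d) I2; rewrite rmorphN !mulrN !mulNr opprK => h.
  rewrite -e2 s'E h mulrBl -[I * d * _]mulrA addrACA; congr (_ + _).
  by rewrite -[LHS]mulrN -[- (I * (d * _))]mulrN -mulrDr !opprD.
have [Xc IXd] := add_sub_eq1 X1 X2.
have Xd : qreal x * d + qreal y * c + d * qconj q = 0.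
  have := congr1 ( *%R I) IXd; rewrite mulrA I2 mulN1r mulr0 => /eqP.
  by rewrite oppr_eq0 => /eqP.
have fE : f p = alpha_part f p + I *: beta_part f p.
  have e : I * qreal 2^-1 * I = - qreal 2^-1.
    by rewrite -qrealC -mulrA I2 mulrN1.
  rewrite /alpha_part /beta_part -/I !scalerA e scaleNr -scalerN -scalerDr opprB.
  rewrite addrACA [f (qconj p) - _]subrr addr0 scalerDr -scalerDl h21.
  by rewrite scale1r.
have gE : alpha_part g p = c%:M /\ beta_part g p = d%:M.
  by rewrite /alpha_part /beta_part /g -raddfD -raddfB !scale_scalar_mx.
rewrite gE.1 gE.2 -/(f p) fE.
set a := alpha_part f p; set b := beta_part f p.
apply/matrixP => i j; rewrite mxE mulcol_scalarE [X in X + _]mxE.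
have -> : (a *m c%:M - b *m d%:M + I *: (a *m d%:M + b *m c%:M)) i j =
    (a i j * c - b i j * d) + I * (a i j * d + b i j * c).
  by rewrite -!mulcol_scalarE !mxE.
rewrite {1}pE [RHS]mxE [X in _ = _ + X]mxE.
exact: slice_sylvester.
Qed.

End Kernel.

(** * Necessity *)

Section Necessity.
Variable R : realType.
Notation H := (quat R).

(** A nonzero entry k would give p = - k (conj q) k^-1, a conjugate of - conj q, with real part - Re
    q < 0. *)
Lemma sylvester_uniq n (K : 'M[H]_n) p q : half_space p -> half_space q ->
  p *: K + K *m (qconj q)%:M = 0 -> K = 0.
Proof.
move=> p0 q0 /matrixP h; apply/matrixP => i j; rewrite mxE.
have := h i j; rewrite mxE mulcol_scalarE mxE mxE.
set k := K i j => e; apply/eqP; apply: contraT => k0.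
have pE : p = - (k * qconj q) / k.
  by move/eqP: e; rewrite addr_eq0 => /eqP <-; rewrite mulrK.
move: p0; rewrite /half_space /= pE mulNr raddfN /= qreM_C mulrA mulVr// mul1r.
by rewrite qre_conj oppr_gt0 ltNge ltW.
Qed.

Lemma sylvester_inj n (K L : 'M[H]_n) p q : half_space p -> half_space q ->
  p *: K + K *m (qconj q)%:M = p *: L + L *m (qconj q)%:M -> K = L.
Proof.
move=> p0 q0 e; apply/eqP; rewrite -subr_eq0; apply/eqP.
apply: (sylvester_uniq p0 q0); rewrite scalerBr mulmxBl addrACA -opprD e.
exact: subrr.
Qed.

Lemma caratheodory_kernel_real n (phi : H -> 'M[H]_n) x y : 0 < x -> 0 < y ->
  caratheodory_kernel phi (qreal x) (qreal y) =
  qreal (x + y)^-1 *: (phi (qreal x) + qadj (phi (qreal y))).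
Proof.
move=> x0 y0; apply: (@sylvester_inj _ _ _ (qreal x) (qreal y)) => //.
rewrite caratheodory_sylvester// qconj_real mulmx_scalar_real !scalerA -scalerDl.
by rewrite -!rmorphM -rmorphD /= -mulrDl mulfV ?rmorph1 ?scale1r// gt_eqF// addr_gt0.
Qed.

Lemma caratheodory_hermitian n (phi : H -> 'M[H]_n) u v :
  half_space u -> half_space v ->
  caratheodory_kernel phi u v = qadj (caratheodory_kernel phi v u).
Proof.
move=> u0 v0; apply: (sylvester_inj u0 v0); rewrite caratheodory_sylvester//.
have := congr1 (@qadj R n n) (caratheodory_sylvester phi v0 u0).
move: (caratheodory_kernel phi v u) => K; rewrite !raddfD /= qadjM qadj_scalar !qadjK qconjK.
have -> : qadj (v *: K) = qadj K *m (qconj v)%:M.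
  by apply/matrixP => i j; rewrite mulcol_scalarE !qadjE [X in qconj X]mxE qconjM.
by rewrite mul_scalar_mx [LHS]addrC [RHS]addrC.
Qed.

Lemma real_kernel_psd n (K : H -> H -> 'M[H]_n) (s : seq (R * 'cV[H]_n)) :
  positive_definite_kernel half_space K -> all (fun a => 0 < a.1) s ->
  0 <= \sum_(a <- s) \sum_(b <- s) ip a.2 (K (qreal a.1) (qreal b.1) *m b.2).
Proof.
move=> [Kh Kp] /allP s0.
pose z : R * 'cV[H]_n := (0, 0).
pose u (k : 'I_(size s)) := qreal (nth z s k).1.
pose xi (k : 'I_(size s)) := (nth z s k).2.
have hu k : half_space (u k) by apply: s0; exact: mem_nth.
set X := (\matrix_(k < size s, j < size s)
  (qadj (xi k) *m K (u k) (u j) *m xi j) ord0 ord0).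
have hX : hermitian X.
  apply/matrixP => k j; rewrite qadjE [X in qconj X]mxE [RHS]mxE -qadjE !qadjM qadjK -Kh//.
  by rewrite mulmxA.
(* The vectors [xi] already carry all the coefficients, so the form is evaluated at the all-ones
   column. *)
have := psd_of_no_negative_eigenvalue hX (Kp _ u xi hu) (const_mx 1).
congr (_ <= _); rewrite ipE (big_nth z) big_mkord; apply: eq_bigr => k _.
rewrite mxE qconj_real mul1r mxE raddf_sum (big_nth z) big_mkord.
by apply: eq_bigr => j _; rewrite /= [const_mx _ _ _]mxE mulr1 [X k j]mxE /ip mulmxA.
Qed.

Lemma mx_eval_adj N (A : 'M[H]_N) (f : {poly R}) :
  mx_eval (qadj A) f = qadj (mx_eval A f).
Proof.
by rewrite /mx_eval raddf_sum; apply: eq_bigr => i _ /=; rewrite qadjZ qadjX.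
Qed.

Lemma resolvent_adj N (A : 'M[H]_N) (f : {poly R}) x : mx_eval A f = 0 ->
  f.[x] != 0 -> resolvent (qadj A) f x = qadj (resolvent A f x).
Proof.
move=> fA fx.
have fA' : mx_eval (qadj A) f = 0 by rewrite mx_eval_adj fA raddf0.
apply/esym/(resolvent_uniq fA' fx).
have := congr1 (@qadj R N N) (mulmx_resolventr fA fx).
by rewrite qadjM raddfB /= qadj_scalar qconj_real qadj1.
Qed.

(** [W] is a controllability Gramian sampled at real rates: its null vectors are orthogonal to every
    (x - A)^-1 B, hence to every A^t B. With [Z] its inverse, the inputs B^* (x - A)^-* Z v steer to
    [v]. *)
Lemma reachableP n N (A : 'M[H]_N) (B : 'M[H]_(N, n)) (f : {poly R}) :
  f != 0 -> mx_eval A f = 0 ->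
  (forall v : 'cV[H]_N,
     (forall t : nat, qadj B *m qadj A ^+ t *m v = 0) -> v = 0) ->
  forall v, exists2 s, admissible_signal f s & state A B f s = v.
Proof.
move=> f0 fA ctr v.
have ginj : injective (fun k : nat => k.+1%:R : R).
  by move=> a b /eqP; rewrite eqr_nat => /eqP[].
have [l [ul fl lP]] := poly_nonroots (size f) f0 ginj.
have la x : x \in l -> admissible f x.
  by move=> /lP[fx [k xk]]; rewrite /admissible fx xk ltr0Sn.
pose Rs x := resolvent A f x.
pose W := \sum_(x <- l) Rs x *m B *m (qadj B *m qadj (Rs x)).
have Winj (w : 'cV[H]_N) : W *m w = 0 -> w = 0.
  move=> Ww; apply: ctr => t.
  have : ip w (W *m w) = 0 by rewrite Ww ip0r.
  rewrite mulmx_suml ip_sumr => /eqP.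
  have ipe x : ip w (Rs x *m B *m (qadj B *m qadj (Rs x)) *m w) =
      ip (qadj B *m qadj (Rs x) *m w) (qadj B *m qadj (Rs x) *m w).
    by rewrite -[Rs x *m B *m _ *m w]mulmxA ip_adjr qadjM.
  rewrite psumr_eq0 => [/allP w0|x _]; last by rewrite ipe ip_ge0.
  have e : qadj w *m A ^+ t *m B = 0.
    apply: (resolvent_observable fA f0 ul fl) => [x /lP[]//|x xl].
    have /w0/= := xl; rewrite ipe => /eqP/ip_eq0/(congr1 (@qadj R n 1)).
    by rewrite raddf0 !qadjM !qadjK mulmxA.
  have := congr1 (@qadj R _ _) e; rewrite !qadjM qadjX qadjK raddf0 mulmxA.
  by [].
have [Z WZ _] := mulmx_injective_invertible Winj.
exists [seq (x, qadj B *m qadj (Rs x) *m (Z *m v)) | x <- l].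
  by apply/allP => _ /mapP[x xl ->]; exact: la.
rewrite /state big_map /= -[RHS]mul1mx -WZ -mulmxA mulmx_suml.
by apply: eq_bigr => x _; rewrite !mulmxA.
Qed.

Lemma ip_col_mx m n (a a' : 'cV[H]_m) (b b' : 'cV[H]_n) :
  ip (col_mx a b) (col_mx a' b') = ip a a' + ip b b'.
Proof.
rewrite !ipE big_split_ord; congr (_ + _); apply: eq_bigr => i _.
  by rewrite !col_mxEu.
by rewrite !col_mxEd.
Qed.

Lemma qadj_block m1 m2 n1 n2 (A : 'M[H]_(m1, n1)) (B : 'M[H]_(m1, n2))
    (C : 'M[H]_(m2, n1)) (D : 'M[H]_(m2, n2)) :
  qadj (block_mx A B C D) = block_mx (qadj A) (qadj C) (qadj B) (qadj D).
Proof. by rewrite /qadj tr_block_mx map_block_mx. Qed.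

Lemma ipP m (X : 'M[H]_m) v : qre ((qadj v *m X *m v) ord0 ord0) = ip v (X *m v).
Proof. by rewrite /ip mulmxA. Qed.

Section LinearMatrixInequality.
Variables (n N : nat) (A : 'M[H]_N) (B : 'M[H]_(N, n)) (C : 'M[H]_(n, N)).
Variables (D : 'M[H]_n) (P : 'M[H]_N).
Hypothesis hP : hermitian P.

Let lmi := block_mx P 0 0 (1%:M : 'M[H]_n) *m block_mx A B C D
  + qadj (block_mx A B C D) *m block_mx P 0 0 (1%:M : 'M[H]_n).

Lemma lmi_form a b : ip (col_mx a b) (lmi *m col_mx a b) =
  2 * (ip (P *m a) (A *m a + B *m b) + ip b (C *m a + D *m b)).
Proof.
rewrite /lmi mulmxDl ipDr -!mulmxA.
have -> : ip (col_mx a b) (qadj (block_mx A B C D) *m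
    (block_mx P 0 0 1%:M *m col_mx a b)) =
    ip (col_mx a b) (block_mx P 0 0 1%:M *m (block_mx A B C D *m col_mx a b)).
  by rewrite ip_adjr qadjK ipC ip_adj qadj_block hP !raddf0 qadj1.
rewrite !mul_block_col !mul0mx !mul1mx addr0 add0r ip_col_mx ip_adjr hP.
ring.
Qed.

Lemma lmi_hermitian : hermitian lmi.
Proof.
rewrite /Defs.hermitian /lmi raddfD /= !qadjM qadjK addrC.
by rewrite qadj_block hP !raddf0 qadj1.
Qed.

Lemma lmi_psdP : positive_semidefinite lmi <->
  forall a b, 0 <= ip (P *m a) (A *m a + B *m b) + ip b (C *m a + D *m b).
Proof.
split=> [[_ h] a b|h].
  by have := h (col_mx a b); rewrite ipP lmi_form pmulr_rge0.
split; first exact: lmi_hermitian.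
by move=> v; rewrite ipP -[v]vsubmxK lmi_form mulr_ge0.
Qed.

End LinearMatrixInequality.

Lemma mulmx_inv_hermitian m (Q Z : 'M[H]_m) : hermitian Q -> Q *m Z = 1%:M ->
  hermitian Z.
Proof.
move=> hQ QZ; have := congr1 (@qadj R m m) QZ; rewrite qadjM hQ qadj1 => ZQ.
by rewrite /Defs.hermitian -[LHS]mulmx1 -QZ mulmxA ZQ mul1mx.
Qed.

Lemma pd_injective m (Q : 'M[H]_m) : (forall v, v != 0 -> 0 < ip v (Q *m v)) ->
  forall v : 'cV[H]_m, Q *m v = 0 -> v = 0.
Proof.
move=> Qpd v Qv; apply/eqP; apply: contraT => /Qpd.
by rewrite Qv ip0r ltxx.
Qed.

Lemma pd_inverse_pd m (Q Z : 'M[H]_m) : Q *m Z = 1%:M ->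
  (forall v, v != 0 -> 0 < ip v (Q *m v)) ->
  forall v, v != 0 -> 0 < ip v (Z *m v).
Proof.
move=> QZ Qpd v v0; have : 0 < ip (Z *m v) (Q *m (Z *m v)).
  apply: Qpd; apply: contra_neq v0 => Zv.
  by rewrite -[v]mul1mx -QZ -mulmxA Zv mulmx0.
by rewrite mulmxA QZ mul1mx ipC.
Qed.

Lemma lmi_of_positive_kernel n N (A : 'M[H]_N) (B : 'M[H]_(N, n))
    (C : 'M[H]_(n, N)) (D : 'M[H]_n) (f : {poly R}) (phi : H -> 'M[H]_n) :
  f != 0 -> mx_eval A f = 0 ->
  (forall x, admissible f x -> phi (qreal x) = transfer A B C D f x) ->
  minimal_realization A B C ->
  positive_definite_kernel half_space (caratheodory_kernel phi) ->
  exists P : 'M[H]_N, negative_definite P /\ positive_semidefinite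
    (block_mx P 0 0 (1%:M : 'M[H]_n) *m block_mx A B C D
     + qadj (block_mx A B C D) *m block_mx P 0 0 (1%:M : 'M[H]_n)).
Proof.
move=> f0 fA phiE [obs ctr] pos.
have fA' : mx_eval (qadj A) f = 0 by rewrite mx_eval_adj fA raddf0.
(* Reachability of the dual pair is observability of the given one. *)
have reach := @reachableP _ _ (qadj A) (qadj C) f f0 fA'.
rewrite !qadjK in reach; have {}reach := reach obs.
have trE x : admissible f x ->
    transfer (qadj A) (qadj C) (qadj B) (qadj D) f x = qadj (phi (qreal x)).
  move=> ax; rewrite phiE// /transfer raddfD /= !qadjM mulmxA resolvent_adj//.
  by case/andP: ax.
have en s : admissible_signal f s ->
    0 <= energy (qadj A) (qadj C) (qadj B) (qadj D) f s s.
  move=> /allP os.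
  have s0 : all (fun a : R * 'cV[H]_n => 0 < a.1) s by apply/allP => a /os /andP[].
  have := real_kernel_psd pos s0; congr (_ <= _); rewrite /energy.
  rewrite [LHS]big_seq [RHS]big_seq; apply: eq_bigr => a aS.
  rewrite [LHS]big_seq [RHS]big_seq; apply: eq_bigr => b bS.
  have [oa ob] := (os _ aS, os _ bS).
  rewrite /coenergy !trE// caratheodory_kernel_real; last 2 first.
  - by case/andP: oa.
  - by case/andP: ob.
  by rewrite -scalemxAl ipZr mulmxDl ipDr mulrC addrC -ip_adjr.
have [Q [hQ Q0 diss]] := storage_exists f0 fA' en reach.
have Qpd := storage_pd hQ Q0 diss ctr.
have [Z QZ ZQ] := mulmx_injective_invertible (pd_injective Qpd).
have hZ := mulmx_inv_hermitian hQ QZ.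
have hNZ : hermitian (- Z) by rewrite /Defs.hermitian raddfN /= hZ.
exists (- Z); split.
  apply: ip_negative_definite => // v v0; rewrite mulNmx ipNr oppr_lt0.
  exact: pd_inverse_pd QZ Qpd _ v0.
apply/lmi_psdP => // a b.
(* At state [Z *m a] and input [- b], the dual dissipation inequality becomes the original one for
   [- Z]. *)
have := diss (Z *m a) (- b).
rewrite ip_adjr hQ mulmxA QZ mul1mx !mulmxN !ipBr ipNl -!ip_adj mulNmx ipNl !ipDr.
by rewrite !(ipC (Z *m a)) !(ipC b) mulmxN ipNl; lra.
Qed.

End Necessity.

(** * Rational slice functions *)

Section PlaneFunctions.
Variable R : realType.
Notation H := (quat R).

Definition cmul (u v : R * R) : R * R :=
  (u.1 * v.1 - u.2 * v.2, u.1 * v.2 + u.2 * v.1).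
Definition cinv (u : R * R) : R * R :=
  (u.1 / (u.1 ^+ 2 + u.2 ^+ 2), - u.2 / (u.1 ^+ 2 + u.2 ^+ 2)).

(* The real and imaginary parts of [h] satisfy the Cauchy-Riemann equations at
   [z], with complex derivative [c + i d]. *)
Definition chol (h : R * R -> R * R) (z : R * R) := exists c d : R,
  is_diff z (fst \o h) (fun w : R * R => c * w.1 - d * w.2) /\
  is_diff z (snd \o h) (fun w : R * R => d * w.1 + c * w.2).

Lemma is_diff_fst (z : R * R) : is_diff z (fst : R * R -> R) (fst : R * R -> R).
Proof.
apply: DiffDef; first by apply: linear_differentiable => w; exact: cvg_fst.
by rewrite diff_lin// => w; exact: cvg_fst.
Qed.

Lemma is_diff_snd (z : R * R) : is_diff z (snd : R * R -> R) (snd : R * R -> R).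
Proof.
apply: DiffDef; first by apply: linear_differentiable => w; exact: cvg_snd.
by rewrite diff_lin// => w; exact: cvg_snd.
Qed.

Lemma is_diff_eqf (f g df dg : R * R -> R) z : is_diff z f df -> f = g ->
  df = dg -> is_diff z g dg.
Proof. by move=> + <- <-. Qed.

Lemma chol_id z : chol id z.
Proof.
exists 1, 0; split.
  apply: (is_diff_eqf (is_diff_fst z)) => //.
  by apply/funext => w; rewrite mul1r mul0r subr0.
apply: (is_diff_eqf (is_diff_snd z)) => //.
by apply/funext => w; rewrite mul1r mul0r add0r.
Qed.

Lemma chol_cst c z : chol (fun=> c) z.
Proof.
exists 0, 0; split.
  apply: (is_diff_eqf (is_diff_cst c.1 z)) => //.
  by apply/funext => w; rewrite !mul0r subr0.
apply: (is_diff_eqf (is_diff_cst c.2 z)) => //.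
by apply/funext => w; rewrite !mul0r addr0.
Qed.

Lemma cholD g h z : chol g z -> chol h z -> chol (fun w => g w + h w) z.
Proof.
move=> [c [d [g1 g2]]] [c' [d' [h1 h2]]]; exists (c + c'), (d + d'); split.
  apply: (is_diff_eqf (is_diffD g1 h1)) => //.
  by apply/funext => w; rewrite /= !fctE; ring.
apply: (is_diff_eqf (is_diffD g2 h2)) => //.
by apply/funext => w; rewrite /= !fctE; ring.
Qed.

Lemma cholM g h z : chol g z -> chol h z -> chol (fun w => cmul (g w) (h w)) z.
Proof.
move=> [c [d [g1 g2]]] [c' [d' [h1 h2]]].
exists ((g z).1 * c' + (h z).1 * c - (g z).2 * d' - (h z).2 * d).
exists ((g z).1 * d' + (h z).1 * d + (g z).2 * c' + (h z).2 * c); split.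
  apply: (is_diff_eqf (is_diffB (is_diffM g1 h1) (is_diffM g2 h2))) => //.
  by apply/funext => w; rewrite /= !fctE /= /GRing.scale /=; ring.
apply: (is_diff_eqf (is_diffD (is_diffM g1 h2) (is_diffM g2 h1))) => //.
by apply/funext => w; rewrite /= !fctE /= /GRing.scale /=; ring.
Qed.

Lemma is_diff_inv (f df : R * R -> R) z : is_diff z f df -> f z != 0 ->
  is_diff z (fun w => (f w)^-1) (fun w => - (f z) ^- 2 * df w).
Proof.
move=> fd fz0; have di : is_diff (f z) (GRing.inv : R -> R) (fun h : R => - (f z) ^- 2 *: h).
  by apply: DiffDef; [exact: differentiable_Rinv | exact: diff_Rinv].
exact: is_diff_comp fd di.
Qed.

Lemma cholV h z : chol h z -> (h z).1 ^+ 2 + (h z).2 ^+ 2 != 0 ->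
  chol (fun w => cinv (h w)) z.
Proof.
move=> [c [d [h1 h2]]] n0.
have hn := is_diffD (is_diffM h1 h1) (is_diffM h2 h2).
have nz : ((fst \o h) * (fst \o h) + (snd \o h) * (snd \o h)) z != 0.
  by rewrite !fctE /= -!expr2.
have hv := is_diff_inv hn nz.
set a := (h z).1 in n0 *; set b := (h z).2 in n0 *.
pose c' := ((b ^+ 2 - a ^+ 2) * c - 2 * a * b * d) / (a ^+ 2 + b ^+ 2) ^+ 2.
pose d' := (2 * a * b * c + (b ^+ 2 - a ^+ 2) * d) / (a ^+ 2 + b ^+ 2) ^+ 2.
have n2 : a * a + b * b != 0 by rewrite -!expr2.
exists c', d'; split.
  apply: (is_diff_eqf (is_diffM h1 hv)) => //.
  apply/funext => w; rewrite /c' /d' !fctE /= /GRing.scale /= -/a -/b.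
  by field; rewrite ?n2 ?n0.
apply: (is_diff_eqf (is_diffM (is_diffN h2) hv)) => //.
apply/funext => w; rewrite /c' /d' !fctE /= /GRing.scale /= -/a -/b.
by field; rewrite ?n2 ?n0.
Qed.

(** The analogue of [chol] for vector values, to be applied to the four real coordinates of a matrix
    entry; products are formed beforehand, at the level of [chol]. *)
Definition vhol (V : normedModType R) (u v : R * R -> V) (z : R * R) :=
  exists c d : V, is_diff z u (fun w : R * R => w.1 *: c - w.2 *: d) /\
  is_diff z v (fun w : R * R => w.1 *: d + w.2 *: c).

Lemma is_diff_eqv (V : normedModType R) (f g df dg : R * R -> V) z :
  is_diff z f df -> f = g -> df = dg -> is_diff z g dg.
Proof. by move=> + <- <-. Qed.

Lemma is_diff_scalev (V : normedModType R) (f df : R * R -> R) (v : V) z :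
  is_diff z f df -> is_diff z (fun w => f w *: v) (fun w => df w *: v).
Proof. by move=> fd; exact: is_diff_comp fd (is_diff_scalel (f z) v). Qed.

Lemma vhol_scale (V : normedModType R) (h : R * R -> R * R) (v : V) z :
  chol h z -> vhol (fun w => (h w).1 *: v) (fun w => (h w).2 *: v) z.
Proof.
move=> [c [d [h1 h2]]]; exists (c *: v), (d *: v); split.
  apply: (is_diff_eqv (is_diff_scalev v h1)) => //.
  by apply/funext => w; rewrite scalerBl !scalerA ![w.1 * _]mulrC ![w.2 * _]mulrC.
apply: (is_diff_eqv (is_diff_scalev v h2)) => //.
by apply/funext => w; rewrite scalerDl !scalerA ![w.1 * _]mulrC ![w.2 * _]mulrC.
Qed.

Lemma vhol_sum (V : normedModType R) I (r : seq I) (u v : I -> R * R -> V) z :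
  (forall i, vhol (u i) (v i) z) ->
  vhol (fun w => \sum_(i <- r) u i w) (fun w => \sum_(i <- r) v i w) z.
Proof.
move=> h; elim: r => [|i r [c [d [h1 h2]]]].
  exists 0, 0; split.
    apply: (is_diff_eqv (is_diff_cst (0 : V) z)).
      by apply/funext => w; rewrite big_nil.
    by apply/funext => w; rewrite !scaler0 subr0.
  apply: (is_diff_eqv (is_diff_cst (0 : V) z)).
    by apply/funext => w; rewrite big_nil.
  by apply/funext => w; rewrite !scaler0 addr0.
have [c' [d' [k1 k2]]] := h i; exists (c' + c), (d' + d); split.
  apply: (is_diff_eqv (is_diffD k1 h1)).
    by apply/funext => w; rewrite big_cons.
  by apply/funext => w; rewrite fctE !scalerDr opprD addrACA.
apply: (is_diff_eqv (is_diffD k2 h2)).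
  by apply/funext => w; rewrite big_cons.
by apply/funext => w; rewrite fctE !scalerDr addrACA.
Qed.

Lemma derive1_fst (V : normedModType R) (u du : R * R -> V) (x y : R) :
  is_diff (x, y) u du -> derive1 (fun t => u (t, y)) x = du (1, 0).
Proof.
move=> hu.
have hc := is_diff_comp (is_diff_pair (is_diff_id x) (is_diff_cst y x)) hu.
by rewrite derive1E' ?(@ex_diff _ _ _ _ _ _ _ hc)// diff_val.
Qed.

Lemma derive1_snd (V : normedModType R) (u du : R * R -> V) (x y : R) :
  is_diff (x, y) u du -> derive1 (fun t => u (x, t)) y = du (0, 1).
Proof.
move=> hu.
have hc := is_diff_comp (is_diff_pair (is_diff_cst x y) (is_diff_id y)) hu.
by rewrite derive1E' ?(@ex_diff _ _ _ _ _ _ _ hc)// diff_val.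
Qed.

Lemma vhol_partial (V : normedModType R) (u v : R * R -> V) (x y : R) :
  vhol u v (x, y) -> [/\ differentiable u (x, y), differentiable v (x, y),
    derive1 (fun t => u (t, y)) x = derive1 (fun t => v (x, t)) y &
    derive1 (fun t => u (x, t)) y = - derive1 (fun t => v (t, y)) x].
Proof.
move=> [c [d [hu hv]]]; split.
- exact: (@ex_diff _ _ _ _ _ _ _ hu).
- exact: (@ex_diff _ _ _ _ _ _ _ hv).
- by rewrite (derive1_fst hu) (derive1_snd hv) /= !scale0r !scale1r subr0 add0r.
- by rewrite (derive1_snd hu) (derive1_fst hv) /= !scale0r !scale1r sub0r addr0.
Qed.

(** Embeds the complex plane, coded as [R * R], onto the slice through [I]. Computing in the plane
    first makes the components alpha and beta independent of [I]. *)
Definition cval (I : H) (u : R * R) : H := qreal u.1 + I * qreal u.2.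

Lemma cvalM I u v : I * I = -1 -> cval I (cmul u v) = cval I u * cval I v.
Proof.
by move=> I2; rewrite /cval slice_mulE// -!rmorphM /= -rmorphB -rmorphD.
Qed.

Lemma cvalD I u v : cval I (u + v) = cval I u + cval I v.
Proof. by rewrite /cval /= !rmorphD mulrDr addrACA. Qed.

Lemma cval0 I : cval I 0 = 0.
Proof. by rewrite /cval /= rmorph0 mulr0 addr0. Qed.

Lemma sumsq_neq0 I u : cval I u != 0 -> u.1 ^+ 2 + u.2 ^+ 2 != 0.
Proof.
apply: contra_neq => /eqP; rewrite paddr_eq0 ?sqr_ge0// !sqrf_eq0.
by move=> /andP[/eqP u1 /eqP u2]; rewrite /cval u1 u2 rmorph0 mulr0 addr0.
Qed.

Lemma cvalV I u : I * I = -1 -> cval I u != 0 -> cval I (cinv u) = (cval I u)^-1.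
Proof.
move=> I2 u0; have n0 := sumsq_neq0 u0.
apply: (mulrI (x := cval I u)); rewrite // divrr// -cvalM//.
have -> : cmul u (cinv u) = (1, 0).
  by rewrite /cmul /cinv /=; congr (_, _); field.
by rewrite /cval /= rmorph0 mulr0 addr0 rmorph1.
Qed.

Fixpoint cpow k (z : R * R) : R * R :=
  if k is k'.+1 then cmul z (cpow k' z) else (1, 0).

Definition cpoly (F : {poly R}) (z : R * R) : R * R :=
  \sum_(k < size F) cmul (F`_k, 0) (cpow k z).

(** The complex function z^k / F(z). *)
Definition cterm F k z := cmul (cpow k z) (cinv (cpoly F z)).

Lemma cval_pow I k x y : I * I = -1 -> cval I (cpow k (x, y)) = slice_point x y I ^+ k.
Proof.
move=> I2; elim: k => [|k IH]; first by rewrite /cval /= rmorph0 mulr0 addr0 rmorph1.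
by rewrite /= cvalM// IH exprS.
Qed.

Lemma cval_poly I F x y : I * I = -1 ->
  cval I (cpoly F (x, y)) = (map_poly (@qreal R) F).[slice_point x y I].
Proof.
move=> I2; rewrite (qpoly_evalE _ (leqnn _)) /cpoly.
rewrite (big_morph (cval I) (cvalD I) (cval0 I)); apply: eq_bigr => k _.
by rewrite cvalM// cval_pow// {1}/cval /= rmorph0 mulr0 addr0 qrealC.
Qed.

Lemma cval_term I F k x y : I * I = -1 ->
  (map_poly (@qreal R) F).[slice_point x y I] != 0 ->
  cval I (cterm F k (x, y)) =
  slice_point x y I ^+ k * ((map_poly (@qreal R) F).[slice_point x y I])^-1.
Proof. by move=> I2 F0; rewrite /cterm cvalM// cvalV ?cval_poly// cval_pow. Qed.

Definition cconj (u : R * R) : R * R := (u.1, - u.2).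

Lemma cconjM u v : cconj (cmul u v) = cmul (cconj u) (cconj v).
Proof. by rewrite /cconj /cmul /=; congr (_, _); ring. Qed.
Lemma cconjD u v : cconj (u + v) = cconj u + cconj v.
Proof. by rewrite /cconj /= opprD. Qed.
Lemma cconjV u : cconj (cinv u) = cinv (cconj u).
Proof. by rewrite /cconj /cinv /= sqrrN !mulNr. Qed.
Lemma cpow_conj k z : cpow k (cconj z) = cconj (cpow k z).
Proof.
elim: k => [|k IH] /=; first by rewrite /cconj /= oppr0.
by rewrite IH cconjM.
Qed.
Lemma cpoly_conj F z : cpoly F (cconj z) = cconj (cpoly F z).
Proof.
have c0 : cconj 0 = 0 by rewrite /cconj /= oppr0.
rewrite /cpoly (big_morph cconj cconjD c0); apply: eq_bigr => k _.
by rewrite cpow_conj cconjM /cconj /= oppr0.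
Qed.
Lemma cterm_conj F k z : cterm F k (cconj z) = cconj (cterm F k z).
Proof. by rewrite /cterm cpow_conj cpoly_conj -cconjV -cconjM. Qed.

Lemma chol_sum I (r : seq I) (h : I -> R * R -> R * R) z :
  (forall i, chol (h i) z) -> chol (fun w => \sum_(i <- r) h i w) z.
Proof.
move=> hh; elim: r => [|i r IH].
  by under eq_fun do rewrite big_nil; exact: chol_cst.
by under eq_fun do rewrite big_cons; exact: cholD.
Qed.

Lemma chol_pow k z : chol (cpow k) z.
Proof.
elim: k => [|k IH]; first exact: chol_cst.
by apply: cholM => //; exact: chol_id.
Qed.

Lemma chol_poly F z : chol (cpoly F) z.
Proof.
apply: chol_sum => k; apply: cholM; first exact: chol_cst.
exact: chol_pow.
Qed.

Lemma chol_term F k z : (cpoly F z).1 ^+ 2 + (cpoly F z).2 ^+ 2 != 0 ->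
  chol (cterm F k) z.
Proof.
by move=> n0; apply: cholM; [exact: chol_pow | apply: cholV => //; exact: chol_poly].
Qed.

End PlaneFunctions.

(** * Locality of the Cauchy-Riemann equations *)

Section Gluing.
Variable R : realType.
Notation H := (quat R).

Lemma is_diff_near (V W : normedModType R) (f g df : V -> W) (z : V) :
  (\forall w \near z, f w = g w) -> is_diff z f df -> is_diff z g df.
Proof.
move=> fg fd; have fdiff : differentiable f z .
  exact: (@ex_diff _ _ _ _ _ _ _ fd).
have cf := diff_continuous fdiff.
have fgz : f z = g z by exact: nbhs_singleton fg.
have eqg : g \o shift z = cst (g z) + 'd f z +o_ (0 : V) id.
  apply/eqaddoP => e e0.
  have := diff_locally fdiff; move/eqaddoP => /(_ e e0) fe.
  have fg0 : \forall w \near (0 : V), f (w + z) = g (w + z).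
    have : (fun w : V => w + z) @ (0 : V) --> z.
      by rewrite -[X in _ --> X]add0r; apply: cvgD; [exact: cvg_id|exact: cvg_cst].
    by move=> /(_ _ fg).
  by move: fe fg0; apply: filterS2 => w; rewrite !fctE /= -fgz => + <-.
have dg : 'd g z = 'd f z :> (V -> W) by apply: diff_unique.
have gdiff : differentiable g z.
  by apply/diff_locallyP; rewrite dg.
by apply: DiffDef => //; rewrite dg diff_val.
Qed.

Lemma vhol_near (V : normedModType R) (u v u' v' : R * R -> V) z :
  (\forall w \near z, u w = u' w) -> (\forall w \near z, v w = v' w) ->
  vhol u v z -> vhol u' v' z.
Proof.
move=> uu vv [c [d [hu hv]]]; exists c, d.
by split; [exact: is_diff_near hu | exact: is_diff_near hv].
Qed.

Lemma vhol_of_partial (V : normedModType R) (u v : R * R -> V) (x y : R) :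
  differentiable u (x, y) -> differentiable v (x, y) ->
  derive1 (fun t => u (t, y)) x = derive1 (fun t => v (x, t)) y ->
  derive1 (fun t => u (x, t)) y = - derive1 (fun t => v (t, y)) x ->
  vhol u v (x, y).
Proof.
move=> /differentiableP du /differentiableP dv.
rewrite (derive1_fst du) (derive1_snd dv) (derive1_snd du) (derive1_fst dv).
move=> e1 e2.
have dE (f : {linear (R * R)%type -> V}) (w : R * R) :
    f w = w.1 *: f (1, 0) + w.2 *: f (0, 1).
  rewrite -!linearZ -linearD; congr (f _); case: w => a b.
  by congr (_, _); rewrite /= /GRing.scale /= !(mulr0, mulr1, addr0, add0r).
exists ('d u (x, y) (1, 0)), ('d v (x, y) (1, 0)); split.
  apply: (is_diff_eqv du) => //; apply/funext => w.
  by rewrite (dE ('d u (x, y)) w) e2 scalerN.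
apply: (is_diff_eqv dv) => //; apply/funext => w.
by rewrite (dE ('d v (x, y)) w) -e1.
Qed.

Lemma slice_point_near (Om : set H) x y (I : H) : qopen Om ->
  Om (slice_point x y I) -> \forall z \near (x, y), Om (slice_point z.1 z.2 I).
Proof.
move=> oO Oxy.
have c : (fun z : R * R => qvec (slice_point z.1 z.2 I)) @ (x, y) -->
    qvec (slice_point x y I).
  have e a b : qvec (slice_point a b I) = a *: qvec 1 + b *: qvec I.
    by rewrite /slice_point -qrealC raddfD /= -[qreal a]mulr1 !qvecZ.
  under eq_fun do rewrite e; rewrite e.
  by apply: cvgD; apply: cvgZ; (exact: cvg_cst || exact: cvg_fst || exact: cvg_snd).
have nO : nbhs (qvec (slice_point x y I)) (@qvec R @` Om).
  by apply: open_nbhs_nbhs; split => //; exists (slice_point x y I).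
have h : \forall z \near (x, y), (@qvec R @` Om) (qvec (slice_point z.1 z.2 I)).
  exact: (c _ nO).
by apply: filterS h => z [p Op /qvec_inj <-].
Qed.

End Gluing.

(** * Slice extension by a rational function with real denominator *)

Section SliceRational.
Variable R : realType.
Notation H := (quat R).

Definition mx_vhol m n (alpha beta : R -> R -> 'M[H]_(m, n)) (x y : R) :=
  forall i j, vhol (fun z : R * R => qvec (alpha z.1 z.2 i j))
    (fun z : R * R => qvec (beta z.1 z.2 i j)) (x, y).

Lemma mx_vholP m n (alpha beta : R -> R -> 'M[H]_(m, n)) x y :
  mx_vhol alpha beta x y <->
  [/\ mx_differentiable alpha x y, mx_differentiable beta x y,
      forall i j, partial_x alpha x y i j = partial_y beta x y i j &
      forall i j, partial_y alpha x y i j = - partial_x beta x y i j].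
Proof.
split=> [h|[h1 h2 h3 h4] i j].
  by split => i j; have [] := vhol_partial (h i j).
exact: (vhol_of_partial (h1 i j) (h2 i j) (h3 i j) (h4 i j)).
Qed.

Lemma slice_pair_uniq m n (I : H) (a b a' b' : 'M[H]_(m, n)) : I * I = -1 ->
  a + I *: b = a' + I *: b' -> a - I *: b = a' - I *: b' -> a = a' /\ b = b'.
Proof.
move=> I2 h1 h2.
have hb (u v : 'M[H]_(m, n)) : u + u = v + v -> u = v.
  move=> e; have : qreal 2 *: u = qreal 2 *: v.
    by rewrite rmorphD rmorph1 !scalerDl !scale1r.
  move=> /(congr1 ( *:%R (qreal 2^-1))); rewrite !scalerA -rmorphM /= mulVf ?pnatr_eq0//.
  by rewrite rmorph1 !scale1r.
have aa : a = a'.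
  apply: hb; have := congr2 +%R h1 h2.
  by rewrite addrACA subrr addr0 [in RHS]addrACA subrr addr0.
split => //; move: h1; rewrite aa => /addrI /(congr1 ( *:%R I)).
by rewrite !scalerA I2 !scaleN1r => /oppr_inj.
Qed.

Section Rational.
Variables (m n : nat) (F : {poly R}) (K : nat) (M : nat -> 'M[H]_(m, n)).
Local Notation ev p := ((map_poly (@qreal R) F).[p]).

Definition ratf (p : H) : 'M[H]_(m, n) :=
  (ev p)^-1 *: \sum_(k < K) p ^+ k *: M k.
Definition rat_alpha x y := \sum_(k < K) qreal (cterm F k (x, y)).1 *: M k.
Definition rat_beta x y := \sum_(k < K) qreal (cterm F k (x, y)).2 *: M k.

Lemma ratf_slice x y (I : H) : imag_sphere I -> ev (slice_point x y I) != 0 ->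
  ratf (slice_point x y I) = rat_alpha x y + I *: rat_beta x y.
Proof.
move=> /imag_sphere_sqr I2 F0.
rewrite /ratf /rat_alpha /rat_beta !scaler_sumr -big_split; apply: eq_bigr => k _.
rewrite /= !scalerA -scalerDl; congr (_ *: _).
rewrite -/(cval I (cterm F k (x, y))) cval_term//.
set p := slice_point x y I in F0 *; have c : GRing.comm (p ^+ k) (ev p).
  by apply: commr_sym; apply: commrX; apply: qpoly_comm.
by have := commrV c.
Qed.

Lemma rat_alphaN x y : rat_alpha x (- y) = rat_alpha x y.
Proof.
by apply: eq_bigr => k _; rewrite -[(x, - y)]/(cconj (x, y)) cterm_conj.
Qed.

Lemma rat_betaN x y : rat_beta x (- y) = - rat_beta x y.
Proof.
rewrite /rat_beta -sumrN; apply: eq_bigr => k _.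
by rewrite -[(x, - y)]/(cconj (x, y)) cterm_conj rmorphN scaleNr.
Qed.

Lemma rat_vhol x y (I : H) : imag_sphere I -> ev (slice_point x y I) != 0 ->
  mx_vhol rat_alpha rat_beta x y.
Proof.
move=> /imag_sphere_sqr I2 F0 i j.
have n0 : (cpoly F (x, y)).1 ^+ 2 + (cpoly F (x, y)).2 ^+ 2 != 0.
  by apply: (@sumsq_neq0 _ I); rewrite cval_poly.
have hs := @vhol_sum R 'rV[R]_4 'I_K (index_enum 'I_K)
  (fun k z => (cterm F k z).1 *: qvec (M k i j))
  (fun k z => (cterm F k z).2 *: qvec (M k i j)) (x, y)
  (fun k => vhol_scale (qvec (M k i j)) (chol_term k n0)).
have e (c : 'I_K -> R) : qvec ((\sum_(k < K) qreal (c k) *: M k) i j) =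
    \sum_(k < K) c k *: qvec (M k i j).
  by rewrite summxE raddf_sum; apply: eq_bigr => k _ /=; rewrite mxE qvecZ.
have [c [d [h1 h2]]] := hs; exists c, d; split.
  by apply: (is_diff_eqv h1) => //; apply/funext => -[a b]; rewrite e.
by apply: (is_diff_eqv h2) => //; apply/funext => -[a b]; rewrite e.
Qed.

End Rational.

Lemma half_space_slice x y (I : H) : imag_sphere I ->
  half_space (slice_point x y I) <-> 0 < x.
Proof.
move=> [I0 _]; rewrite /half_space /slice_point /= -[I * _]qrealC qreMl I0.
by rewrite mulr0 addr0.
Qed.

Lemma half_space_symmetric : axially_symmetric (@half_space R).
Proof.
by move=> x y I J SI SJ /(half_space_slice _ _ SI) x0; apply/half_space_slice.
Qed.

Lemma half_space_open : qopen (@half_space R).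
Proof.
rewrite /qopen.
have -> : @qvec R @` half_space = (fun v : 'rV[R]_4 => v 0 0) @^-1` [set t | 0 < t].
  rewrite eqEsubset; split => [_ [p p0 <-]|v v0] /=; first by rewrite mxE.
  exists (Quat (v 0 (inord 0)) (v 0 (inord 1)) (v 0 (inord 2)) (v 0 (inord 3))) => //=.
    by rewrite /half_space /= (_ : inord 0 = 0)//; apply/val_inj; rewrite /= inordK.
  apply/rowP => k; rewrite mxE; case: k => -[|[|[|[|k]]]] //= kk; congr (v 0 _);
    by apply/val_inj; rewrite /= inordK.
apply: open_comp; last exact: open_gt.
by move=> v _; exact: coord_continuous.
Qed.

Lemma slice_glue m n (Omega U : set H) (f : H -> 'M[H]_(m, n)) F K M :
  slice_hyperholomorphic Omega f -> qopen U -> axially_symmetric U ->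
  (forall p, U p -> (map_poly (@qreal R) F).[p] != 0) ->
  (forall p, Omega p -> U p -> f p = ratf F K M p) ->
  slice_hyperholomorphic (Omega `|` U)
    (fun p => if `[< Omega p >] then f p else ratf F K M p).
Proof.
move=> [oO sO [al [be [comp hol]]]] oU sU FU agree.
split.
- by rewrite /qopen image_setU; exact: openU.
- move=> x y I J SI SJ [OI|UI]; [left; exact: sO OI|right; exact: sU UI].
have i0S : imag_sphere (Quat 0 1 0 0 : H).
  by split => //; rewrite /qnorm /qnormsq /= expr0n expr1n /= !addr0 add0r sqrtr1.
set i0 : H := Quat 0 1 0 0 in i0S.
(* By axial symmetry, membership in [Omega] can be tested on one fixed slice, so the choice between
   the two pairs of components does not depend on [I]. *)
pose inO x y := `[< Omega (slice_point x y i0) >].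
have inOE x y I : imag_sphere I -> `[< Omega (slice_point x y I) >] = inO x y.
  move=> SI; apply/asboolP/asboolP; exact: sO.
have inON x y : inO x (- y) = inO x y.
  rewrite -(inOE x y (- i0)) ?slice_pointNN//; last exact: imag_sphereN.
  by rewrite -[slice_point x y _]slice_pointNN opprK.
exists (fun x y => if inO x y then al x y else rat_alpha F K M x y).
exists (fun x y => if inO x y then be x y else rat_beta F K M x y).
split.
  move=> x y I SI OU; rewrite inOE// inON.
  case: ifPn => [|nO].
    by rewrite -(inOE x y I)// => /asboolP /(comp x y I SI).
  rewrite rat_alphaN rat_betaN; split => //; apply: ratf_slice => //.
  by case: OU => [OI|/FU//]; move: nO; rewrite -(inOE x y I)// => /asboolP.
move=> x y I SI OU; apply/mx_vholP => i j.
have [Oxy|nO] := pselect (Omega (slice_point x y I)).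
  have nr := slice_point_near oO Oxy.
  have /mx_vholP/(_ i j) := hol x y I SI Oxy; apply: vhol_near;
    by apply: filterS nr => z /= Oz; rewrite -(inOE z.1 z.2 I)// asboolT.
have {OU}UI : U (slice_point x y I) by case: OU.
have nr := slice_point_near oU UI.
have := rat_vhol K M SI (FU _ UI) i j.
(* A point of [U] outside [Omega] may have neighbours in [Omega], where the glued components are
   those of [f]. Agreement at [I] and at [- I] identifies them with the rational ones. *)
have key z : U (slice_point z.1 z.2 I) -> inO z.1 z.2 ->
    rat_alpha F K M z.1 z.2 = al z.1 z.2 /\ rat_beta F K M z.1 z.2 = be z.1 z.2.
  move=> Uz; rewrite -(inOE z.1 z.2 I)// => /asboolP Oz.
  have SN := imag_sphereN SI.
  have ON := sO _ _ _ _ SI SN Oz; have UN := sU _ _ _ _ SI SN Uz.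
  have [c1 _ _] := comp _ _ _ SI Oz; have [c2 _ _] := comp _ _ _ SN ON.
  apply: (slice_pair_uniq (imag_sphere_sqr SI)).
    by rewrite -c1 agree// ratf_slice//; exact: FU.
  rewrite -!scaleNr -c2 agree// ratf_slice//; exact: FU.
apply: vhol_near; apply: filterS nr => z /= Uz; case: ifPn => //;
  by move=> /(key z Uz)[e1 e2]; rewrite ?e1 ?e2.
Qed.

End SliceRational.

(** * Comparison with the realization *)

Section Agreement.
Variable R : realType.
Notation H := (quat R).
Local Notation ev f p := ((map_poly (@qreal R) f).[p]).

Lemma cval_neq0 (I : H) u : I * I = -1 -> u.1 ^+ 2 + u.2 ^+ 2 != 0 ->
  cval I u != 0.
Proof.
move=> I2 n0; have : cval I u * cval I (cinv u) = 1.
  rewrite -cvalM// (_ : cmul u (cinv u) = (1, 0)).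
    by rewrite /cval /= rmorph0 mulr0 addr0 rmorph1.
  by rewrite /cmul /cinv /=; congr (_, _); field.
by move=> e; apply/eqP => u0; move: e; rewrite u0 mul0r => /esym/eqP; rewrite oner_eq0.
Qed.

Lemma qpoly_evalM (f g : {poly R}) (p : H) : ev (f * g) p = ev f p * ev g p.
Proof.
by rewrite rmorphM hornerM_comm//; apply/esym; apply: qpoly_comm.
Qed.

Lemma qsum_decomp K (c : nat -> H) : exists P0 P1 P2 P3 : {poly R}, forall p : H,
  \sum_(k < K) p ^+ k * c k = ev P0 p + ev P1 p * Quat 0 1 0 0 +
    ev P2 p * Quat 0 0 1 0 + ev P3 p * Quat 0 0 0 1.
Proof.
exists (\poly_(k < K) qre (c k)), (\poly_(k < K) qi (c k)),
  (\poly_(k < K) qj (c k)), (\poly_(k < K) qk (c k)) => p.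
rewrite !(@qpoly_evalE _ _ K) ?size_poly// !mulr_suml -!big_split.
apply: eq_bigr => k _; rewrite !coef_poly ltn_ord /= -!mulrA -!mulrDr.
by congr (_ * _); case: (c k) => a b e d; congr Quat; rewrite /=; ring.
Qed.

(** Componentwise, the identity on a real ray is one between real polynomials; these are then equal,
    and evaluation of real polynomials at any quaternion is multiplicative. *)
Lemma power_sum_identity (f d : {poly R}) K L (c c' : nat -> H) (r : R) :
  (forall x, r < x -> qreal f.[x] * \sum_(k < K) qreal x ^+ k * c k =
                      qreal d.[x] * \sum_(k < L) qreal x ^+ k * c' k) ->
  forall p, ev f p * \sum_(k < K) p ^+ k * c k =
            ev d p * \sum_(k < L) p ^+ k * c' k.
Proof.
have [P0 [P1 [P2 [P3 PE]]]] := qsum_decomp K c.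
have [S0 [S1 [S2 [S3 SE]]]] := qsum_decomp L c'.
move=> h p.
have vanish (g : {poly R}) : (forall x, r < x -> g.[x] = 0) -> g = 0.
  move=> g0; apply/eqP; apply: contraT => gn0.
  have ginj : injective (fun k : nat => r + k.+1%:R).
    by move=> a b /addrI/eqP; rewrite eqr_nat => /eqP[].
  have [l [_ + lP]] := poly_nonroots 1 gn0 ginj; case: l lP => // x l lP _.
  have [|gx [k xk]] := lP x; first by rewrite mem_head.
  by move: gx; rewrite g0 ?eqxx// xk ltrDl ltr0Sn.
have comps x : r < x -> [/\ f.[x] * P0.[x] = d.[x] * S0.[x],
    f.[x] * P1.[x] = d.[x] * S1.[x], f.[x] * P2.[x] = d.[x] * S2.[x] &
    f.[x] * P3.[x] = d.[x] * S3.[x]].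
  move=> /h; rewrite PE SE !qpoly_eval_real => -[] /=.
  by move=> e1 e2 e3 e4; split; lra.
have e0 : f * P0 = d * S0.
  apply/eqP; rewrite -subr_eq0; apply/eqP/vanish => x /comps[e _ _ _].
  by rewrite hornerD hornerN !hornerM e subrr.
have e1 : f * P1 = d * S1.
  apply/eqP; rewrite -subr_eq0; apply/eqP/vanish => x /comps[_ e _ _].
  by rewrite hornerD hornerN !hornerM e subrr.
have e2 : f * P2 = d * S2.
  apply/eqP; rewrite -subr_eq0; apply/eqP/vanish => x /comps[_ _ e _].
  by rewrite hornerD hornerN !hornerM e subrr.
have e3 : f * P3 = d * S3.
  apply/eqP; rewrite -subr_eq0; apply/eqP/vanish => x /comps[_ _ _ e].
  by rewrite hornerD hornerN !hornerM e subrr.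
by rewrite PE SE !mulrDr !mulrA -!qpoly_evalM e0 e1 e2 e3.
Qed.

Lemma power_mxsum_identity m n (f d : {poly R}) K L (c c' : nat -> 'M[H]_(m, n)) r :
  (forall x, r < x -> qreal f.[x] *: \sum_(k < K) qreal x ^+ k *: c k =
                      qreal d.[x] *: \sum_(k < L) qreal x ^+ k *: c' k) ->
  forall p, ev f p *: \sum_(k < K) p ^+ k *: c k =
            ev d p *: \sum_(k < L) p ^+ k *: c' k.
Proof.
move=> h p; apply/matrixP => i j.
have entry s S (a : nat -> 'M[H]_(m, n)) (q : H) :
    (s *: \sum_(k < S) q ^+ k *: a k) i j = s * \sum_(k < S) q ^+ k * a k i j.
  by rewrite mxE summxE; congr (_ * _); apply: eq_bigr => k _; rewrite mxE.
rewrite !entry; apply: (@power_sum_identity f d K L (fun k => c k i j) (fun k => c' k i j) r).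
by move=> x rx; rewrite -!entry h.
Qed.

Section Rational.
Variables (m n : nat) (Omega : set H) (phi : H -> 'M[H]_(m, n)).
Variables (d : {poly R}) (l : nat) (P : nat -> 'M[H]_(m, n)).
Variables (F : {poly R}) (K : nat) (M : nat -> 'M[H]_(m, n)) (r : R).
Hypothesis slice_phi : slice_hyperholomorphic Omega phi.
Hypotheses (d0 : d != 0) (F0 : F != 0).
Hypothesis dom : forall p, ev d p != 0 -> Omega p.
Hypothesis phiE : forall p, Omega p -> ev d p *: phi p = \sum_(k < l) p ^+ k *: P k.
Hypothesis real_agree : forall x, r < x -> Omega (qreal x) /\
  qreal F.[x] *: phi (qreal x) = \sum_(k < K) qreal x ^+ k *: M k.

Lemma rational_identity p :
  ev F p *: \sum_(k < l) p ^+ k *: P k = ev d p *: \sum_(k < K) p ^+ k *: M k.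
Proof.
apply: (@power_mxsum_identity _ _ _ _ _ _ _ _ r) => x /real_agree[Ox e].
by rewrite -phiE// -e qpoly_eval_real !scalerA qrealC.
Qed.

Lemma agree_off_roots p : Omega p -> ev d p != 0 -> ev F p != 0 ->
  phi p = ratf F K M p.
Proof.
move=> Op dp Fp; rewrite /ratf.
have := rational_identity p; rewrite -phiE// scalerA.
have -> : ev F p * ev d p = ev d p * ev F p by rewrite -!qpoly_evalM mulrC.
rewrite -scalerA => /(congr1 ( *:%R (ev d p)^-1)).
rewrite ![(ev d p)^-1 *: _]scalerA !mulVr// !scale1r => <-.
by rewrite scalerA mulVr// scale1r.
Qed.

(* At the zeros of [d] lying in the domain, continuity along the real direction. *)
Lemma agree_on_domain p : Omega p -> ev F p != 0 -> phi p = ratf F K M p.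
Proof.
move=> Op Fp; have [dp|] := eqVneq (ev d p) 0; last first.
  by move=> dp; exact: agree_off_roots.
have [oO sO [al [be [comp hol]]]] := slice_phi.
have [y [SI pE]] := slice_unit_decomp p.
set I := slice_unit p in SI pE; set x := qre p in pE.
have I2 := imag_sphere_sqr SI; have SN := imag_sphereN SI.
have Oxy : Omega (slice_point x y I) by rewrite -pE.
have Fxy : ev F (slice_point x y I) != 0 by rewrite -pE.
have [c _ _] := comp _ _ _ SI Oxy.
rewrite pE c ratf_slice//.
have /mx_vholP hol1 := hol _ _ _ SI Oxy.
have hol2 := rat_vhol K M SI Fxy.
have near_pt e : 0 < e -> exists2 t, x < t < x + e &
    al t y = rat_alpha F K M t y /\ be t y = rat_beta F K M t y.
  move=> e0.
  (* Starting at [k.+2] keeps every candidate strictly between x and x + e. All the points lie in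
     one slice, hence commute, and finitely many are roots of F d. *)
  pose g k := x + e / k.+2%:R.
  pose s := [seq slice_point (g k) y I | k <- iota 0 (size (F * d))].
  have us : uniq s.
    rewrite map_inj_in_uniq ?iota_uniq// => a b _ _.
    rewrite /slice_point => /addIr [] /addrI /(mulfI (lt0r_neq0 e0))/invr_inj/eqP.
    by rewrite eqr_nat => /eqP[].
  have cs a b : a \in s -> b \in s -> a * b = b * a.
    move=> /mapP[k _ ->] /mapP[k' _ ->].
    have e' t : slice_point t y I = cval I (t, y) by [].
    by rewrite !e' -!cvalM//; congr cval; rewrite /cmul /=; congr (_, _); ring.
  have [||_ /mapP[k _ ->]] := qpoly_eval_neq0 (_ : F * d != 0) us cs.
  - by rewrite mulf_neq0.
  - by rewrite size_map size_iota.
  rewrite qpoly_evalM => Fd.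
  have Fk : ev F (slice_point (g k) y I) != 0.
    by apply: contra_neq Fd => ->; rewrite mul0r.
  have dk : ev d (slice_point (g k) y I) != 0.
    by apply: contra_neq Fd => ->; rewrite mulr0.
  exists (g k).
    rewrite /g ltrDl divr_gt0//= ltrD2l ltr_pdivrMr// ltr_pMr// ltr1n//.
  have Ok := dom dk; have ON := sO _ _ _ _ SI SN Ok.
  have evN (f : {poly R}) z : ev f (slice_point z y I) != 0 -> ev f (slice_point z y (- I)) != 0.
    rewrite -(cval_poly f z y I2) -(cval_poly f z y (imag_sphere_sqr SN)).
    by move=> /sumsq_neq0; apply: cval_neq0; exact: imag_sphere_sqr.
  have [c1 _ _] := comp _ _ _ SI Ok; have [c2 _ _] := comp _ _ _ SN ON.
  apply: (slice_pair_uniq I2).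
    by rewrite -c1 agree_off_roots// ratf_slice.
  rewrite -!scaleNr -c2 agree_off_roots ?ratf_slice//; exact: evN.
have lim (u v : R -> R -> 'M[H]_(m, n)) :
    (forall i j, differentiable (fun z : R * R => qvec (u z.1 z.2 i j)) (x, y)) ->
    (forall i j, differentiable (fun z : R * R => qvec (v z.1 z.2 i j)) (x, y)) ->
    (forall e, 0 < e -> exists2 t, x < t < x + e & u t y = v t y) ->
    u x y = v x y.
  move=> du dv uv; apply/matrixP => i j; apply: qvec_inj; apply/eqP.
  rewrite -subr_eq0; apply: contraT => w0.
  have pc : (fun t : R => (t, y)) @ x --> (x, y).
    apply: differentiable_continuous.
    exact: (@ex_diff _ _ _ _ _ _ _ (is_diff_pair (is_diff_id x) (is_diff_cst y x))).
  have cu : (fun t => qvec (u t y i j)) @ x --> qvec (u x y i j).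
    exact: (cvg_comp _ _ pc (differentiable_continuous (du i j))).
  have cv : (fun t => qvec (v t y i j)) @ x --> qvec (v x y i j).
    exact: (cvg_comp _ _ pc (differentiable_continuous (dv i j))).
  have nz : \forall t \near x, qvec (u t y i j) - qvec (v t y i j) != 0.
    exact: (cvgr_neq0 _ (cvgB cu cv) w0).
  have [e /= e0 be0] := (nbhs_ballP _ _).1 nz.
  have [t /andP[xt te] uvt] := uv e e0.
  have : qvec (u t y i j) - qvec (v t y i j) != 0.
    by apply: be0; rewrite /ball /= distrC ltr_norml; apply/andP; split; lra.
  by rewrite uvt subrr eqxx.
congr (_ + _ *: _).
- apply: lim => [i j|i j|e /near_pt[t tx [? ?]]]; last by exists t.
  + by have [] := vhol_partial (hol1 i j).
  + by have [] := vhol_partial (hol2 i j).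
- apply: lim => [i j|i j|e /near_pt[t tx [? ?]]]; last by exists t.
  + by have [] := vhol_partial (hol1 i j).
  + by have [] := vhol_partial (hol2 i j).
Qed.

End Rational.
End Agreement.

(** * Sufficiency *)

Section Sufficiency.
Variable R : realType.
Notation H := (quat R).
Local Notation ev f p := ((map_poly (@qreal R) f).[p]).

Lemma ip_scale_half n (v : 'cV[H]_n) p : ip v (p *: v) = qre p * ip v v.
Proof.
rewrite !ipE mulr_sumr; apply: eq_bigr => i _; rewrite mxE qreM_C -mulrA.
by rewrite mul_qconj qconj_mul -qrealC !qreMl mulrC.
Qed.

(** * Lyapunov's argument for a kernel on finitely many points *)

Section LyapunovFamily.
Variables (M n : nat) (T : 'I_M -> 'I_M -> 'M[H]_n) (p : 'I_M -> H).
Hypothesis p_gt0 : forall k, 0 < qre (p k).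
Hypothesis T_herm : forall k j, T k j = qadj (T j k).
Hypothesis lyap : forall v : 'I_M -> 'cV[H]_n,
  0 <= \sum_k \sum_j
    ip (v k) ((p k *: T k j + T k j *m (qconj (p j))%:M) *m v j).

Let I := ('I_M * 'I_n)%type.
(** The family is flattened into one matrix so that the eigenvalue criterion for Hermitian matrices
    applies. *)
Let big_mx : 'M[H]_#|{: I}| := \matrix_(a, b)
  T (enum_val a).1 (enum_val b).1 (enum_val a).2 (enum_val b).2.
Let split_col (w : 'cV[H]_#|{: I}|) k : 'cV[H]_n := \col_a w (enum_rank (k, a)) 0.

Lemma big_mx_mul w k : split_col (big_mx *m w) k = \sum_j T k j *m split_col w j.
Proof.
apply/colP => a; rewrite mxE mxE summxE.
under [RHS]eq_bigr do rewrite mxE.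
rewrite pair_bigA /= (reindex (fun a : 'I_#|{: I}| => enum_val a)) /=;
  last exact: onW_bij (enum_val_bij _).
by apply: eq_bigr => b _; rewrite !mxE enum_rankK -surjective_pairing enum_valK.
Qed.

Lemma ip_split_col w w' : ip w w' = \sum_k ip (split_col w k) (split_col w' k).
Proof.
under [RHS]eq_bigr do rewrite ipE.
rewrite ipE pair_bigA /= [RHS](reindex (fun a : 'I_#|{: I}| => enum_val a)) /=;
  last exact: onW_bij (enum_val_bij _).
by apply: eq_bigr => b _; rewrite !mxE -surjective_pairing enum_valK.
Qed.

(** For an eigenvector with components w_k and eigenvalue x < 0, the form in [lyap] equals 2 x sum_k
    Re(p_k) |w_k|^2, which is negative. *)
Lemma lyapunov_family v : 0 <= \sum_k \sum_j ip (v k) (T k j *m v j).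
Proof.
have hX : hermitian big_mx.
  by apply/matrixP => a b; rewrite qadjE !mxE T_herm qadjE qconjK.
have psd : forall w, 0 <= ip w (big_mx *m w).
  apply: psd_of_no_negative_eigenvalue => // x x0 [w w0 wx].
  rewrite mulmx_scalar_real in wx.
  have ev1 k : \sum_j T k j *m split_col w j = qreal x *: split_col w k.
    by rewrite -big_mx_mul wx; apply/colP => a; rewrite !mxE.
  have := lyap (split_col w).
  have -> : \sum_k \sum_j ip (split_col w k) ((p k *: T k j +
        T k j *m (qconj (p j))%:M) *m split_col w j) =
      \sum_k 2 * x * (qre (p k) * ip (split_col w k) (split_col w k)).
    transitivity (\sum_k \sum_j ip (split_col w k) (p k *: (T k j *m split_col w j))
      + \sum_k \sum_j ip (split_col w k) (T k j *m (qconj (p j) *: split_col w j))).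
      rewrite -big_split; apply: eq_bigr => k _; rewrite -big_split; apply: eq_bigr => j _.
      by rewrite mulmxDl ipDr scalemxAl -mulmxA mul_scalar_mx.
    rewrite [X in _ + X]exchange_big -big_split; apply: eq_bigr => k _ /=.
    rewrite -ip_sumr -scaler_sumr ev1 scalerA -qrealC -scalerA ipZr ip_scale_half.
    under eq_bigr do rewrite ip_adjr -T_herm.
    rewrite -ip_suml ev1 ipZl ip_scale_half; ring.
  rewrite -mulr_sumr nmulr_rge0; last by rewrite nmulr_llt0.
  move=> h; have : 0 < ip w w by exact: ip_gt0.
  rewrite ip_split_col ltNge => /negP; apply.
  apply: sumr_le0 => k _; rewrite leNgt; apply/negP => vk.
  move: h; rewrite leNgt (bigD1 k)//= ltr_pwDl ?mulr_gt0//.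
  by apply: sumr_ge0 => j _; rewrite mulr_ge0 ?ip_ge0// ltW.
pose w : 'cV[H]_#|{: I}| := \col_a v (enum_val a).1 (enum_val a).2 0.
have wE k : split_col w k = v k by apply/colP => a; rewrite !mxE enum_rankK.
have := psd w; rewrite ip_split_col; congr (_ <= _); apply: eq_bigr => k _.
rewrite big_mx_mul wE ip_sumr; apply: eq_bigr => j _; by rewrite wE.
Qed.

End LyapunovFamily.

(** * Roots of the minimal annihilating polynomial *)

Section HalfPlaneRoots.
Variables (N : nat) (A P : 'M[H]_N).
Hypothesis hP : hermitian P.
Hypothesis P_pd : forall v, v != 0 -> 0 < ip v (P *m v).
Hypothesis dissA : forall v, ip (P *m v) (A *m v) <= 0.

(* With [w = (A - x) v], the hypothesis reads [A w = x w - y^2 v]; add up the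
   dissipation inequalities at [v] and [w]. *)
Lemma quadratic_injective x y (v : 'cV[H]_N) : 0 < x ->
  A *m (A *m v) + qreal (- (2 * x)) *: (A *m v) + qreal (x ^+ 2 + y ^+ 2) *: v = 0 ->
  v = 0.
Proof.
move=> x0 e.
pose L a b := ip (P *m a) b.
have LC a b : L a b = L b a by rewrite /L ip_adj hP ipC.
have pos a : 0 <= L a a.
  have [->|a0] := eqVneq a 0; first by rewrite /L mulmx0 ip0l.
  by rewrite /L ipC ltW// P_pd.
have zero a : L a a <= 0 -> a = 0.
  move=> La; apply/eqP; apply: contraT => /P_pd.
  by rewrite ipC ltNge La.
pose w := A *m v + qreal (- x) *: v.
have Av : A *m v = w + qreal x *: v by rewrite /w rmorphN scaleNr subrK.
have Aw : A *m w = qreal x *: w + qreal (- y ^+ 2) *: v.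
  apply/eqP; rewrite -subr_eq0 -[X in _ == X]e /w mulmxDr mulmxZr; apply/eqP.
  move: (A *m (A *m v)) => u; move: (A *m v) => t.
  apply/matrixP => i j; rewrite !mxE.
  case: (u i j) (t i j) (v i j) => a b c d [a' b' c' d'] [a1 b1 c1 d1].
  by congr Quat; rewrite /=; ring.
have h1 : L v (A *m v) <= 0 by exact: dissA.
have h2 : L w (A *m w) <= 0 by exact: dissA.
have l1 : L v (A *m v) = L v w + x * L v v by rewrite Av /L ipDr ipZr.
have l2 : L w (A *m w) = x * L w w - y ^+ 2 * L v w.
  by rewrite Aw /L ipDr !ipZr -/(L w v) LC mulNr.
have w0 : w = 0.
  apply: zero; have := pos v; have := pos w; have := sqr_ge0 y.
  rewrite l1 in h1; rewrite l2 in h2 => y2 pw pv.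
  have : x * L w w <= 0.
    have : y ^+ 2 * (L v w + x * L v v) <= 0 by rewrite mulr_ge0_le0.
    have : 0 <= y ^+ 2 * (x * L v v) by apply: mulr_ge0 => //; rewrite mulr_ge0// ltW.
    lra.
  by rewrite pmulr_rle0.
apply: zero; move: h1; rewrite l1 w0 {1}/L ip0r add0r.
by rewrite pmulr_rle0.
Qed.

Lemma quadratic_mx_injective l x y (V : 'M[H]_(N, l)) : 0 < x ->
  A *m (A *m V) + qreal (- (2 * x)) *: (A *m V) + qreal (x ^+ 2 + y ^+ 2) *: V = 0 ->
  V = 0.
Proof.
move=> x0 e; apply/matrixP => i j; rewrite mxE.
suff /colP/(_ i) : V *m delta_mx j 0 = 0 :> 'cV[H]_N by rewrite -colE !mxE.
apply: (@quadratic_injective x y) => //.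
have := congr1 (mulmx^~ (delta_mx j 0 : 'cV[H]_l)) e.
by rewrite !mulmxDl mul0mx -!scalemxAl -!mulmxA.
Qed.

(** A root x + I y with x > 0 makes [f] divisible by X - x or by X^2 - 2xX + x^2 + y^2. That factor
    is injective at [A], so the cofactor already annihilates [A], against minimality. *)
Lemma half_plane_nonroot f p : min_annihilator A f -> half_space p -> ev f p != 0.
Proof.
move=> [f0 fA fmin] p0; apply/eqP => fp.
have [y [SI pE]] := slice_unit_decomp p.
set I := slice_unit p in SI pE; set x := qre p in pE.
have I2 := imag_sphere_sqr SI.
have x0 : 0 < x by [].
have no_factor (g m : {poly R}) : (1 < size m)%N -> f = g * m ->
    mx_eval A g = 0 -> False.
  move=> sm fg gA; have g0 : g != 0.
    by apply: contra_neq f0 => g0; rewrite fg g0 mul0r.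
  have m0 : m != 0 by rewrite -size_poly_gt0 ltnW.
  have := fmin g g0 gA; rewrite fg size_mul// leqNgt => /negP; apply.
  by case: (size m) sm => [|[|k]] // _; rewrite !addnS /= ltnS leq_addr.
have [y0|y0] := eqVneq y 0.
  have px : p = qreal x by rewrite pE /slice_point y0 rmorph0 mulr0 addr0.
  have : root f x.
    by move: fp; rewrite px qpoly_eval_real => -[fx]; rewrite /root fx.
  move=> /factor_theorem[g fg]; apply: (no_factor _ _ _ fg).
    by rewrite size_XsubC.
  (* For y = 0 the quadratic is (X - x)^2, which kills whatever X - x kills. *)
  apply: (@quadratic_mx_injective _ x 0) => //.
  have e : A *m mx_eval A g = qreal x *: mx_eval A g.
    move: fA; rewrite fg (_ : g * _ = g * 'X + (- x) *: g); last first.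
      by rewrite -mul_polyC polyCN; ring.
    rewrite mx_evalD mx_evalMX mx_evalZ rmorphN scaleNr => /eqP.
    by rewrite subr_eq0 => /eqP.
  rewrite e mulmxZr e !scalerA -!scalerDl -!rmorphM -!rmorphD /=.
  rewrite (_ : _ + _ = 0) ?rmorph0 ?scale0r//; ring.
pose r1 := - (2 * x); pose r0 := x ^+ 2 + y ^+ 2.
pose m : {poly R} := 'X^2 + (r1 *: 'X + r0%:P).
have sm : size m = 3%N.
  rewrite size_polyDl size_polyXn// (leq_ltn_trans (size_polyD _ _))//.
  rewrite gtn_max !ltnS (leq_trans (size_scale_leq _ _)) ?size_polyX//.
  by rewrite (leq_trans (size_polyC_leq1 _)).
have mp : ev m p = 0.
  have evm (b c : R) : ev ('X^2 + (b *: 'X + c%:P)) p = p * p + qreal b * p + qreal c.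
    rewrite !rmorphD /= map_polyXn map_polyZ /= map_polyX map_polyC.
    by rewrite !hornerD hornerXn hornerZ hornerX hornerC expr2 addrA.
  rewrite evm.
  have -> : p = cval I (x, y) by rewrite pE.
  have cr t : qreal t = cval I (t, 0) by rewrite /cval /= rmorph0 mulr0 addr0.
  rewrite (cr r1) (cr r0) -!cvalM// -!cvalD (_ : _ + _ + _ = 0) ?cval0//.
  by apply: injective_projections; rewrite /= /r1 /r0; ring.
have sr : (size (modp f m) < 3)%N by rewrite -sm ltn_modp -size_poly_gt0 sm.
pose q := divp f m; pose s := modp f m.
have fE : f = q * m + s by exact: divp_eq.
have sp : ev s p = 0.
  move: fp; rewrite {1}fE rmorphD hornerD /= qpoly_evalM mp mulr0 add0r.
  by [].
(* A real polynomial of degree at most one has no non-real root unless it is zero. *)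
have s0 : s = 0.
  move: sp; rewrite (qpoly_evalE p (_ : size s <= 2)%N)//.
  rewrite !big_ord_recl big_ord0 /= expr0 expr1 mul1r addr0 pE => sp.
  have : cval I (s`_0 + x * s`_1, y * s`_1) = 0.
    rewrite -sp /cval /slice_point /= mulrDl rmorphD !rmorphM addrA.
    by rewrite mulrA.
  move=> /eqP; apply: contraTeq => s0; apply: cval_neq0 => //=.
  apply: contra_neq s0 => /eqP; rewrite paddr_eq0 ?sqr_ge0// !sqrf_eq0.
  rewrite mulf_eq0 (negbTE y0) /= => /andP[/eqP s00 /eqP s1].
  rewrite s1 mulr0 addr0 in s00.
  apply/polyP => -[|[|k]]; rewrite coef0//.
  by rewrite nth_default// (leq_trans _ (_ : 2 <= k.+2)%N).
rewrite s0 addr0 in fE; apply: (no_factor _ _ _ fE); first by rewrite sm.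
apply: (@quadratic_mx_injective _ x y) => //.
rewrite -fA fE (_ : q * m = q * 'X * 'X + r1 *: (q * 'X) + r0 *: q); last first.
  by rewrite -!mul_polyC /m -mul_polyC; ring.
by rewrite !mx_evalD !mx_evalZ !mx_evalMX.
Qed.

End HalfPlaneRoots.

(** * Positivity of the kernel from the matrix inequality *)

Section KernelPositivity.
Variables (n N : nat) (A : 'M[H]_N) (B : 'M[H]_(N, n)) (C : 'M[H]_(n, N)).
Variables (D : 'M[H]_n) (Q : 'M[H]_N) (phi : H -> 'M[H]_n) (Ga : H -> 'M[H]_(n, N)).
Hypothesis hQ : hermitian Q.
Hypothesis Q_ge0 : forall v, 0 <= ip v (Q *m v).
Hypothesis diss : forall a b, 0 <= - ip a (A *m (Q *m a)) + ip a (B *m b)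
  - ip b (C *m (Q *m a)) + ip b (D *m b).
Hypothesis Ga_sylv : forall p, half_space p -> p *: Ga p - Ga p *m A = C.
Hypothesis phiE : forall p, half_space p -> phi p = D + Ga p *m B.

Lemma psd_form_sum (I : finType) (G : I -> 'M[H]_(n, N)) (v : I -> 'cV[H]_n) :
  \sum_k \sum_j ip (v k) (G k *m Q *m qadj (G j) *m v j) =
  ip (\sum_k qadj (G k) *m v k) (Q *m (\sum_k qadj (G k) *m v k)).
Proof.
rewrite ip_suml; apply: eq_bigr => k _; rewrite mulmx_sumr ip_sumr.
by apply: eq_bigr => j _; rewrite -!mulmxA ip_adjr.
Qed.

(** Replace p Gamma by C + Gamma A, and its adjoint likewise. The form of p T + T conj q then
    depends only on a = sum Gamma_k^* w_k and b = sum w_k, and is twice the right side of [diss] at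
    (a, b). *)
Lemma kernel_form_ge0 M (u : 'I_M -> H) (v : 'I_M -> 'cV[H]_n) :
  (forall k, half_space (u k)) ->
  0 <= \sum_k \sum_j ip (v k) (caratheodory_kernel phi (u k) (u j) *m v j).
Proof.
move=> hu.
pose K k j := caratheodory_kernel phi (u k) (u j).
pose G k := Ga (u k).
pose T k j := K k j - G k *m Q *m qadj (G j).
have Therm k j : T k j = qadj (T j k).
  rewrite /T raddfB /= -caratheodory_hermitian// !qadjM hQ qadjK mulmxA.
  by [].
have lyap (w : 'I_M -> 'cV[H]_n) : 0 <= \sum_k \sum_j
    ip (w k) ((u k *: T k j + T k j *m (qconj (u j))%:M) *m w j).
  pose a := \sum_k qadj (G k) *m w k; pose b := \sum_k w k.
  pose g j := qadj (G j) *m w j.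
  have TE k j : (u k *: T k j + T k j *m (qconj (u j))%:M) *m w j =
      (D *m w j + qadj D *m w j + qadj B *m g j - C *m (Q *m g j)) +
      G k *m (B *m w j - Q *m (qadj C *m w j) - A *m (Q *m g j) - Q *m (qadj A *m g j)).
    have s1 : u k *: G k = C + G k *m A by rewrite -(Ga_sylv (hu k)) subrK.
    have s2 : qadj (G j) *m (qconj (u j))%:M = qadj C + qadj A *m qadj (G j).
      have := congr1 (@qadj R n N) (Ga_sylv (hu j)); rewrite raddfB /= qadjM => <-.
      rewrite subrK; apply/matrixP => i i'.
      by rewrite mulcol_scalarE !qadjE [X in _ = qconj X]mxE qconjM.
    have -> : u k *: T k j + T k j *m (qconj (u j))%:M = phi (u k) + qadj (phi (u j)) -
        ((C + G k *m A) *m Q *m qadj (G j) + G k *m Q *m (qadj C + qadj A *m qadj (G j))).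
      rewrite -(caratheodory_sylvester phi (hu k) (hu j)) -s1 -s2.
      rewrite -[caratheodory_kernel _ _ _]/(K k j).
      rewrite /T; move: (K k j) => X.
      by rewrite scalerBr mulmxBl addrACA -opprD !scalemxAl mulmxA.
    rewrite !phiE// raddfD /= qadjM /g.
    rewrite !(mulmxDl, mulmxDr, mulmxBl, mulmxBr, mulNmx, mulmxN) -!mulmxA.
    rewrite -!/(G _).
    move: (D *m w j) (qadj D *m w j) (qadj B *m _) (C *m (Q *m _))
      (G k *m (B *m w j)) (G k *m (Q *m (qadj C *m w j)))
      (G k *m (A *m _)) (G k *m (Q *m (qadj A *m _))) => x1 x2 x3 x4 x5 x6 x7 x8.
    apply/colP => i; rewrite !mxE.
    case: (x1 i 0) (x2 i 0) (x3 i 0) (x4 i 0) => ? ? ? ? [? ? ? ?] [? ? ? ?] [? ? ? ?].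
    case: (x5 i 0) (x6 i 0) (x7 i 0) (x8 i 0) => ? ? ? ? [? ? ? ?] [? ? ? ?] [? ? ? ?].
    by congr Quat; rewrite /=; ring.
  have aE : a = \sum_j g j by [].
  have -> : \sum_k \sum_j ip (w k) ((u k *: T k j + T k j *m (qconj (u j))%:M) *m w j) =
      2 * (- ip a (A *m (Q *m a)) + ip a (B *m b) - ip b (C *m (Q *m a)) + ip b (D *m b)).
    transitivity (\sum_k ip (w k) (
       (D *m b + qadj D *m b + qadj B *m a - C *m (Q *m a)) +
       G k *m (B *m b - Q *m (qadj C *m b) - A *m (Q *m a) - Q *m (qadj A *m a)))).
      apply: eq_bigr => k _; rewrite -ip_sumr; congr ip.
      under eq_bigr do rewrite TE.
      rewrite big_split -mulmx_sumr /= !sumrB !big_split /= -!mulmx_sumr.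
      by rewrite -aE.
    under eq_bigr do rewrite ipDr ip_adjr.
    rewrite big_split -!ip_suml -/a -/b !ipBr !ipDr.
    have t1 : ip b (qadj D *m b) = ip b (D *m b) by rewrite -ip_adj ipC.
    have t2 : ip b (qadj B *m a) = ip a (B *m b) by rewrite -ip_adj ipC.
    have t3 : ip a (Q *m (qadj C *m b)) = ip b (C *m (Q *m a)).
      by rewrite ip_adjr hQ -ip_adj ipC.
    have t4 : ip a (Q *m (qadj A *m a)) = ip a (A *m (Q *m a)).
      by rewrite ip_adjr hQ -ip_adj ipC.
    by rewrite t1 t2 t3 t4 /=; ring.
  by rewrite mulr_ge0.
have := lyapunov_family hu Therm lyap v.
have -> : \sum_k \sum_j ip (v k) (K k j *m v j) = 
   \sum_k \sum_j ip (v k) (T k j *m v j) + \sum_k \sum_j ip (v k) (G k *m Q *m qadj (G j) *m v j).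
  rewrite -big_split; apply: eq_bigr => k _; rewrite -big_split; apply: eq_bigr => j _.
  by rewrite /= -ipDr -mulmxDl subrK.
by move=> h; rewrite psd_form_sum addr_ge0.
Qed.

Lemma kernel_positive : positive_definite_kernel half_space (caratheodory_kernel phi).
Proof.
split=> [u v u0 v0|M u xi hu x x0 [c c0 cx]]; first exact: caratheodory_hermitian.
rewrite mulmx_scalar_real in cx.
(* The coordinates of the eigenvector are absorbed into the [xi k]; the form then equals x |c|^2 <
   0. *)
pose v k := xi k *m (c k 0)%:M.
have := kernel_form_ge0 v hu.
suff -> : \sum_k \sum_j ip (v k) (caratheodory_kernel phi (u k) (u j) *m v j) = x * ip c c.
  by rewrite nmulr_rge0// leNgt ip_gt0.
rewrite -ipZr -cx ipE; apply: eq_bigr => k _.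
rewrite mxE mulr_sumr raddf_sum; apply: eq_bigr => j _ /=.
rewrite mxE /v /ip qadjM qadj_scalar !mulmxA.
rewrite mulcol_scalarE -!mulmxA mul_scalar_mx mxE -mulrA.
by congr (qre (_ * (_ * _))); rewrite !mulmxA.
Qed.

End KernelPositivity.
End Sufficiency.

(** * The realization as a rational function, and the equivalence *)

Section MainTheorem.
Variable R : realType.
Notation H := (quat R).
Variables (n N : nat) (Omega : set H) (phi : H -> 'M[H]_n).
Variables (A : 'M[H]_N) (B : 'M[H]_(N, n)) (C : 'M[H]_(n, N)) (D : 'M[H]_n).
Hypothesis phi_realization : realization Omega phi A B C D.
Local Notation ev f p := ((map_poly (@qreal R) f).[p]).

Lemma realization_real (f : {poly R}) x : mx_eval A f = 0 -> f.[x] != 0 ->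
  Omega (qreal x) -> phi (qreal x) = transfer A B C D f x.
Proof.
move=> fA fx Ox; have [G [_ GE] phiE] := phi_realization.
rewrite phiE// /transfer; congr (_ + _).
by apply: GE => //; [exact: mulmx_resolventl | exact: mulmx_resolventr].
Qed.

(** Numerator coefficients of D + Gamma B over the common real denominator [f]. *)
Definition realization_coef (f : {poly R}) k : 'M[H]_n :=
  qreal f`_k *: D + C *m rcoef A f k *m B.

Lemma ratf_realization f p : ev f p != 0 ->
  ratf f (size f) (realization_coef f) p = D + (ev f p)^-1 *: gam A f C p *m B.
Proof.
move=> fp; rewrite /ratf /realization_coef.
under eq_bigr do rewrite scalerDr.
rewrite big_split /= scalerDr; congr (_ + _).
  under eq_bigr do rewrite scalerA.
  by rewrite -scaler_suml -qpoly_evalE// scalerA mulVr// scale1r.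
rewrite -scalemxAl; congr (_ *: _); rewrite /gam mulmx_suml.
by apply: eq_bigr => k _; rewrite scalemxAl.
Qed.

Lemma realization_real_sum (f : {poly R}) x : mx_eval A f = 0 -> f.[x] != 0 ->
  Omega (qreal x) ->
  qreal f.[x] *: phi (qreal x) =
  \sum_(k < size f) qreal x ^+ k *: realization_coef f k.
Proof.
move=> fA fx Ox; have fq : ev f (qreal x) != 0.
  by rewrite qpoly_eval_real qreal_neq0.
have : phi (qreal x) = ratf f (size f) (realization_coef f) (qreal x).
  rewrite (realization_real fA fx Ox) ratf_realization// qpoly_eval_real.
  rewrite /transfer; congr (_ + _ *m B).
  by rewrite -gam_realE// rmorphV ?unitfE.
have qx : qreal f.[x] \is a GRing.unit by rewrite /in_mem /= qreal_neq0.
by rewrite /ratf qpoly_eval_real => ->; rewrite scalerA divrr ?scale1r.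
Qed.

End MainTheorem.

Unset Implicit Arguments.

Theorem theorem4p1 (R : realType) (n N : nat)
    (Omega : set (quat R)) (phi : quat R -> 'M[quat R]_n)
    (A : 'M[quat R]_N) (B : 'M[quat R]_(N, n))
    (C : 'M[quat R]_(n, N)) (D : 'M[quat R]_n)
    (phi_rational : rational_slice_hyperholomorphic Omega phi)
    (phi_infinity : slice_hyperholomorphic_at_infinity Omega phi)
    (phi_realization : realization Omega phi A B C D)
    (phi_minimal : minimal_realization A B C) :
  (half_space `<=` Omega /\
   positive_definite_kernel half_space (caratheodory_kernel phi))
  <->
  (exists H : 'M[quat R]_N,
     negative_definite H /\
     positive_semidefinite
       (block_mx H 0 0 (1%:M : 'M[quat R]_n) *m block_mx A B C D
        + qadj (block_mx A B C D) *m block_mx H 0 0 (1%:M : 'M[quat R]_n))).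
Proof.
have [f fmin] := min_annihilator_exists A; have [f0 fA _] := fmin.
split=> [[half pos]|[P [negP psd]]].
  apply: (lmi_of_positive_kernel f0 fA _ phi_minimal pos) => x /andP[x0 fx].
  by apply: (realization_real phi_realization fA fx); apply: half.
have [hP P_neg] := negative_definite_ip negP.
have {}psd := (lmi_psdP A B C D hP).1 psd.
have hNP : hermitian (- P) by rewrite /Defs.hermitian raddfN /= hP.
have NP_pd (v : 'cV[quat R]_N) : v != 0 -> 0 < ip v (- P *m v).
  by move=> /P_neg; rewrite mulNmx ipNr oppr_gt0.
have dissA v : ip (- P *m v) (A *m v) <= 0.
  have := psd v 0; rewrite mulmx0 addr0 ip0l addr0.
  by rewrite mulNmx ipNl oppr_le0.
have fp p : half_space p -> (map_poly (@qreal R) f).[p] != 0.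
  exact: half_plane_nonroot hNP NP_pd dissA _ _ fmin.
have [slice_phi [d [l [S [d0 dom phiE]]]] maximal] := phi_rational.
have [r [r_sub _]] := phi_infinity.
pose M := realization_coef A B C D f.
have agree p : Omega p -> (map_poly (@qreal R) f).[p] != 0 ->
    phi p = ratf f (size f) M p.
  (* Beyond [r] a real point lies in [Omega]; being positive, it lies in the half-space, where [f]
     has no root. *)
  apply: (agree_on_domain slice_phi d0 f0 dom phiE (r := Num.max 0 r)) => x.
  rewrite gt_max => /andP[x0 rx].
  have Ox : Omega (qreal x).
    apply: r_sub => /=; rewrite -[qreal x]mul1r qnormZ gtr0_norm//.
    by rewrite /qnorm /qnormsq /= expr0n expr1n /= !addr0 sqrtr1 mulr1.
  split => //; apply: (realization_real_sum phi_realization) => //.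
  by rewrite -qreal_neq0 -qpoly_eval_real; exact: fp.
(* The glued function extends [phi] to the union of [Omega] and the half-space; maximality puts this
   union inside [Omega]. *)
have half : half_space `<=` Omega.
  have := maximal _ _ (slice_glue (F := f) (K := size f) (M := M) slice_phi
    (@half_space_open R) (@half_space_symmetric R) fp (fun p Op hp => agree p Op (fp p hp))).
  move=> h p hp; apply: h; [by left|move=> q Oq; by rewrite asboolT|by right].
split => //.
have [Q PQ QP] := mulmx_injective_invertible (pd_injective NP_pd).
apply: (@kernel_positive R n N A B C D Q phi
  (fun p => (map_poly (@qreal R) f).[p]^-1 *: gam A f C p)).
- exact: mulmx_inv_hermitian hNP PQ.
- move=> v; have [->|v0] := eqVneq v 0; first by rewrite mulmx0 ip0r.
  exact: ltW (pd_inverse_pd PQ NP_pd v0).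
(* [Q] inverts [- P], so [P *m (Q *m a)] is [- a], and the sign of [b] is chosen to match. *)
- move=> a b; have := psd (Q *m a) (- b).
  have -> : P *m (Q *m a) = - a.
    by rewrite mulmxA -[P]opprK mulNmx PQ mulNmx mul1mx.
  by rewrite !mulmxN !ipBr !ipNl; lra.
- move=> p hp.
  have pc : p * (map_poly (@qreal R) f).[p]^-1 = (map_poly (@qreal R) f).[p]^-1 * p.
    by apply: commrV; apply/esym; exact: qpoly_comm.
  rewrite scalerA pc -scalerA -scalemxAl -scalerBr gam_sylvester// scalerA mulVr ?scale1r//.
  exact: fp.
- move=> p hp; rewrite agree ?fp//; last exact: half.
  by rewrite ratf_realization// fp.
Qed.
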